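(* Let $x_m$ ($m\ge1$), $y$, $z$ denote the classes in $\Theta(\mathfrak{T})$ of the marked trees $X_m$, $Y$, $Z$. There is a ring isomorphism $$i\colon\Theta(\mathfrak{T})\to\mathbf{Z}[u,v]/(uv)$$ satisfying $$i(x_1)=u+v+2,\quad i(x_2)=u+v+1,\quad i(x_3)=u+v,$$ $$i(x_m)=v+1-(m-2)(u+1)\ \text{ for } m\ge4,\quad i(y)=u,\quad i(z)=u-v.$$
   Context: **Trees.** A tree is a finite connected simple graph without cycles (the empty tree and the one-point tree are allowed; the vertex of the one-point tree counts as a leaf). Vertices of valence one are leaves, others nodes. The leaf set $L(T)$ carries the quaternary relation: $R(x_1,x_2;y_1,y_2)$ iff the four leaves are distinct and the shortest path joining $x_1,x_2$ has a common edge with the shortest path joining $y_1,y_2$. A tree structure is a finite set with a quaternary relation isomorphic to some $L(T)$; $\mathfrak{T}$ is the class of tree structures. Isomorphism classes of tree structures correspond to reduced trees (no nodes of valence two). **Amalgamations.** An embedding of structures is an injection that is an isomorphism onto its image with the induced relation. For embeddings $i_\alpha\colon X\to Y_\alpha$ in $\mathfrak{T}$, an amalgamation of $Y_1,Y_2$ over $X$ is $Z\in\mathfrak{T}$ with jointly surjective embeddings $j_\alpha\colon Y_\alpha\to Z$ with $j_1i_1=j_2i_2$, up to isomorphism. **$\Theta(\mathfrak{T})$.** The commutative ring generated by symbols $[i]$ for embeddings $i$ in $\mathfrak{T}$, with relations: $[i]=1$ for isomorphisms; $[j\circ i]=[j][i]$; and, for embeddings $i\colon X\to Y$ and $X\to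 X'$ with amalgamations $i'_\alpha\colon X'\to Y'_\alpha$, $[i]=\sum_\alpha[i'_\alpha]$. The class of a marked tree $(T,a)$ ($a$ a leaf of $T$) is the class of the inclusion $T\setminus a\to T$. **The marked trees.** $X_1$, $X_2$ are the unique marked trees with 1 and 2 leaves. For $m\ge3$, $X_m$ has one node with $m$ leaves attached, one marked. $Y$ has two adjacent nodes, each with two leaves attached, one of the four leaves being marked. $Z$ has three nodes in a path; each end node has two leaves attached, the middle node has one leaf attached, and that leaf is marked. *)

(* Defs.v *)
From HB Require Import structures.
From mathcomp Require Import all_boot all_algebra.
From mathcomp Require Import generic_quotient ring_quotient.
From mathcomp Require Import boolp.
From mathcomp.multinomials Require Import monalg.

Set Implicit Arguments.
Unset Strict Implicit.
Unset Printing Implicit Defensive.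

Import GRing.Theory.
Local Open Scope ring_scope.
Local Open Scope quotient_scope.

(* [ucycle e c] forbids repeated vertices; the bound 2 discounts the
   degenerate closed walk x, y, x along a single edge. *)
Record is_tree (V : finType) (e : rel V) : Prop := IsTree {
  tree_sym : symmetric e;
  tree_irr : irreflexive e;
  tree_conn : forall x y, connect e x y;
  tree_acyclic : forall c : seq V, ucycle e c -> (size c <= 2)%N }.

(* The second disjunct is the one-point tree, whose vertex counts as a leaf. *)
Definition leaf (V : finType) (e : rel V) (x : V) : bool :=
  (#|[set y | e x y]| == 1)%N || (#|V| == 1)%N.

Definition shortest_path (V : finType) (e : rel V) (x y : V) (p : seq V) :=
  [/\ path e x p, last x p = y &
      forall q, path e x q -> last x q = y -> (size p <= size q)%N].

Definition edge_of (V : finType) (x : V) (p : seq V) (a b : V) : bool :=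
  ((a, b) \in zip (x :: p) p) || ((b, a) \in zip (x :: p) p).

Definition quat (X : Type) := X -> X -> X -> X -> Prop.

Definition path_rel (V : finType) (e : rel V) : quat V :=
  fun x1 x2 y1 y2 =>
    uniq [:: x1; x2; y1; y2] /\
    exists p q a b, [/\ shortest_path e x1 x2 p, shortest_path e y1 y2 q,
                        edge_of x1 p a b & edge_of y1 q a b].

Definition leaves (V : finType) (e : rel V) : finType := {x : V | leaf e x}.

Definition leaf_rel (V : finType) (e : rel V) : quat (leaves e) :=
  fun x1 x2 y1 y2 => path_rel e (val x1) (val x2) (val y1) (val y2).

Definition is_tree_structure (X : finType) (R : quat X) : Prop :=
  exists (V : finType) (e : rel V), is_tree e /\
  exists f : X -> leaves e, bijective f /\
    forall x1 x2 y1 y2,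
      R x1 x2 y1 y2 <-> leaf_rel (f x1) (f x2) (f y1) (f y2).

Record treeStr := TreeStr {
  carrier :> finType;
  qrel : quat carrier;
  treeStrP : is_tree_structure qrel }.

Record embedding (X Y : treeStr) := Embedding {
  emb_fun :> X -> Y;
  emb_inj : injective emb_fun;
  emb_rel : forall x1 x2 y1 y2, qrel x1 x2 y1 y2 <->
    qrel (emb_fun x1) (emb_fun x2) (emb_fun y1) (emb_fun y2) }.

Lemma emb_comp_inj (X Y Z : treeStr) (j : embedding Y Z) (i : embedding X Y) :
  injective (j \o i).
Proof. exact: inj_comp (@emb_inj _ _ j) (@emb_inj _ _ i). Qed.

Lemma emb_comp_rel (X Y Z : treeStr) (j : embedding Y Z) (i : embedding X Y)
    x1 x2 y1 y2 :
  qrel x1 x2 y1 y2 <->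
  qrel ((j \o i) x1) ((j \o i) x2) ((j \o i) y1) ((j \o i) y2).
Proof. by rewrite (emb_rel i) (emb_rel j). Qed.

Definition emb_comp (X Y Z : treeStr) (j : embedding Y Z) (i : embedding X Y) :=
  Embedding (@emb_comp_inj _ _ _ j i) (@emb_comp_rel _ _ _ j i).

Section Paths.
Variables (V : finType) (e : rel V).

Lemma shortest_path_uniq x y p : shortest_path e x y p -> uniq (x :: p).
Proof.
case=> ep <- min_p; case/shortenP: (ep) (min_p) => q eq uq sub_qp le_p.
have szq : (size p <= size q)%N by exact: le_p.
apply: leq_size_uniq uq _ _ => // z.
by rewrite !inE => /orP[->|/sub_qp->] //; rewrite orbT.
Qed.

Hypothesis esym : symmetric e.

Lemma path_avoids_leaf a x p : #|[set y | e a y]| = 1%N ->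
  path e x p -> uniq (x :: p) -> a != x -> a != last x p -> a \notin p.
Proof.
move=> val1 ep up ax alast; apply/negP => /splitPr pa.
case: p / pa ep up alast => p1 [|z p2]; first by rewrite last_cat /= eqxx.
rewrite cat_path => /andP[_ /andP[e1 /andP[e2 _]]] up _.
have /eqP/cards1P[w wP] := val1.
have : z \in [set w] by rewrite -wP inE.
have : last x p1 \in [set w] by rewrite -wP inE esym.
rewrite !inE => /eqP lw /eqP zw; move: up.
rewrite -cat_cons cat_uniq => /and3P[_ /negP[]].
by have := mem_last x p1; rewrite lw -zw => zp /=; rewrite zp orbT.
Qed.

End Paths.

Section DeleteLeaf.
Variables (V : finType) (e : rel V) (a : V).
Hypotheses (eT : is_tree e) (a1 : #|[set y | e a y]| = 1%N).

Let V' : finType := {x : V | x != a}.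
Let e' : rel V' := relpre val e.

Lemma lift_path (x : V') p : path e (val x) p -> uniq (val x :: p) ->
  last (val x) p != a ->
  exists p' : seq V', p = map val p' /\ path e' x p'.
Proof.
move=> ep up la.
have ap : a \notin p.
  apply: (path_avoids_leaf (tree_sym eT) a1 ep up); last by rewrite eq_sym.
  by rewrite eq_sym (valP x).
have [p' pE] : exists p' : seq V', p = map val p'.
  elim: p ap {ep up la} => [|y p IHp]; first by exists [::].
  rewrite inE negb_or eq_sym => /andP[ya /IHp[p' ->]].
  by exists (Sub y ya :: p').
by exists p'; split=> //; move: ep; rewrite pE path_map.
Qed.

Lemma delete_shortest (x y : V') p :
  shortest_path e (val x) (val y) p <->
  exists2 p', p = map val p' & shortest_path e' x y p'.
Proof.
split=> [sp|[p' -> [ep <- min_p]]].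
  have [ep lp min_p] := sp.
  have [p' [pE ep']] : exists p' : seq V', p = map val p' /\ path e' x p'.
    apply: lift_path (shortest_path_uniq sp) _ => //.
    by rewrite lp (valP y).
  exists p' => //; split=> // [|q eq lq].
    by apply: val_inj; rewrite -lp pE last_map.
  have := min_p (map val q); rewrite pE !size_map; apply.
    by rewrite path_map.
  by rewrite last_map lq.
split; rewrite ?path_map ?last_map // => q eq.
case/shortenP: eq => q1 eq1 uq1 sub_q1 lq1.
have [q' [qE eq']] : exists q' : seq V', q1 = map val q' /\ path e' x q'.
  by apply: lift_path => //; rewrite lq1 (valP (last x p')).
have : (size p' <= size q')%N.
  by apply: min_p => //; apply: val_inj; rewrite -lq1 qE last_map.
move=> le_p; rewrite size_map (leq_trans le_p) //.
rewrite -(size_map val q') -qE; apply: uniq_leq_size => //.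
by case/andP: uq1.
Qed.

Lemma delete_edge_of (x : V') p (b c : V) :
  edge_of (val x) (map val p) b c <->
  exists b' c' : V', [/\ b = val b', c = val c' & edge_of x p b' c'].
Proof.
have zipE : zip (val x :: map val p) (map val p)
          = [seq (val u.1, val u.2) | u <- zip (x :: p) p].
  by rewrite -map_cons; elim: p (x :: p) => [|y p IHp] [|z q] //=; rewrite IHp.
have inj2 : injective (fun u : V' * V' => (val u.1, val u.2)).
  by move=> [b1 c1] [b2 c2] [/val_inj-> /val_inj->].
rewrite /edge_of zipE; split=> [|[b' [c' [-> -> ]]]].
  by case/orP=> /mapP[[b' c'] /= bc [-> ->]];
     [exists b', c'|exists c', b']; split=> //; rewrite bc ?orbT.
by rewrite (mem_map inj2 _ (b', c')) (mem_map inj2 _ (c', b')).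
Qed.

Lemma delete_path_rel (x1 x2 y1 y2 : V') :
  path_rel e (val x1) (val x2) (val y1) (val y2) <-> path_rel e' x1 x2 y1 y2.
Proof.
have uE : uniq [:: val x1; val x2; val y1; val y2] = uniq [:: x1; x2; y1; y2].
  by rewrite -(map_inj_uniq val_inj).
rewrite /path_rel uE; split=> -[u [p [q [b [c [sp sq ep eq]]]]]]; split=> //.
  have /delete_shortest[p' pE sp'] := sp; have /delete_shortest[q' qE sq'] := sq.
  move: ep eq; rewrite {}pE {}qE => /delete_edge_of[b' [c' [-> -> ep']]].
  case/delete_edge_of=> b'' [c'' [/val_inj<- /val_inj<- eq']].
  by exists p', q', b', c'.
exists (map val p), (map val q), (val b), (val c); split.
- by apply/delete_shortest; exists p.
- by apply/delete_shortest; exists q.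
- by apply/delete_edge_of; exists b, c.
- by apply/delete_edge_of; exists b, c.
Qed.

Lemma delete_is_tree : is_tree e'.
Proof.
split.
- by move=> x y; apply: (tree_sym eT).
- by move=> x; apply: (tree_irr eT).
- move=> x y; have /connectP[p ep lp] := tree_conn eT (val x) (val y).
  move: lp; case/shortenP: ep => q eq uq _ lq.
  have [q' [qE eq']] : exists q' : seq V', q = map val q' /\ path e' x q'.
    by apply: lift_path => //; rewrite -lq (valP y).
  by apply/connectP; exists q' => //; apply: val_inj; rewrite lq qE last_map.
- move=> c /andP[ec uc]; rewrite -(size_map val); apply: (tree_acyclic eT).
  by rewrite /ucycle map_inj_uniq ?uc ?andbT ?cycle_map //; apply: val_inj.
Qed.

Lemma delete_leaf (x : V') : leaf e (val x) -> leaf e' x.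
Proof.
case/orP=> [/cards1P[w wP]|/eqP/fintype1[z zP]]; last first.
  by have := valP x; rewrite (zP (val x)) (zP a) eqxx.
have xw y : e (val x) y = (y == w) by rewrite -[RHS]in_set1 -wP inE.
apply/orP; have [wa|wa] := eqVneq w a; [right|left].
  apply/eqP; rewrite -(cardsT V'); apply/eqP/cards1P; exists x.
  apply/setP=> y; rewrite !inE.
  have /connectP[[|z p] /= ep lp] := tree_conn delete_is_tree x y.
    by rewrite lp eqxx.
  by move: ep; rewrite /e' /= xw wa (negPf (valP z)).
apply/cards1P; exists (Sub w wa); apply/setP=> y.
by rewrite !inE /e' /= xw.
Qed.

End DeleteLeaf.

Lemma is_tree_structure_sub (X : finType) (R : quat X) (V : finType)
    (e : rel V) (f : X -> V) :
  is_tree e -> injective f -> (forall x, leaf e (f x)) ->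
  (forall x1 x2 y1 y2,
    R x1 x2 y1 y2 <-> path_rel e (f x1) (f x2) (f y1) (f y2)) ->
  is_tree_structure R.
Proof.
have [n] := ubnP #|V|; elim: n => // n IHn in V e f *.
rewrite ltnS => leVn eT f_inj f_leaf RE.
have [/forallP f_onto|] := boolP [forall a, leaf e a ==> (a \in codom f)].
  pose g x : leaves e := Sub (f x) (f_leaf x).
  exists V, e; split=> //; exists g; split; last exact: RE.
  have g_inj : injective g by move=> x y [/f_inj].
  have g_onto (b : leaves e) : exists x, g x == b.
    have /implyP/(_ (valP b))/codomP[x bE] := f_onto (val b).
    by exists x; rewrite -val_eqE /= -bE.
  have gK : cancel (fun b => xchoose (g_onto b)) g.
    by move=> b; apply/eqP; apply: (xchooseP (g_onto b)).
  exists (fun b => xchoose (g_onto b)) => // x.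
  by apply: g_inj; rewrite gK.
case/forallPn=> a; rewrite negb_imply => /andP[la /codomP a_f].
have fa x : f x != a by apply/eqP => fxa; apply: a_f; exists x.
have ltV' : (#|{: {x : V | x != a}}| < n)%N.
  apply: leq_trans leVn; rewrite card_sig; apply: proper_card.
  apply/properP; split; first exact/subsetP.
  by exists a => //; rewrite !inE eqxx.
case/orP: la => [/eqP a1|/eqP V1]; last first.
  have X0 (x : X) : False.
    by have [z zP] := fintype1 V1; have := fa x; rewrite (zP (f x)) (zP a) eqxx.
  exists void, (fun _ _ => false); split.
    by split=> [[]|[]|[]|[|[]]].
  exists (fun x => False_rect _ (X0 x)); split=> [|x]; last by case: (X0 x).
  by exists (fun b => of_void X (val b)) => [x|[[]]]; case: (X0 x).
apply: (IHn _ _ (fun x => Sub (f x) (fa x) : {x : V | x != a}) ltV').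
- exact: delete_is_tree eT a1.
- by move=> x y [/f_inj].
- by move=> x; apply: delete_leaf => //; apply: f_leaf.
- by move=> *; rewrite RE -(delete_path_rel eT a1).
Qed.

Lemma leaf_rel_tree (V : finType) (e : rel V) :
  is_tree e -> is_tree_structure (@leaf_rel V e).
Proof. by move=> eT; exists V, e; split=> //; exists id; split=> //; exists id. Qed.

Definition leafStr (V : finType) (e : rel V) (eT : is_tree e) : treeStr :=
  TreeStr (leaf_rel_tree eT).

Lemma is_tree_structure_emb (X : finType) (Y : treeStr) (f : X -> Y) :
  injective f ->
  is_tree_structure (fun x1 x2 y1 y2 => qrel (f x1) (f x2) (f y1) (f y2)).
Proof.
move=> f_inj; have [V [e [eT [g [g_bij gR]]]]] := treeStrP Y.
apply: (is_tree_structure_sub (f := fun x => val (g (f x))) eT).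
- by move=> x y /val_inj/(bij_inj g_bij)/f_inj.
- by move=> x; apply: (valP (g (f x))).
- by move=> *; rewrite gR.
Qed.

Definition induced (X : finType) (Y : treeStr) (f : X -> Y)
  (f_inj : injective f) : treeStr := TreeStr (is_tree_structure_emb f_inj).

Definition induced_emb (X : finType) (Y : treeStr) (f : X -> Y)
    (f_inj : injective f) : embedding (induced f_inj) Y :=
  @Embedding (induced f_inj) Y f f_inj (fun _ _ _ _ => iff_refl _).

Record markedTree := MarkedTree {
  mt_vertex : finType;
  mt_edge : rel mt_vertex;
  mt_tree : is_tree mt_edge;
  mt_mark : mt_vertex;
  mt_leaf : leaf mt_edge mt_mark }.

Section Inclusion.
Variable T : markedTree.

Definition unmarked : finType :=
  {x : leafStr (mt_tree T) | val x != mt_mark T}.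

Definition unmarked_incl (x : unmarked) : leafStr (mt_tree T) := val x.

Lemma unmarked_inj : injective unmarked_incl.
Proof. exact: val_inj. Qed.

Definition marked_emb : embedding (induced unmarked_inj) (leafStr (mt_tree T)) :=
  induced_emb unmarked_inj.

End Inclusion.

(* Symbols [i] are indexed by embeddings between tree structures carried by
   some 'I_n, so that they form a small type.  Since [i] = 1 for isomorphisms
   and [j \o i] = [j] [i], this gives the same ring as using all embeddings;
   [cls] below sends an arbitrary embedding to its class. *)

Record skel := Skel {
  skel_size : nat;
  skel_rel : quat 'I_skel_size;
  skelP : is_tree_structure skel_rel }.

Coercion skel_str (X : skel) : treeStr := TreeStr (skelP X).

Definition skel_of (X : treeStr) : skel :=
  Skel (is_tree_structure_emb (@enum_val_inj X X)).

Section SkelEmbedding.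
Variables (X Y : treeStr) (i : embedding X Y).

Definition skel_fun (x : skel_of X) : skel_of Y := enum_rank (i (enum_val x)).

Lemma skel_fun_inj : injective skel_fun.
Proof. by move=> x y /enum_rank_inj/(@emb_inj _ _ i)/enum_val_inj. Qed.

Lemma skel_fun_rel x1 x2 y1 y2 : qrel x1 x2 y1 y2 <->
  qrel (skel_fun x1) (skel_fun x2) (skel_fun y1) (skel_fun y2).
Proof. by rewrite /= !enum_rankK; apply: (emb_rel i). Qed.

Definition skel_emb : embedding (skel_of X) (skel_of Y) :=
  Embedding skel_fun_inj skel_fun_rel.

End SkelEmbedding.

Record amalgamation (X Y1 Y2 : skel)
    (i1 : embedding X Y1) (i2 : embedding X Y2) := Amalgamation {
  am_str :> skel;
  am1 : embedding Y1 am_str;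
  am2 : embedding Y2 am_str;
  am_comm : forall x, am1 (i1 x) = am2 (i2 x);
  am_surj : forall z, (exists y, am1 y = z) \/ (exists y, am2 y = z) }.

Definition amalg_iso (X Y1 Y2 : skel)
    (i1 : embedding X Y1) (i2 : embedding X Y2) (a b : amalgamation i1 i2) :=
  exists h : embedding a b, [/\ bijective h,
    forall y, h (am1 a y) = am1 b y & forall y, h (am2 a y) = am2 b y].

(* The library's {ideal_quot _} requires a proof that the ideal is proper; this
   quotient by the ideal generated by S does not, and so may be the zero ring. *)

Section IdealQuotient.
Variables (R : comNzRingType) (S : R -> Prop).

Inductive gen_ideal : R -> Prop :=
| gen_ideal_gen x : S x -> gen_ideal x
| gen_ideal0 : gen_ideal 0
| gen_idealD x y : gen_ideal x -> gen_ideal y -> gen_ideal (x + y)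
| gen_idealM a x : gen_ideal x -> gen_ideal (a * x).

Definition ideal_pred : R -> bool := fun x => `[< gen_ideal x >].

Lemma ideal_pred_closed : zmod_closed ideal_pred.
Proof.
split=> [|x y]; rewrite /in_mem /=; first exact/asboolP/gen_ideal0.
move=> /asboolP Ix /asboolP Iy; apply/asboolP/gen_idealD => //.
by rewrite -mulN1r; apply: gen_idealM.
Qed.

HB.instance Definition _ := GRing.isZmodClosed.Build R ideal_pred
  ideal_pred_closed.

Definition generated_ideal : zmodClosed R :=
  GRing.ZmodClosed.clone R ideal_pred _.

Definition ideal_quotient : Type := Quotient.quot generated_ideal.
HB.instance Definition _ := GRing.Zmodule.on ideal_quotient.

Definition proj (x : R) : ideal_quotient := \pi_(Quotient.quot generated_ideal) x.

Lemma projP x y : proj x = proj y <-> gen_ideal (x - y).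
Proof.
by split=> [/eqP|Ixy]; [|apply/eqP]; rewrite -Quotient.idealrBE;
   [move/asboolP|apply/asboolP].
Qed.

Lemma proj_is_zmod_morphism : zmod_morphism proj.
Proof. exact: (raddfB \pi_(Quotient.quot generated_ideal)). Qed.

Definition proj_repr (x : ideal_quotient) : R :=
  repr (x : Quotient.quot generated_ideal).

Lemma proj_reprK : cancel proj_repr proj.
Proof. exact: (@reprK _ (Quotient.quot generated_ideal)). Qed.

Definition quot_mul (x y : ideal_quotient) : ideal_quotient :=
  proj (proj_repr x * proj_repr y).

Lemma quot_mulE x y : quot_mul (proj x) (proj y) = proj (x * y).
Proof.
have repP z : gen_ideal (proj_repr (proj z) - z).
  by apply/projP; rewrite proj_reprK.
apply/projP; set x' := proj_repr _; set y' := proj_repr _.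
have -> : x' * y' - x * y = x' * (y' - y) + y * (x' - x).
  by rewrite !mulrBr addrA [y * x']mulrC subrK [y * x]mulrC.
by apply: gen_idealD; apply: gen_idealM; apply: repP.
Qed.

Lemma proj_surj x : exists a, proj a = x.
Proof. by exists (proj_repr x); apply: proj_reprK. Qed.

Lemma quot_mulA : associative quot_mul.
Proof.
move=> x y z; have [a <-] := proj_surj x; have [b <-] := proj_surj y.
by have [c <-] := proj_surj z; rewrite !quot_mulE mulrA.
Qed.

Lemma quot_mulC : commutative quot_mul.
Proof.
move=> x y; have [a <-] := proj_surj x; have [b <-] := proj_surj y.
by rewrite !quot_mulE mulrC.
Qed.

Lemma quot_mul1 : left_id (proj 1) quot_mul.
Proof. by move=> x; have [a <-] := proj_surj x; rewrite quot_mulE mul1r. Qed.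

Lemma quot_mulD : left_distributive quot_mul +%R.
Proof.
have projD a b : proj (a + b) = proj a + proj b.
  exact: (raddfD \pi_(Quotient.quot generated_ideal)).
move=> x y z; have [a <-] := proj_surj x; have [b <-] := proj_surj y.
by have [c <-] := proj_surj z; rewrite -projD !quot_mulE mulrDl projD.
Qed.

HB.instance Definition _ := GRing.Zmodule_isComPzRing.Build ideal_quotient
  quot_mulA quot_mulC quot_mul1 quot_mulD.

Lemma proj_is_monoid_morphism : monoid_morphism proj.
Proof. by split=> // x y; rewrite -quot_mulE. Qed.

HB.instance Definition _ := GRing.isZmodMorphism.Build R ideal_quotient proj
  proj_is_zmod_morphism.
HB.instance Definition _ := GRing.isMonoidMorphism.Build R ideal_quotient proj
  proj_is_monoid_morphism.

End IdealQuotient.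

Definition freeComRing (G : choiceType) : comNzRingType := {malg int[{cmonom G}]}.

Definition var (G : choiceType) (g : G) : freeComRing G := << ucm g >>.

Record symbol := Symbol {
  sym_dom : skel;
  sym_cod : skel;
  sym_emb : embedding sym_dom sym_cod }.

Definition symRing : comNzRingType := freeComRing {classic symbol}.

Definition sym (X Y : skel) (i : embedding X Y) : symRing :=
  @var {classic symbol} (Symbol i).

Inductive Theta_rel : symRing -> Prop :=
| Theta_iso (X Y : skel) (i : embedding X Y) :
    bijective i -> Theta_rel (sym i - 1)
| Theta_comp (X Y Z : skel) (j : embedding Y Z) (i : embedding X Y) :
    Theta_rel (sym (emb_comp j i) - sym j * sym i)
| Theta_amalg (X Y X' : skel) (i : embedding X Y) (k : embedding X X')
    (n : nat) (s : 'I_n -> amalgamation i k) :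
    (* s lists each isomorphism class of amalgamations exactly once *)
    (forall a : amalgamation i k, exists! t, amalg_iso (s t) a) ->
    Theta_rel (sym i - \sum_(t < n) sym (am2 (s t))).

Definition Theta : comPzRingType := ideal_quotient Theta_rel.

Definition cls (X Y : treeStr) (i : embedding X Y) : Theta :=
  proj Theta_rel (sym (skel_emb i)).

Definition marked_cls (T : markedTree) : Theta := cls (marked_emb T).

Definition Zuv_rel (f : freeComRing 'I_2) : Prop :=
  f = var (ord0 : 'I_2) * var (ord_max : 'I_2).

Definition Zuv : comPzRingType := ideal_quotient Zuv_rel.
Definition u_ : Zuv := proj Zuv_rel (var (ord0 : 'I_2)).
Definition v_ : Zuv := proj Zuv_rel (var (ord_max : 'I_2)).

Lemma is_tree_parent (V : finType) (e : rel V) (r : V) (par : V -> V)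
    (h : V -> nat) :
  (forall x y, e x y = (x != r) && (y == par x) || (y != r) && (x == par y)) ->
  (forall x, x != r -> (h (par x) < h x)%N) ->
  is_tree e.
Proof.
move=> eE hP; have esym : symmetric e by move=> x y; rewrite !eE orbC.
split=> //.
- move=> x; rewrite eE orbb; apply/negbTE/andP => -[xr /eqP xE].
  by have := hP x xr; rewrite -xE ltnn.
- have to_r x : connect e x r.
    have [n] := ubnP (h x); elim: n x => // n IHn x; rewrite ltnS => hx.
    have [->//|xr] := eqVneq x r.
    apply: connect_trans (IHn _ (leq_trans (hP x xr) hx)).
    by apply: connect1; rewrite eE xr eqxx.
  by move=> x y; apply: connect_trans (to_r x) _; rewrite (sym_connect_sym esym).
- move=> c /andP[ec uc]; rewrite leqNgt; apply/negP => szc.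
  have [x0 x0c] : exists x0, x0 \in c by case: c szc {ec uc} => // x0; exists x0; rewrite mem_head.
  have [x xc max_x] := arg_maxnP h x0c.
  have par_max y : y \in c -> e x y -> y = par x.
    move=> yc; rewrite eE => /orP[/andP[_ /eqP]//|/andP[yr /eqP xE]].
    by have := leq_trans (hP y yr) (max_x y yc); rewrite xE ltnn.
  have [n c' rotE] := rot_to xc.
  have mem_c y : (y \in c) = (y \in x :: c') by rewrite -rotE mem_rot.
  move: ec uc szc; rewrite -(rot_cycle n) -(rot_uniq n) -(size_rot n) rotE.
  case: c' mem_c {rotE} => [|y [|z p]] // mem_c ec uc _.
  move: ec; rewrite /= rcons_path => /and4P[exy _ _ elx].
  have yE : y = par x by apply: par_max exy; rewrite mem_c !inE eqxx orbT.
  have lE : last z p = par x.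
    by apply: par_max; rewrite 1?esym // mem_c 2!in_cons mem_last !orbT.
  move: uc; rewrite /= => /and3P[_ /negP[]].
  by rewrite yE -lE mem_last.
Qed.

Definition edge_list (n : nat) (E : seq (nat * nat)) : rel 'I_n :=
  fun x y => ((val x, val y) \in E) || ((val y, val x) \in E).

Definition point_edge : rel unit := fun _ _ => false.

Lemma point_is_tree : is_tree point_edge.
Proof. by apply: (@is_tree_parent _ _ tt id (fun=> 0%N)) => [[] []|[]]. Qed.

Lemma point_leaf : leaf point_edge tt.
Proof. by rewrite /leaf card_unit eqxx orbT. Qed.

Definition point_tree := MarkedTree point_is_tree point_leaf.

Definition segment_edge : rel bool := fun x y => x != y.

Lemma segment_is_tree : is_tree segment_edge.
Proof.
by apply: (@is_tree_parent _ _ false (fun=> false) (fun b => b : nat))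
  => [[] []|[]].
Qed.

Lemma segment_leaf : leaf segment_edge true.
Proof. by apply/orP/or_introl/cards1P; exists false; apply/setP=> -[]; rewrite !inE. Qed.

Definition segment_tree := MarkedTree segment_is_tree segment_leaf.

(* The node is None; the n.+1 leaves are the Some i. *)
Definition star_edge (n : nat) : rel (option 'I_n.+1) :=
  fun x y => isSome x != isSome y.

Lemma star_is_tree n : is_tree (@star_edge n).
Proof.
by apply: (@is_tree_parent _ _ None (fun=> None) (fun x => isSome x : nat))
  => [[?|] [?|]|[?|]].
Qed.

Lemma star_leaf n : leaf (@star_edge n) (Some ord0).
Proof. by apply/orP/or_introl/cards1P; exists None; apply/setP=> -[?|]; rewrite !inE. Qed.

Definition star_tree n := MarkedTree (star_is_tree n) (star_leaf n).

(* The value at m = 0 is irrelevant. *)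
Definition X_tree (m : nat) : markedTree :=
  match m with
  | 0 | 1 => point_tree
  | 2 => segment_tree
  | n.+1 => star_tree n
  end.

(* Nodes 0, 1; leaves 2, 3 at node 0 and 4, 5 at node 1. *)
Definition Y_edge : rel 'I_6 :=
  @edge_list 6 [:: (0, 1); (0, 2); (0, 3); (1, 4); (1, 5)]%N.

Definition Y_mark : 'I_6 := @Ordinal 6 2 isT.

Lemma Y_is_tree : is_tree Y_edge.
Proof.
pose par (x : 'I_6) : 'I_6 := inord (nth 0 [:: 0; 0; 0; 0; 1; 1] x)%N.
apply: (@is_tree_parent _ _ ord0 par val) => [x y|x].
  by case: x => [[|[|[|[|[|[|]]]]]] ?];
     case: y => [[|[|[|[|[|[|]]]]]] ?]; rewrite // -!val_eqE /= ?inordK.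
by case: x => [[|[|[|[|[|[|]]]]]] ?]; rewrite // -val_eqE /= inordK.
Qed.

Lemma Y_leaf : leaf Y_edge Y_mark.
Proof.
apply/orP/or_introl/cards1P; exists ord0; apply/setP=> x.
by rewrite !inE -val_eqE; case: x => [[|[|[|[|[|[|]]]]]] ?].
Qed.

Definition Y_tree := MarkedTree Y_is_tree Y_leaf.

(* Nodes 0, 1, 2; leaves 3, 4 at node 0, leaf 5 at node 1, leaves 6, 7 at node 2. *)
Definition Z_edge : rel 'I_8 :=
  @edge_list 8 [:: (0, 1); (1, 2); (0, 3); (0, 4); (1, 5); (2, 6); (2, 7)]%N.

Definition Z_mark : 'I_8 := @Ordinal 8 5 isT.

Lemma Z_is_tree : is_tree Z_edge.
Proof.
pose par (x : 'I_8) : 'I_8 := inord (nth 0 [:: 0; 0; 1; 0; 0; 1; 2; 2] x)%N.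
apply: (@is_tree_parent _ _ ord0 par val) => [x y|x].
  by case: x => [[|[|[|[|[|[|[|[|]]]]]]]] ?];
     case: y => [[|[|[|[|[|[|[|[|]]]]]]]] ?]; rewrite // -!val_eqE /= ?inordK.
by case: x => [[|[|[|[|[|[|[|[|]]]]]]]] ?]; rewrite // -val_eqE /= inordK.
Qed.

Lemma Z_leaf : leaf Z_edge Z_mark.
Proof.
apply/orP/or_introl/cards1P; exists (@Ordinal 8 1 isT); apply/setP=> x.
by rewrite !inE -val_eqE; case: x => [[|[|[|[|[|[|[|[|]]]]]]]] ?].
Qed.

Definition Z_tree := MarkedTree Z_is_tree Z_leaf.

(* Main.v *)
Require Import Defs.
From HB Require Import structures.
From mathcomp Require Import all_boot all_algebra.
From mathcomp Require Import perm zify ring.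
From mathcomp Require Import boolp finmap.
From mathcomp.multinomials Require Import monalg.
Set Implicit Arguments.
Unset Strict Implicit.
Unset Printing Implicit Defensive.
Import GRing.Theory.

(** For four leaves of a tree, write D(xy;zw) when the path from x to y avoids the path
    from z to w. Allowing x = y and z = w, this relation satisfies a few axioms that say
    that the splits of the leaf set given by the edges are pairwise compatible
    ([qsep_separation]), and every relation with these properties comes from a tree
    ([separation_tree]). In this form an amalgamation of Y and X' over X is a relation on
    the disjoint union that restricts to the given ones and may identify points.

    The type of a new leaf a over a set S of leaves is the place where a attaches to the
    tree of S. It is measured by the number k of pieces into which this place cuts S and,
    when k = 2, by the number s of pieces with one leaf. Let b be another new leaf. If
    the types of a and b differ, there is one way to amalgamate, and the type of a over
    S + b has the same k and s ([lifts_distinguished]). If they agree, the amalgams can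
    be listed ([lifts_same_type]). A function t(k,s) with values in a commutative ring
    therefore gives a function on one-point extensions that is additive under amalgamation
    as soon as it satisfies a recursion, the first condition of [type_measure]. Its
    solutions are determined by y = t(2,1) and z = t(2,0), which are arbitrary ([type_measure_value]).
    The product of the values along a chain of one-point extensions is independent of
    the chain if moreover y y = y z ([weight_swap]). With y = u and z = u - v this
    condition is u v = 0. So there is a multiplicative function on embeddings with
    values in Z[u,v]/(uv) that is additive under amalgamation ([emb_weight_amalg]), and
    it gives the homomorphism from Theta.

    Conversely, in Theta the class of a one-point extension depends on its type only. A
    leaf whose type differs from that of the marked leaf can be deleted without changing
    the class ([removable_step]), and the marked trees in which no leaf can be deleted
    are the X_m, Y and Z ([irremovable_cases]). The relations of Theta for the amalgams
    of these trees with themselves are the recursion, and the two ways to build the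
    caterpillar with five leaves from three of its leaves give y y = y z
    ([tree_value_measure]). Hence u and v can be sent back to the classes y and y - z,
    and the two homomorphisms are inverse to each other because the values y and z
    determine all the others. *)

(** * Separation relations *)

Section Separation.
Variable W : finType.
Implicit Types (P S A : {set W}) (D : W -> W -> W -> W -> bool).

(** [D x y z w] says that, in a tree, the path from [x] to [y] avoids the path from [z]
    to [w], or that some split of the leaf set has [x], [y] on one side and [z], [w]
    on the other. [D x x y y] says that the points [x] and [y] are different: points
    may coincide, so that a relation on a disjoint union can describe an
    amalgamation. The relation vanishes outside the support [P]. *)
Record presep P D : Prop := Presep {
  sep_supp : forall x y z w, D x y z w -> x \in P;
  sep_flip : forall x y z w, D x y z w = D y x z w;
  sep_swap : forall x y z w, D x y z w = D z w x y;
  sep_thin : forall x y z w, D x y z w -> ~~ D x z y w;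
  sep_sat : forall t x y z w, t \in P -> D x y z w -> D t y z w || D x y z t }.

(** [sep_point] provides the splits that cut off one point. Without it the relation
    describes an arbitrary system of pairwise compatible splits, as is needed while a
    new tree is being put together. *)
Record separation P D : Prop := Separation {
  sep_pre :> presep P D;
  sep_point : forall x y z, D x x z z -> D y y z z -> D x y z z }.

Definition same D x y := ~~ D x x y y.

Lemma sep_flipr P D (DP : presep P D) x y z w : D x y z w = D x y w z.
Proof. by rewrite (sep_swap DP) (sep_flip DP) (sep_swap DP). Qed.

End Separation.

(** Closes a goal [D _ _ _ _] from the same relation up to the dihedral
    symmetries of the two pairs. *)
Ltac sep_sym DP H := solve
  [ exact: H | rewrite (sep_flip DP); exact: H | rewrite (sep_flipr DP); exact: H
  | rewrite (sep_flip DP) (sep_flipr DP); exact: H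
  | rewrite (sep_swap DP); first
    [ exact: H | rewrite (sep_flip DP); exact: H | rewrite (sep_flipr DP); exact: H
    | rewrite (sep_flip DP) (sep_flipr DP); exact: H ] ].

(** Closes any goal from two different pairings of the same four points. *)
Ltac sep_absurd DP H1 H2 := exfalso; solve
  [ move/negP: (sep_thin DP H1); apply; sep_sym DP H2
  | move: (H1); rewrite (sep_flip DP); move/(sep_thin DP)/negP; apply; sep_sym DP H2 ].

Section PresepTheory.
Variables (W : finType) (P : {set W}) (D : W -> W -> W -> W -> bool).
Hypothesis DP : presep P D.

Lemma sep_irr1 x y z : D x z z y = false.
Proof. by apply/negP => /[dup] /(sep_thin DP)/negP. Qed.
Lemma sep_irr2 x y z : D z x z y = false.
Proof. by rewrite (sep_flip DP) sep_irr1. Qed.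
Lemma sep_irr3 x y z : D x z y z = false.
Proof. by rewrite (sep_flipr DP) sep_irr1. Qed.
Lemma sep_irr4 x y z : D z x y z = false.
Proof. by rewrite (sep_flip DP) sep_irr3. Qed.
Definition sep_irr := (sep_irr1, sep_irr2, sep_irr3, sep_irr4).

Lemma sep_mem x y z w :
  D x y z w -> [/\ x \in P, y \in P, z \in P & w \in P].
Proof.
move=> Dxyzw; split; first exact: sep_supp Dxyzw.
- by move: Dxyzw; rewrite (sep_flip DP); apply: sep_supp.
- by move: Dxyzw; rewrite (sep_swap DP); apply: sep_supp.
- by move: Dxyzw; rewrite (sep_swap DP) (sep_flip DP); apply: sep_supp.
Qed.

Lemma sep_diagl x y z w : D x y z w -> D x x z w.
Proof.
move=> Dxyzw; have [xP _ _ _] := sep_mem Dxyzw.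
move: Dxyzw; rewrite (sep_flip DP) => /(sep_sat DP xP).
by rewrite sep_irr orbF.
Qed.

Lemma sep_diagr x y z w : D x y z w -> D x y z z.
Proof. by rewrite (sep_swap DP) => /sep_diagl; rewrite (sep_swap DP). Qed.

Lemma sep_satP t x y z w : t \in P -> D x y z w -> D t y z w \/ D x y z t.
Proof. by move=> tP Dx; apply/orP; apply: (sep_sat DP). Qed.

Lemma sep_transr x y z w t : D x y z w -> D x y z t -> D x y w t.
Proof.
move=> D1 D2; have [_ _ zP wP] := sep_mem D1; have [_ _ _ tP] := sep_mem D2.
have D1' : D z w x y by sep_sym DP D1.
have D2' : D z t x y by sep_sym DP D2.
have [D3|D3] := sep_satP tP D1'; first by sep_sym DP D3.
have [D4|D4] := sep_satP wP D2'; first by sep_sym DP D4.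
sep_absurd DP D3 D4.
Qed.

Lemma sep_transl x y z w t : D x y z w -> D x t z w -> D y t z w.
Proof. by rewrite ![D _ _ z w](sep_swap DP); apply: sep_transr. Qed.

Lemma sameC x y : same D x y = same D y x.
Proof. by rewrite /same (sep_swap DP). Qed.

Lemma same_refl x : same D x x.
Proof. by rewrite /same sep_irr. Qed.

Lemma same_trans x y z : y \in P -> same D x y -> same D y z -> same D x z.
Proof.
move=> yP /negP xy /negP yz; apply/negP => /(sep_satP yP)[Dy|Dy].
  have Dy' : D y x z z by sep_sym DP Dy.
  exact: yz (sep_diagl Dy').
have Dy' : D x x y z by sep_sym DP Dy.
exact: xy (sep_diagr Dy').
Qed.

Lemma same_subst x x' y z w : x' \in P -> same D x x' -> D x y z w -> D x' y z w.
Proof.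
move=> xP /negP xx' /(sep_satP xP)[//|/sep_diagl Dx].
have Dx' : D x x x' z by sep_sym DP Dx.
by case: xx'; apply: sep_diagr Dx'.
Qed.

Lemma same_sub4 x y z w x' y' z' w' :
  x' \in P -> y' \in P -> z' \in P -> w' \in P ->
  same D x x' -> same D y y' -> same D z z' -> same D w w' ->
  D x y z w -> D x' y' z' w'.
Proof.
move=> xP yP zP wP xx' yy' zz' ww' /(same_subst xP xx').
rewrite (sep_flip DP) => /(same_subst yP yy').
rewrite (sep_flip DP) (sep_swap DP) => /(same_subst zP zz').
rewrite (sep_flip DP) => /(same_subst wP ww').
by rewrite (sep_flip DP) (sep_swap DP).
Qed.

(** The points on the side of [a] of the path joining [y] to [z] form one side
    of a split: nothing separates them from each other that does not also
    separate them from the rest. *)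
Lemma sep_split a y z p q s t :
  D a p y z -> D a q y z -> s \in P -> t \in P -> ~~ D a s y z -> ~~ D a t y z ->
  D p q s t.
Proof.
move=> Dp Dq sP tP Ns Nt; have Dpq := sep_transl Dp Dq.
have aux r : r \in P -> ~~ D a r y z -> D p q y r.
  move=> rP /negP Nr; have Dpq' : D p q y z by [].
  have [Dr|//] := sep_satP rP Dpq'.
  have Dqa : D q a y z by sep_sym DP Dq.
  have Dqr : D q r y z by sep_sym DP Dr.
  by case: Nr; apply: sep_transl Dqa Dqr.
exact: sep_transr (aux _ sP Ns) (aux _ tP Nt).
Qed.

End PresepTheory.

(** * The type of a point over a set *)

Definition class_count (T : finType) (r : rel T) (S : {set T}) : nat :=
  #|[set [set y in S | r x y] | x in S]|.

Definition equiv_on (T : finType) (r : rel T) (S : {set T}) : Prop :=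
  [/\ {in S, reflexive r}, {in S &, symmetric r} & {in S & &, transitive r}].

Section ClassCount.
Variables (T : finType) (r : rel T) (S : {set T}).
Hypothesis rS : equiv_on r S.

Lemma equiv_onS (S' : {set T}) : S' \subset S -> equiv_on r S'.
Proof.
move=> /subsetP sub; have [r1 r2 r3] := rS; split.
- by move=> x /sub; apply: r1.
- by move=> x y /sub xS /sub yS; apply: r2.
- by move=> y x z /sub yS /sub xS /sub zS; apply: r3.
Qed.

Lemma class_eqP x y : x \in S -> y \in S ->
  ([set z in S | r x z] == [set z in S | r y z]) = r x y.
Proof.
move=> xS yS; have [r1 r2 r3] := rS; apply/eqP/idP => [/setP/(_ y)|xy].
  by rewrite !inE yS r1.
have yx : r y x by rewrite r2.
apply/setP=> z; rewrite !inE; case zS: (z \in S) => //=.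
by apply/idP/idP; [apply: (r3 x y z)|apply: (r3 y x z)].
Qed.

Lemma class_count_transversal : exists A : {set T},
  [/\ A \subset S, #|A| = class_count r S,
      {in A &, forall x y, r x y -> x = y} &
      {in S, forall x, exists2 y, y \in A & r x y}].
Proof.
have [r1 r2 r3] := rS.
pose cl x := [set z in S | r x z].
pose rp x := odflt x [pick z in cl x].
have rpP x : x \in S -> (rp x \in S) && r x (rp x).
  move=> xS; rewrite /rp; case: pickP => [z|/(_ x)] /=; rewrite !inE //.
  by rewrite xS r1.
have rpE x y : x \in S -> y \in S -> r x y -> rp x = rp y.
  move=> xS yS; rewrite -class_eqP // => /eqP clE; rewrite /rp /cl clE.
  by case: pickP => // /(_ y); rewrite !inE yS r1.
exists (rp @: S); split.
- by apply/subsetP=> _ /imsetP[x xS ->]; case/andP: (rpP x xS).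
- rewrite /class_count -(@card_in_imset _ _ cl).
    rewrite -imset_comp; congr #|pred_of_set _|; apply: eq_in_imset => x xS /=.
    by have /andP[zS xz] := rpP x xS; apply/eqP; rewrite class_eqP // r2.
  move=> _ _ /imsetP[x xS ->] /imsetP[y yS ->] /eqP.
  have /andP[xS' xx] := rpP x xS; have /andP[yS' yy] := rpP y yS.
  rewrite class_eqP // => rr; apply: rpE => //.
  apply: (r3 (rp x)) => //; apply: (r3 (rp y)) => //.
  by rewrite r2.
- move=> _ _ /imsetP[x xS ->] /imsetP[y yS ->] rr.
  have /andP[xS' xx] := rpP x xS; have /andP[yS' yy] := rpP y yS.
  apply: rpE => //; apply: (r3 (rp x)) => //; apply: (r3 (rp y)) => //.
  by rewrite r2.
move=> x xS; have /andP[xS' xx] := rpP x xS; exists (rp x) => //.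
by apply: imset_f.
Qed.

Lemma class_count0 : (class_count r S == 0) = (S == set0).
Proof. by rewrite /class_count cards_eq0 imset_eq0. Qed.

Lemma class_count1 :
  (class_count r S == 1) -> {in S &, forall x y, r x y}.
Proof.
have [r1 r2 r3] := rS; have [A [AS <- A1 A2]] := class_count_transversal.
case/cards1P=> a AE x y xS yS.
have [_ /[!(AE, inE)] /eqP-> xa] := A2 x xS.
have [_ /[!(AE, inE)] /eqP-> ya] := A2 y yS.
have aS : a \in S by apply: (subsetP AS); rewrite AE inE.
by apply: (r3 a) => //; rewrite r2.
Qed.

Lemma class_count2 : class_count r S = 2 ->
  exists x y, [/\ x \in S, y \in S, ~~ r x y &
    {in S, forall z, r x z = ~~ r y z}].
Proof.
have [r1 r2 r3] := rS; have [A [/subsetP AS <- A1 A2]] := class_count_transversal.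
case/eqP/cards2P=> x [y [xy AE]].
have xA : x \in A by rewrite AE !inE eqxx.
have yA : y \in A by rewrite AE !inE eqxx orbT.
have xS := AS _ xA; have yS := AS _ yA.
have Nxy : ~~ r x y by apply: contra xy => /A1-> //; rewrite eqxx.
exists x, y; split=> // z zS; apply/idP/idP => [xz|yz].
  by apply: contra Nxy => yz; apply: (r3 z) => //; rewrite r2.
have [w] := A2 z zS; rewrite AE !inE => /orP[] /eqP->; first by rewrite r2.
by rewrite r2 // (negPf yz).
Qed.

Lemma class_count_add b : b \notin S -> equiv_on r (b |: S) ->
  {in S, forall x, ~~ r b x} ->
  class_count r (b |: S) = (class_count r S).+1.
Proof.
move=> bS [r1 r2 r3] Nb; rewrite /class_count.
have bE : [set y in b |: S | r b y] = [set b].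
  apply/setP=> y; rewrite !inE; have [->|yb] /= := eqVneq y b.
    by rewrite r1 ?setU11.
  by apply/negP => /andP[/Nb/negP].
rewrite imsetU1 bE.
have -> : [set [set y in b |: S | r x y] | x in S]
        = [set [set y in S | r x y] | x in S].
  apply: eq_in_imset => x xS; apply/setP=> y; rewrite !inE.
  have [->|//] := eqVneq y b; rewrite (negPf bS) /=.
  by rewrite r2 ?setU11 ?setU1r // (negPf (Nb x xS)).
rewrite cardsU1; case: imsetP => [[x xS /setP/(_ b)]|_]; last by rewrite add1n.
by rewrite !inE eqxx (negPf bS).
Qed.

End ClassCount.

Lemma class_count_map (T T' : finType) (f : T -> T') (r : rel T) (r' : rel T')
    (S : {set T}) (S' : {set T'}) :
  equiv_on r' S' -> {in S, forall x, f x \in S'} ->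
  {in S &, forall x y, r x y = r' (f x) (f y)} ->
  {in S', forall y, exists2 x, x \in S & r' (f x) y} ->
  class_count r S = class_count r' S'.
Proof.
move=> r'S fS rE fsurj; have [r1 r2 r3] := r'S.
have rS : equiv_on r S.
  split=> [x xS|x y xS yS|y x z yS xS zS].
  - by rewrite (rE x x) // r1 ?fS.
  - by rewrite (rE x y) // (rE y x) // r2 ?fS.
  - by rewrite (rE x y) // (rE y z) // (rE x z) //; apply: r3; rewrite fS.
pose cl' y := [set z in S' | r' y z].
have -> : class_count r' S' = #|[set cl' (f x) | x in S]|.
  congr #|pred_of_set _|; apply/setP=> C; apply/imsetP/imsetP => -[y yS ->].
    have [x xS xy] := fsurj y yS; exists x => //.
    by apply/esym/eqP; rewrite /cl' (class_eqP r'S) ?fS.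
  by exists (f y); rewrite ?fS.
have [A [/subsetP AS <- A1 A2]] := class_count_transversal rS.
rewrite -(@card_in_imset _ _ (fun x => cl' (f x)) A).
  congr #|pred_of_set _|; apply/setP=> C; apply/imsetP/imsetP => -[x xS ->].
    by exists x => //; apply: AS.
  have [y yA xy] := A2 x xS; exists y => //.
  have yS := AS _ yA; have := class_eqP r'S (fS _ xS) (fS _ yS).
  by rewrite -rE // xy => /eqP.
move=> x y xA yA; have xS := AS _ xA; have yS := AS _ yA => /eqP.
by have := class_eqP r'S (fS _ xS) (fS _ yS); rewrite -rE // => -> /A1; apply.
Qed.

Lemma class_count_fun (T U : finType) (h : T -> U) (r : rel T) (S : {set T}) :
  {in S &, forall x y, r x y = (h x == h y)} -> class_count r S = #|h @: S|.
Proof.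
move=> rE; rewrite (@class_count_map _ _ h r eq_op S (h @: S)) //.
- rewrite /class_count; apply: card_in_imset => x y xS yS /setP/(_ x).
  by rewrite !inE eqxx xS => /esym/andP[_ /eqP].
- by split=> [x _|x y _ _|y x z _ _ _ /eqP-> /eqP->] //; apply: eq_sym.
- by move=> x xS; apply: imset_f.
- by move=> _ /imsetP[x xS ->]; exists x.
Qed.

Section PointType.
Variables (W : finType).
Implicit Types (P S A : {set W}) (D : W -> W -> W -> W -> bool).

(** The point [a] hangs from some place of the tree of [S]. Removing this place cuts the
    tree into pieces, and [sim] relates the points of [S] in the same piece. The place
    is a vertex when there are at least three classes, the interior of an edge when
    there are two. *)
Definition sim D S a : rel W :=
  fun x y => same D x y || [exists d in S, D x y a d].

Definition realized D S a := [exists x in S, same D a x].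

Definition class_num D S a := class_count (sim D S a) S.

(** The points that are alone in their class. With two classes, their number tells
    whether the edge at which [a] attaches ends in a leaf. *)
Definition lonely D S a :=
  [set x in S | [forall y in S, sim D S a x y ==> same D x y]].

Definition lonely_num D S a := class_count (sim D S a) (lonely D S a).

(** The value of [t] at the type of [a]. Singleton classes are counted only when there
    are two classes: the other types are told apart by their number of classes only. *)
Definition weight (A : pzSemiRingType) (t : nat -> nat -> A) D S a : A :=
  if realized D S a then 1%R
  else t (class_num D S a) (if class_num D S a == 2 then lonely_num D S a else 0).

Lemma simP D S a x y :
  reflect (same D x y \/ exists2 d, d \in S & D x y a d) (sim D S a x y).
Proof.
apply: (iffP orP) => -[|]; [by left| |by left|].
  by case/exists_inP=> d; right; exists d.
by case=> d dS Dd; right; apply/exists_inP; exists d.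
Qed.

(** In the transitive case with two witnesses [d] and [d'], one of them separates both
    pairs from [a], by compatibility of the two splits. *)
Lemma sim_equiv P D S a : presep P D -> S \subset P -> equiv_on (sim D S a) S.
Proof.
move=> DP SP; have sP x : x \in S -> x \in P := subsetP SP x.
split=> [x _|x y _ _|y x z yS xS zS]; first by rewrite /sim (same_refl DP).
  rewrite /sim (sameC DP); congr orb; apply: eq_existsb => d.
  by rewrite (sep_flip DP).
have symS u v : same D u v -> same D v u by rewrite (sameC DP).
case/simP=> [xy|[d dS Dxy]] /simP[yz|[d' dS' Dyz]];
  apply/simP.
- by left; apply: (same_trans DP) xy yz; apply: sP.
- by right; exists d' => //; apply: (same_subst DP) (symS _ _ xy) Dyz; apply: sP.
- right; exists d => //; have Dyx : D y x a d by sep_sym DP Dxy.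
  by have := same_subst DP (sP _ zS) yz Dyx; rewrite (sep_flip DP).
have [D1|D1] := sep_satP DP (sP _ xS) Dyz; first by right; exists d'.
have Dyx : D y x a d by sep_sym DP Dxy.
have [D2|D2] := sep_satP DP (sP _ zS) Dyx; last sep_absurd DP D1 D2.
by right; exists d => //; sep_sym DP D2.
Qed.

End PointType.

Section Transport.
Variables (W W' : finType) (D : W -> W -> W -> W -> bool)
  (D' : W' -> W' -> W' -> W' -> bool) (P' : {set W'}) (f : W -> W').
Variables (S : {set W}) (a : W).
Hypotheses (DP' : presep P' D') (SP' : f @: S \subset P').
Hypothesis DD' : forall x y z w, x \in a |: S -> y \in a |: S -> z \in a |: S ->
  w \in a |: S -> D x y z w = D' (f x) (f y) (f z) (f w).

Let inS x : x \in S -> x \in a |: S. Proof. exact: setU1r. Qed.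
Let ina : a \in a |: S. Proof. exact: setU11. Qed.

Lemma same_map x y : x \in a |: S -> y \in a |: S ->
  same D x y = same D' (f x) (f y).
Proof. by move=> xS yS; rewrite /same DD'. Qed.

Lemma realized_map : realized D S a = realized D' (f @: S) (f a).
Proof.
apply/exists_inP/exists_inP => -[x xS ax].
  by exists (f x); rewrite ?imset_f // -same_map // inS.
by case/imsetP: xS ax => y yS -> ay; exists y; rewrite // same_map // inS.
Qed.

Lemma sim_map x y : x \in S -> y \in S ->
  sim D S a x y = sim D' (f @: S) (f a) (f x) (f y).
Proof.
move=> /[dup] xS /inS xS' /[dup] yS /inS yS'; rewrite /sim same_map //.
congr orb; apply/exists_inP/exists_inP => -[d dS Dd].
  by exists (f d); rewrite ?imset_f // -DD' // inS.
by case/imsetP: dS Dd => e eS -> De; exists e; rewrite // DD' // inS.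
Qed.

Lemma class_num_map : class_num D S a = class_num D' (f @: S) (f a).
Proof.
apply: (class_count_map (f := f)); first exact: sim_equiv DP' SP'.
- by move=> x xS; apply: imset_f.
- exact: sim_map.
- move=> _ /imsetP[x xS ->]; exists x => //.
  by have [r1 _ _] := sim_equiv (f a) DP' SP'; apply/r1/imset_f.
Qed.

Lemma lonely_map x : x \in S ->
  (x \in lonely D S a) = (f x \in lonely D' (f @: S) (f a)).
Proof.
move=> xS; rewrite !inE xS imset_f //=; apply/forall_inP/forall_inP.
  move=> H _ /imsetP[y yS ->]; rewrite -sim_map // -same_map ?inS //.
  exact: H.
by move=> H y yS; rewrite sim_map // same_map ?inS //; apply: H; apply: imset_f.
Qed.

Lemma lonely_num_map : lonely_num D S a = lonely_num D' (f @: S) (f a).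
Proof.
have subS (x : W) : x \in lonely D S a -> x \in S by rewrite inE => /andP[].
apply: (class_count_map (f := f)).
- apply: (equiv_onS (sim_equiv (f a) DP' SP')).
  by apply/subsetP=> x; rewrite inE => /andP[].
- by move=> x xL; rewrite -lonely_map // subS.
- by move=> x y /subS xS /subS yS; apply: sim_map.
- move=> y yL; have := yL; rewrite inE => /andP[/imsetP[x xS yE] _].
  rewrite {}yE in yL *; exists x; first by rewrite lonely_map.
  by have [r1 _ _] := sim_equiv (f a) DP' SP'; apply/r1/imset_f.
Qed.

Lemma weight_map (A : pzSemiRingType) (t : nat -> nat -> A) :
  weight t D S a = weight t D' (f @: S) (f a).
Proof. by rewrite /weight realized_map class_num_map lonely_num_map. Qed.

End Transport.

(** * Adding a point to the base *)

Section OnePoint.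
Variables (W : finType) (P S : {set W}) (D : W -> W -> W -> W -> bool) (a : W).
Hypotheses (DP : separation P D) (SP : S \subset P) (aP : a \in P).
Hypothesis Na : ~~ realized D S a.

Let sP x : x \in S -> x \in P. Proof. exact: subsetP SP x. Qed.

Lemma unrealized x : x \in S -> D a a x x.
Proof.
move=> xS; apply: contraNT Na => ax; apply/exists_inP; exists x => //.
Qed.

Lemma unrealized_point x y : x \in S -> y \in S -> ~~ same D x y -> D a x y y.
Proof.
by move=> xS yS /negPn xy; apply: (sep_point DP) (unrealized yS) xy.
Qed.

(** If all points of [S] looked alike from [a], then among the sides
    [{t | D x t a d}] there would be no largest one, as [d] could always be
    absorbed. *)
Lemma sim_separates x y : x \in S -> y \in S -> ~~ same D x y ->
  exists u v, [/\ u \in S, v \in S & ~~ sim D S a u v].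
Proof.
move=> xS yS xy.
case: (boolP [exists u in S, exists v in S, ~~ sim D S a u v]).
  by case/exists_inP=> u uS /exists_inP[v vS uv]; exists u, v.
move=> /exists_inPn all_sim; exfalso.
pose ok (p : W * W) := [&& p.1 \in S, p.2 \in S & D p.1 p.1 a p.2].
(* A largest side would have to absorb the point [p.2] opposite to it. *)
pose side (p : W * W) := [set t in S | D p.1 t a p.2].
have ok_xy : ok (x, y).
  rewrite /ok xS yS /=; have := unrealized_point yS xS.
  by rewrite (sameC DP) => /(_ xy) Da; sep_sym DP Da.
have [[u v] /and3P[/= uS vS uav] max_uv] := arg_maxnP (fun p => #|side p|) ok_xy.
have := all_sim _ uS; move/exists_inPn/(_ _ vS)/negPn/simP=> [uv|[e eS De]].
  have Duv : D u u a v by [].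
  by have /(sep_diagr DP) := etrans (esym (sep_flipr DP _ _ _ _)) uav; apply/negP.
have ok_ue : ok (u, e) by rewrite /ok uS eS /=; apply: sep_diagl DP _ _ _ _ De.
have := max_uv _ ok_ue; rewrite leqNgt => /negP; apply.
apply: proper_card; apply/properP; split; last first.
  by exists v; rewrite inE /= ?vS ?De // (sep_irr3 DP) andbF.
apply/subsetP=> t; rewrite !inE /= => /andP[tS Dt]; rewrite tS /=.
have De' : D v u a e by sep_sym DP De.
have [D1|D1] := sep_satP DP (sP tS) De'; first by sep_sym DP D1.
sep_absurd DP D1 Dt.
Qed.

(** The points [a] and [c] form a cherry: [a] attaches inside the edge at [c]. *)
Definition cherry c := {in S &, forall z w,
  ~~ same D c z -> ~~ same D c w -> D a c z w}.

Lemma lonely_cherry c : class_num D S a = 2 -> c \in lonely D S a -> cherry c.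
Proof.
move=> k2; rewrite inE => /andP[cS /forall_inP cL] z w zS wS cz cw.
have [x [y [xS yS Nxy xE]]] := class_count2 (sim_equiv a DP SP) k2.
have [_ r2 r3] := sim_equiv a DP SP.
have Ncz : ~~ sim D S a c z by apply: contra cz; apply/implyP/cL.
have Ncw : ~~ sim D S a c w by apply: contra cw; apply/implyP/cL.
have xyS u : u \in S -> sim D S a x u || sim D S a y u.
  by move=> uS; rewrite xE //; case: sim.
have key u : u \in S -> sim D S a u c -> ~~ sim D S a u z /\ ~~ sim D S a u w.
  move=> uS uc; split; [apply: contra Ncz|apply: contra Ncw] => uz;
    by apply: (r3 u) => //; rewrite r2.
have zw : sim D S a z w.
  have [xc|yc] := orP (xyS _ cS).
    have [xz xw] := key _ xS xc; rewrite !xE // !negbK in xz xw.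
    by apply: (r3 y) => //; rewrite r2.
  have [yz yw] := key _ yS yc; rewrite -xE // in yz; rewrite -xE // in yw.
  by apply: (r3 x) => //; rewrite r2.
have [{}zw|[d dS Dd]] := simP _ _ _ _ _ zw.
  have Dc := unrealized_point cS zS cz.
  by apply: (same_sub4 DP _ _ _ _ _ _ _ _ Dc); rewrite ?(same_refl DP) ?aP ?sP.
have [D1|D1] := sep_satP DP (sP cS) Dd; last by sep_sym DP D1.
by case/negP: Ncw; apply/simP; right; exists d.
Qed.

End OnePoint.

(** Two points attached inside the edge at the same leaf [c] have the same type. *)
Lemma cherry_type (W : finType) (P S : {set W}) D (a b c : W) :
  separation P D -> S \subset P -> b \in P -> c \in S ->
  ~~ realized D S b -> cherry S D a c -> cherry S D b c ->
  {in S & &, forall x y z, D a x y z -> D b x y z}.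
Proof.
move=> DP SP bP cS Nb ca cb x y z xS yS zS Dax.
have sP u : u \in S -> u \in P := subsetP SP u.
have nsame u v : D u u v v -> ~~ same D u v by rewrite /same negbK.
have subst2 y' : y' \in S -> same D y y' -> D a x y' z.
  move=> yS' yy'; have D1 : D y z a x by sep_sym DP Dax.
  by have D2 := same_subst DP (sP _ yS') yy' D1; sep_sym DP D2.
have subst3 z' : z' \in S -> same D z z' -> D a x y z'.
  move=> zS' zz'; have D1 : D z y a x by sep_sym DP Dax.
  by have D2 := same_subst DP (sP _ zS') zz' D1; sep_sym DP D2.
case cx: (same D c x).
  have xc : same D x c by rewrite (sameC DP).
  have D1 : D x a y z by sep_sym DP Dax.
  have D2 := same_subst DP (sP _ cS) xc D1.
  have Dccyy := sep_diagr DP (sep_diagl DP D2).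
  have D3 : D c a z y by sep_sym DP D2.
  have Dcczz := sep_diagr DP (sep_diagl DP D3).
  have D4 := cb y z yS zS (nsame _ _ Dccyy) (nsame _ _ Dcczz).
  have D5 : D c b y z by sep_sym DP D4.
  by have D6 := same_subst DP (sP _ xS) cx D5; sep_sym DP D6.
have Ncx : ~~ same D c x by rewrite cx.
case cy: (same D c y).
  have yc : same D y c by rewrite (sameC DP).
  have D1 := subst2 _ cS yc.
  case cz: (same D c z).
    have Dxy : D x x c c by rewrite (sep_swap DP); apply/negPn.
    have Dbc := sep_point DP (unrealized Nb cS) Dxy.
    by apply: (same_sub4 DP _ _ _ _ _ _ _ _ Dbc); rewrite ?bP ?sP ?(same_refl DP).
  have Ncz : ~~ same D c z by rewrite cz.
  have D2 := ca x z xS zS Ncx Ncz.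
  by sep_absurd DP D1 D2.
have Ncy : ~~ same D c y by rewrite cy.
case cz: (same D c z).
  have zc : same D z c by rewrite (sameC DP).
  have D1 := subst3 _ cS zc.
  have D2 := ca x y xS yS Ncx Ncy.
  by sep_absurd DP D1 D2.
have Ncz : ~~ same D c z by rewrite cz.
have D1 := ca y z yS zS Ncy Ncz; have D2 := cb y z yS zS Ncy Ncz.
have D3 := sep_transl DP D1 Dax.
have D4 : D c b y z by sep_sym DP D2.
exact: (sep_transl DP D4 D3).
Qed.

Section AddPoint.
Variables (W : finType) (P S : {set W}) (D : W -> W -> W -> W -> bool) (a b : W).
Hypotheses (DP : separation P D) (SP : S \subset P) (aP : a \in P) (bP : b \in P).

Let sP x : x \in S -> x \in P. Proof. exact: subsetP SP x. Qed.
Let SbP : b |: S \subset P. Proof. by rewrite subUset sub1set bP. Qed.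

Lemma weight_add_realized (A : pzSemiRingType) (t : nat -> nat -> A) :
  realized D S b -> weight t D (b |: S) a = weight t D S a.
Proof.
case/exists_inP=> c cS bc.
have [bS|bS] := boolP (b \in S); first by rewrite (setUidPr _) ?sub1set.
have [ab|ab] := eqVneq a b.
  rewrite /weight; have -> : realized D (b |: S) a.
    by apply/exists_inP; exists b; rewrite ?setU11 // ab (same_refl DP).
  have -> // : realized D S a.
  by apply/exists_inP; exists c; rewrite // ab.
pose f x := if x == b then c else x.
have fS x : x \in S -> f x = x.
  by move=> xS; rewrite /f; case: eqVneq xS bS => // -> ->.
have fE : f @: (b |: S) = S.
  apply/setP=> x; apply/imsetP/idP => [[y yS ->]|xS].
    by rewrite /f; case: eqVneq yS => // yb; rewrite !inE (negPf yb).
  by exists x; rewrite ?setU1r // fS.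
have SfP : f @: (b |: S) \subset P by rewrite fE.
rewrite (weight_map DP SfP).
  by rewrite fE /f (negPf ab).
have sub x : x \in a |: (b |: S) -> [/\ x \in P, f x \in P & same D x (f x)].
  rewrite !inE /f => /or3P[] xE.
  - by rewrite (eqP xE) (negPf ab) (same_refl DP).
  - by rewrite (eqP xE) eqxx bP sP // (same_refl DP).
  - by rewrite ifN ?sP ?(same_refl DP) //; apply: contraNneq bS => <-.
move=> x y z w /sub[xP xP' xx] /sub[yP yP' yy] /sub[zP zP' zz] /sub[wP wP' ww].
apply/idP/idP => Dx; apply: (same_sub4 DP _ _ _ _ _ _ _ _ Dx) => //;
  by rewrite (sameC DP).
Qed.

(** [b] joins a class of [a] when some split has [a] on one side and [b] on the
    other, with points of [S] on both sides. *)
Variables (c d : W).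
Hypotheses (cS : c \in S) (dS : d \in S) (bcad : D b c a d).
Hypotheses (Na : ~~ realized D S a) (Nb : ~~ realized D S b).

Lemma join_unrealized : ~~ realized D (b |: S) a.
Proof.
apply/exists_inPn=> x /setU1P[->|xS]; rewrite negbK; last exact: (unrealized Na xS).
have Dbb := sep_diagr DP (sep_diagl DP bcad).
by rewrite (sep_swap DP).
Qed.

Lemma join_sim x y : x \in S -> y \in S -> sim D (b |: S) a x y = sim D S a x y.
Proof.
move=> xS yS; apply/simP/simP => -[]; [by left| |by left|]; last first.
  by case=> e eS De; right; exists e => //; apply: setU1r.
case=> e /setU1P[->|eS] De; right; last by exists e.
have aux z z' : z \in S -> D z z' a b -> D z c a d \/ D a c z z'.
  move=> zS Dz; have D1 : D b a z z' by sep_sym DP Dz.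
  have [D2|D2] := sep_satP DP (sP cS) D1; first by right; sep_sym DP D2.
  have [D3|D3] := sep_satP DP (sP zS) bcad; first by left.
  sep_absurd DP D2 D3.
have De' : D y x a b by sep_sym DP De.
have [Dx|Dx] := aux x y xS De; last by exists c => //; sep_sym DP Dx.
have [Dy|Dy] := aux y x yS De'; last by exists c => //; sep_sym DP Dy.
exists d => //; have Dx' : D c x a d by sep_sym DP Dx.
have Dy' : D c y a d by sep_sym DP Dy.
exact: (sep_transl DP Dx' Dy').
Qed.

Lemma join_class_num : class_num D (b |: S) a = class_num D S a.
Proof.
symmetry; apply: (class_count_map (f := id)).
- exact: (sim_equiv a DP SbP).
- by move=> x xS; apply: setU1r.
- by move=> x y xS yS; rewrite join_sim.
move=> x /setU1P[->|xS]; last first.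
  by exists x => //; have [r1 _ _] := sim_equiv a DP SbP; apply/r1/setU1r.
exists c => //; apply/simP; right; exists d; first exact: setU1r.
by sep_sym DP bcad.
Qed.

Hypothesis Ntype : ~ {in S & &, forall x y z, D a x y z = D b x y z}.

(** If [b] joined a singleton class [{x}], then both [a] and [b] would attach inside the
    edge at [x], and their types would agree. *)
Lemma join_lonely : class_num D S a = 2 -> lonely D (b |: S) a = lonely D S a.
Proof.
move=> k2.
have bc : sim D (b |: S) a c b.
  by apply/simP; right; exists d; rewrite ?setU1r //; sep_sym DP bcad.
have [r1 r2 r3] := sim_equiv a DP SbP.
have Nsim x : x \in lonely D S a -> ~~ sim D (b |: S) a x b.
  move=> xL; have := xL; rewrite inE => /andP[xS /forall_inP xL1].
  apply/negP => /simP[xb|[e eS De]].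
    by case/negP: Nb; apply/exists_inP; exists x; rewrite // (sameC DP).
  have {}eS : e \in S.
    by case/setU1P: eS De => // ->; rewrite (sep_irr3 DP).
  have De' : D b x a e by sep_sym DP De.
  have cha := lonely_cherry DP SP aP Na k2 xL.
  have chb : cherry S D b x.
    move=> z w zS wS xz xw; have D1 := cha z w zS wS xz xw.
    have D1' : D x a z w by sep_sym DP D1.
    have [D2|D2] := sep_satP DP bP D1; first exact: D2.
    have D3 : D a x z z := sep_diagr DP D1.
    have [D4|D4] := sep_satP DP (sP zS) De'.
      case/negP: (xz); apply: (implyP (xL1 z zS)); apply/simP; right.
      by exists e => //; sep_sym DP D4.
    sep_absurd DP D2 D4.
  apply: Ntype => u v w uS vS wS; apply/idP/idP.
    exact: (cherry_type DP SP bP xS Nb cha chb).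
  exact: (cherry_type DP SP aP xS Na chb cha).
apply/setP=> x; apply/idP/idP => [|xL].
  rewrite inE => /andP[/setU1P[->|xS] /forall_inP xL].
    have /implyP := xL c (setU1r _ cS); rewrite r2 ?setU11 ?setU1r // bc => /(_ isT) bc'.
    by case/negP: Nb; apply/exists_inP; exists c.
  rewrite inE xS /=; apply/forall_inP=> y yS; rewrite -join_sim //.
  exact: xL (setU1r _ yS).
have := xL; rewrite inE => /andP[xS /forall_inP xL1].
rewrite inE setU1r //=; apply/forall_inP=> y /setU1P[->|yS].
  by rewrite (negPf (Nsim x xL)).
by rewrite join_sim //; apply: xL1.
Qed.

Lemma weight_join (A : pzSemiRingType) (t : nat -> nat -> A) :
  weight t D (b |: S) a = weight t D S a.
Proof.
rewrite /weight (negPf Na) (negPf join_unrealized) join_class_num.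
case: eqP => // k2; congr (t _ _); rewrite /lonely_num join_lonely //.
apply: (class_count_map (f := id)) => //.
- apply: (equiv_onS (sim_equiv a DP SP)).
  by apply/subsetP=> x; rewrite inE => /andP[].
- by move=> x y; rewrite !inE => /andP[xS _] /andP[yS _]; rewrite join_sim.
move=> x xL; exists x => //; have [r1 _ _] := sim_equiv a DP SP.
by apply: r1; move: xL; rewrite inE => /andP[].
Qed.

End AddPoint.

Section TypesDiffer.
Variables (W : finType) (P S : {set W}) (D : W -> W -> W -> W -> bool) (a b : W).
Hypotheses (DP : separation P D) (SP : S \subset P) (aP : a \in P) (bP : b \in P).
Hypothesis Ntype : ~ {in S & &, forall x y z, D a x y z = D b x y z}.

(** When some triple of [S] tells [a] from [b], a split of the tree of [S] has [a]
    and [b] attached on its two sides. Seen from [a], the point [b] then falls in a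
    class that was already there, and that class was not a singleton. *)
Lemma weight_add (A : pzSemiRingType) (t : nat -> nat -> A) :
  weight t D (b |: S) a = weight t D S a.
Proof.
have [rb|Nb] := boolP (realized D S b); first exact: (weight_add_realized DP SP aP bP).
have [/exists_inP[c cS ac]|Na] := boolP (realized D S a).
  rewrite /weight; have -> : realized D (b |: S) a.
    by apply/exists_inP; exists c; rewrite // setU1r.
  by have -> : realized D S a by apply/exists_inP; exists c.
have [x [y [z [[xS yS zS] Nxyz]]]] : exists x y z,
    [/\ x \in S, y \in S & z \in S] /\ D a x y z != D b x y z.
  apply: contrapT => Nex; apply: Ntype => x y z xS yS zS; apply/eqP.
  by apply: contra_notT Nex => ?; exists x, y, z.
have [c [d [cS dS bcad]]] : exists c d, [/\ c \in S, d \in S & D b c a d].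
  have /orP[/andP[Da /negP Nb']|/andP[/negP Na' Db]] :
      (D a x y z) && ~~ (D b x y z) || ~~ (D a x y z) && (D b x y z).
    by move: Nxyz; case: (D a x y z); case: (D b x y z).
    have [//|D1] := sep_satP DP bP Da.
    have Da' : D a x z y by sep_sym DP Da.
    have [D2|D2] := sep_satP DP bP Da'.
      by case: Nb'; sep_sym DP D2.
    by exists z, x; split=> //; sep_sym DP D2.
  have [//|D1] := sep_satP DP aP Db.
  by exists x, y; split=> //; sep_sym DP D1.
exact: (weight_join DP SP aP bP cS dS bcad Na Nb Ntype).
Qed.

End TypesDiffer.

(** * Cuts and pullbacks *)

Section Constructions.
Variables (W : finType).
Implicit Types (P S A : {set W}) (D : W -> W -> W -> W -> bool).

Definition cut P D : W -> W -> W -> W -> bool :=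
  fun x y z w => [&& x \in P, y \in P, z \in P, w \in P & D x y z w].

Lemma cutE P D x y z w : x \in P -> y \in P -> z \in P -> w \in P ->
  cut P D x y z w = D x y z w.
Proof. by rewrite /cut => -> -> -> ->. Qed.

Lemma cutP P D x y z w :
  reflect ([/\ x \in P, y \in P, z \in P & w \in P] /\ D x y z w)
          (cut P D x y z w).
Proof. by apply: (iffP and5P) => [[]|[[]]]. Qed.

Lemma presep_cut P P' D : presep P D -> P' \subset P -> presep P' (cut P' D).
Proof.
move=> DP /subsetP sub; split.
- by move=> x y z w /cutP[[]].
- by move=> x y z w; rewrite /cut (sep_flip DP); do 2!case: (_ \in P').
- move=> x y z w; rewrite /cut (sep_swap DP).
  by do 4!case: (_ \in P').
- move=> x y z w /cutP[_ Dx]; apply/negP => /cutP[_ Dx'].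
  sep_absurd DP Dx Dx'.
- move=> t x y z w tP /cutP[[xP yP zP wP] Dx]; rewrite !cutE //.
  by apply: (sep_sat DP) => //; apply: sub.
Qed.

Lemma separation_cut P P' D :
  separation P D -> P' \subset P -> separation P' (cut P' D).
Proof.
move=> DP sub; split; first exact: presep_cut DP sub.
move=> x y z /cutP[[xP _ zP _] Dx] /cutP[[yP _ _ _] Dy].
by rewrite cutE //; apply: (sep_point DP).
Qed.

Lemma presep_pull (W' : finType) (P : {set W}) (P' : {set W'})
    (D' : W' -> W' -> W' -> W' -> bool) (f : W -> W') :
  presep P' D' -> {in P, forall x, f x \in P'} ->
  presep P (cut P (fun x y z w => D' (f x) (f y) (f z) (f w))).
Proof.
move=> DP fP; split.
- by move=> x y z w /cutP[[]].
- by move=> x y z w; rewrite /cut (sep_flip DP); do 2!case: (_ \in P).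
- move=> x y z w; rewrite /cut (sep_swap DP).
  by do 4!case: (_ \in P).
- move=> x y z w /cutP[_ Dx]; apply/negP => /cutP[_ Dx'].
  sep_absurd DP Dx Dx'.
- move=> t x y z w tP /cutP[[xP yP zP wP] Dx]; rewrite !cutE //.
  by apply: (sep_sat DP) => //; apply: fP.
Qed.

Lemma separation_pull (W' : finType) (P : {set W}) (P' : {set W'})
    (D' : W' -> W' -> W' -> W' -> bool) (f : W -> W') :
  separation P' D' -> {in P, forall x, f x \in P'} ->
  separation P (cut P (fun x y z w => D' (f x) (f y) (f z) (f w))).
Proof.
move=> DP fP; split; first exact: (presep_pull DP fP).
move=> x y z /cutP[[xP _ zP _] Dx] /cutP[[yP _ _ _] Dy].
by rewrite cutE //; apply: (sep_point DP).
Qed.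

(** Two systems of splits can be joined when no split of one crosses a split of
    the other. *)
Lemma presep_join P D1 D2 : presep P D1 -> presep P D2 ->
  (forall x y z w, D1 x y z w -> ~~ D2 x z y w) ->
  presep P (fun x y z w => D1 x y z w || D2 x y z w).
Proof.
move=> P1 P2 cross; split.
- by move=> x y z w /orP[/(sep_supp P1)|/(sep_supp P2)].
- by move=> x y z w; rewrite (sep_flip P1) (sep_flip P2).
- by move=> x y z w; rewrite (sep_swap P1) (sep_swap P2).
- move=> x y z w /orP[D12|D12]; rewrite negb_or.
    by rewrite cross // (sep_thin P1 D12).
  by rewrite (sep_thin P2 D12) andbT; apply: contraL D12; apply: cross.
- move=> t x y z w tP /orP[D12|D12].
    by case/orP: (sep_sat P1 tP D12) => ->; rewrite ?orbT.
  by case/orP: (sep_sat P2 tP D12) => ->; rewrite ?orbT.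
Qed.

Definition point_split (c : W) : W -> W -> W -> W -> bool := fun x y z w =>
  [&& x == c, y == c, z != c & w != c] || [&& x != c, y != c, z == c & w == c].

Definition isolate P (c : W) D : W -> W -> W -> W -> bool :=
  fun x y z w => D x y z w || cut P (point_split c) x y z w.

Lemma presep_isolate P c D : presep P D -> presep P (isolate P c D).
Proof.
move=> DP; apply: presep_join => //; last first.
  move=> x y z w Dx; apply/negP => /cutP[_ /orP[]] /and4P[].
    by move=> /eqP xE /eqP zE _ _; move: Dx; rewrite xE zE (sep_irr2 DP).
  by move=> _ _ /eqP yE /eqP wE; move: Dx; rewrite yE wE (sep_irr3 DP).
split.
- by move=> x y z w /cutP[[]].
- move=> x y z w; rewrite /cut /point_split.
  by case: (x == c); case: (y == c); case: (x \in P); case: (y \in P).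
- move=> x y z w; rewrite /cut /point_split; do 4!case: (_ \in P) => //=.
  by case: (x == c); case: (y == c); case: (z == c); case: (w == c).
- move=> x y z w /cutP[[xP yP zP wP]]; rewrite cutE // /point_split.
  by case: (x == c); case: (y == c); case: (z == c); case: (w == c).
- move=> t x y z w tP /cutP[[xP yP zP wP]]; rewrite !cutE // /point_split.
  by case: (x == c); case: (y == c); case: (z == c); case: (w == c); case: (t == c).
Qed.

End Constructions.

Section SplitDecomposition.
Variables (W : finType) (P : {set W}) (D : W -> W -> W -> W -> bool) (I : pred W).
Hypothesis DP : presep P D.
Hypothesis DI : {in P & &, forall p q r, forall s, s \in P ->
  I p -> I q -> ~~ I r -> ~~ I s -> D p q r s}.

Lemma split_no_cross p q r s : I p -> I r -> ~~ I q -> ~~ I s -> D p q r s = false.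
Proof.
move=> Ip Ir Iq Is; apply/negP => /[dup] Dp /(sep_mem DP)[pP qP rP sP].
have Dp' := DI pP rP qP sP Ip Ir Iq Is; sep_absurd DP Dp Dp'.
Qed.

Lemma split_move_out r r' y z w : r' \in P -> ~~ I r -> ~~ I r' -> I y -> I z -> I w ->
  D r y z w -> D r' y z w.
Proof.
move=> r'P Ir Ir' Iy Iz Iw /[dup] Dr /(sep_satP DP r'P)[//|D1].
have [rP yP zP wP] := sep_mem DP D1.
have D2 := DI yP zP rP r'P Iy Iz Ir Ir'; sep_absurd DP D1 D2.
Qed.

Lemma split_move_in r r' y z w : r' \in P -> I r -> I r' -> ~~ I y -> ~~ I z -> ~~ I w ->
  D r y z w -> D r' y z w.
Proof.
move=> r'P Ir Ir' Iy Iz Iw /[dup] Dr /(sep_satP DP r'P)[//|D1].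
have [rP yP zP wP] := sep_mem DP D1.
have D2 := DI rP r'P yP zP Ir Ir' Iy Iz; sep_absurd DP D1 D2.
Qed.

Variables (x0 y0 : W).
Hypotheses (x0P : x0 \in P) (y0P : y0 \in P) (Ix0 : I x0) (Iy0 : ~~ I y0).

Definition collapse_out t := if I t then t else y0.
Definition collapse_in t := if I t then x0 else t.

(** A split cuts the tree into two trees, each with the other one collapsed to a
    point. *)
Lemma split_decomposition x y z w : x \in P -> y \in P -> z \in P -> w \in P ->
  D x y z w =
  D (collapse_out x) (collapse_out y) (collapse_out z) (collapse_out w) ||
  D (collapse_in x) (collapse_in y) (collapse_in z) (collapse_in w).
Proof.
have fl := sep_flip DP; have fr := sep_flipr DP; have sw := sep_swap DP.
have irr := sep_irr DP.
move=> xP yP zP wP; rewrite /collapse_out /collapse_in.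
have out1 u v s r r' : r \in P -> r' \in P -> ~~ I r -> ~~ I r' -> I u -> I v -> I s ->
    D r u v s = D r' u v s.
  by move=> rP r'P Ir Ir' Iu Iv Is; apply/idP/idP; apply: split_move_out.
have in1 u v s r r' : r \in P -> r' \in P -> I r -> I r' -> ~~ I u -> ~~ I v -> ~~ I s ->
    D r u v s = D r' u v s.
  by move=> rP r'P Ir Ir' Iu Iv Is; apply/idP/idP; apply: split_move_in.
have DIE p q r s : p \in P -> q \in P -> r \in P -> s \in P ->
  I p -> I q -> ~~ I r -> ~~ I s -> D p q r s = true by move=> *; apply: DI.
have NC := split_no_cross.
have [Ix|Ix] := boolP (I x); have [Iy|Iy] := boolP (I y);
have [Iz|Iz] := boolP (I z); have [Iw|Iw] := boolP (I w); rewrite ?irr ?orbF //=.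
- by rewrite fr sw [in RHS]fr [in RHS]sw (out1 _ _ _ w y0).
- by rewrite sw [in RHS]sw (out1 _ _ _ z y0).
- by rewrite !DIE.
- by rewrite fl [in RHS]fl (out1 _ _ _ y y0).
- by rewrite NC.
- by rewrite fr NC.
- by rewrite (in1 _ _ _ x x0).
- by rewrite (out1 _ _ _ x y0).
- by rewrite fl NC.
- by rewrite fl fr NC.
- by rewrite fl [in RHS]fl (in1 _ _ _ y x0).
- by rewrite sw DIE // [D y0 _ _ _]sw DIE.
- by rewrite sw [in RHS]sw (in1 _ _ _ z x0).
- by rewrite fr sw [in RHS]fr [in RHS]sw (in1 _ _ _ w x0).
Qed.

End SplitDecomposition.

(** An inclusion between two systems of splits on [a |: (b |: S)] has to be checked
    on few quadruples: a degenerate one that contains both [a] and [b] follows from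
    the others by [sep_point]. *)
Section Extensionality.
Variables (W : finType) (S : {set W}) (a b : W).
Let P := a |: (b |: S).
Variables (Q Q' : W -> W -> W -> W -> bool).
Hypotheses (QP : presep P Q) (QP' : separation P Q').
Hypothesis Qa : forall x y z w, x \in a |: S -> y \in a |: S -> z \in a |: S ->
  w \in a |: S -> Q x y z w -> Q' x y z w.
Hypothesis Qb : forall x y z w, x \in b |: S -> y \in b |: S -> z \in b |: S ->
  w \in b |: S -> Q x y z w -> Q' x y z w.
Hypothesis Qaabb : Q a a b b -> Q' a a b b.
Hypothesis Qaxby : {in S &, forall x y, Q a x b y -> Q' a x b y}.
Hypothesis Qabxy : {in S &, forall x y, Q a b x y -> Q' a b x y}.

Let inP x : x \in P -> [\/ x = a, x = b | x \in S].
Proof. by case/setU1P=> [|/setU1P[]]; [constructor 1|constructor 2|constructor 3]. Qed.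

Lemma sep_mono_ab y z w : Q a y z w -> b \in [:: y; z; w] -> Q' a y z w.
Proof.
have irr := (sep_irr QP).
have aux u v : Q a u b v -> Q' a u b v.
  move=> Qu; have [_ uP _ vP] := sep_mem QP Qu.
  have Qab := sep_diagr QP (sep_diagl QP Qu).
  case: (inP uP) Qu => [->|->|uS]; case: (inP vP) => [->|->|vS] Qu;
    rewrite ?irr // in Qu *; try exact: Qaabb.
  - have Qaav : Q a a v v by apply: (sep_diagr QP (w := b)); rewrite (sep_flipr QP).
    rewrite (sep_swap QP'); apply: (sep_point QP'); rewrite (sep_swap QP').
      exact: Qaabb.
    by apply: Qa; rewrite ?setU11 ?setU1r.
  - have Quub : Q u u b b by apply: (sep_diagl QP (y := a)); rewrite (sep_flip QP).
    apply: (sep_point QP'); first exact: Qaabb.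
    by apply: Qb; rewrite ?setU11 ?setU1r.
  - exact: Qaxby.
move=> Qy; have [_ yP zP wP] := sep_mem QP Qy.
rewrite !inE => /or3P[] /eqP bE; rewrite -bE in Qy *.
- case: (inP zP) Qy => [->|->|zS]; case: (inP wP) => [->|->|wS] Qy;
    rewrite ?irr // in Qy *.
  exact: Qabxy.
- exact: aux.
- by rewrite (sep_flipr QP'); apply: aux; rewrite (sep_flipr QP).
Qed.

Lemma sep_mono x y z w : Q x y z w -> Q' x y z w.
Proof.
move=> Qx; have [xP yP zP wP] := sep_mem QP Qx.
have [Nb|Nb] := boolP (b \in [:: x; y; z; w]); last first.
  have inS u : u \in [:: x; y; z; w] -> u \in P -> u \in a |: S.
    move=> uI /inP[->|uE|uS]; rewrite ?setU11 ?setU1r //.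
    by rewrite uE (negPf Nb) in uI.
  by apply: Qa => //; apply: inS; rewrite // !inE eqxx ?orbT.
have [Na|Na] := boolP (a \in [:: x; y; z; w]); last first.
  have inS u : u \in [:: x; y; z; w] -> u \in P -> u \in b |: S.
    move=> uI /inP[uE|->|uS]; rewrite ?setU11 ?setU1r //.
    by rewrite uE (negPf Na) in uI.
  by apply: Qb => //; apply: inS; rewrite // !inE eqxx ?orbT.
have [ab|ab] := eqVneq a b.
  apply: Qa => //; [case: (inP xP)|case: (inP yP)|case: (inP zP)|case: (inP wP)];
  by move=> uE; rewrite !inE ?uE ?ab ?eqxx ?orbT.
have ba : (b == a) = false by rewrite eq_sym (negPf ab).
have key u v s : Q a u v s -> b \in [:: u; v; s] -> Q' a u v s by apply: sep_mono_ab.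
move: Na Nb; rewrite !inE => /or4P[] /eqP aE; rewrite -aE ?ba /= => Nb; rewrite -aE in Qx.
- by apply: key => //; rewrite !inE.
- by rewrite (sep_flip QP'); apply: key; rewrite 1?(sep_flip QP) // !inE.
- rewrite (sep_swap QP'); apply: key; first by rewrite (sep_swap QP).
  by rewrite !inE; move: Nb; case: (b == x); case: (b == y); case: (b == w).
- rewrite (sep_swap QP') (sep_flip QP'); apply: key.
    by rewrite (sep_flip QP) (sep_swap QP).
  by rewrite !inE; move: Nb; case: (b == x); case: (b == y); case: (b == z).
Qed.

End Extensionality.

(** * Extensions by two points *)

Section Lifts.
Variables (W : finType) (S : {set W}) (a b : W).
Let P := a |: (b |: S).
Variables (q D : W -> W -> W -> W -> bool).

Definition eq_on (S' : {set W}) (D1 D2 : W -> W -> W -> W -> bool) : Prop :=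
  forall x y z w, x \in S' -> y \in S' -> z \in S' -> w \in S' ->
  D1 x y z w = D2 x y z w.

(** [q] is a tree on [a |: S] and [D] one on [b |: S]; the lifts are their common
    extensions, in which [a] and [b] may coincide. *)
Definition lift (p : W -> W -> W -> W -> bool) : Prop :=
  [/\ separation P p, eq_on (a |: S) p q & eq_on (b |: S) p D].

Hypotheses (aS : a \notin S) (bS : b \notin S) (ab : a != b).
Hypotheses (qP : separation (a |: S) q) (DP : separation (b |: S) D).
Hypothesis qD : eq_on S q D.

Let inP x : x \in P -> [\/ x = a, x = b | x \in S].
Proof. by case/setU1P=> [|/setU1P[]]; [constructor 1|constructor 2|constructor 3]. Qed.
Let SPa : S \subset a |: S. Proof. exact: subsetUr. Qed.
Let SPb : S \subset b |: S. Proof. exact: subsetUr. Qed.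
Let aSP x : x \in a |: S -> x \in P.
Proof. by case/setU1P=> [->|xS]; rewrite /P ?setU11 ?setU1r. Qed.
Let bSP x : x \in b |: S -> x \in P.
Proof. by move=> xS; apply: setU1r. Qed.
Let SP x : x \in S -> x \in P.
Proof. by move=> xS; rewrite /P !setU1r. Qed.
Let inSa x : x \in S -> x \in a |: S. Proof. exact: setU1r. Qed.
Let inSb x : x \in S -> x \in b |: S. Proof. exact: setU1r. Qed.
Let aPa : a \in a |: S. Proof. exact: setU11. Qed.
Let bPb : b \in b |: S. Proof. exact: setU11. Qed.
Let aP : a \in P. Proof. exact: setU11. Qed.
Let bP : b \in P. Proof. exact: bSP. Qed.

(** ** Placing [a] at the same point as [c] *)
Section Duplicate.
Variable c : W.
Hypothesis cSb : c \in b |: S.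
(** [a] is sent to [c], at whose place it is put. *)
Definition relabel t := if t == a then c else t.

Lemma relabelP t : t \in P -> relabel t \in b |: S.
Proof.
move/inP=> [->|->|tS]; rewrite /relabel ?eqxx //.
  by rewrite eq_sym (negPf ab).
by case: eqVneq => // _; apply: inSb.
Qed.

Lemma relabel_id t : t \in b |: S -> relabel t = t.
Proof.
rewrite /relabel; case: eqVneq => // -> /setU1P[ab'|aS'].
  by move: ab; rewrite ab' eqxx.
by move: aS; rewrite aS'.
Qed.

Definition duplicate := cut P (fun x y z w =>
  D (relabel x) (relabel y) (relabel z) (relabel w)).

Lemma lift_duplicate :
  eq_on (a |: S) q (fun x y z w => D (relabel x) (relabel y) (relabel z) (relabel w)) ->
  lift duplicate.
Proof.
move=> qE; split.
- exact: (separation_pull DP relabelP).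
- by move=> x y z w xP yP zP wP; rewrite /duplicate cutE ?aSP // qE.
- move=> x y z w xP yP zP wP; rewrite /duplicate cutE ?bSP //.
  by rewrite !relabel_id.
Qed.

Lemma lift_same_eq p : lift p -> same p a c -> eq_on P p duplicate.
Proof.
move=> [pP _ pD] ac x y z w xP yP zP wP.
have cP := bSP cSb.
have rel t : t \in P -> relabel t \in P /\ same p t (relabel t).
  move=> tP; rewrite /relabel; case: eqVneq => [->//|_]; split=> //.
  exact: (same_refl pP).
have [[xP' xx] [yP' yy]] := (rel x xP, rel y yP).
have [[zP' zz] [wP' ww]] := (rel z zP, rel w wP).
rewrite /duplicate cutE // -pD ?relabelP //; apply/idP/idP => px;
  apply: (same_sub4 pP _ _ _ _ _ _ _ _ px) => //; by rewrite (sameC pP).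
Qed.

End Duplicate.

(** ** Gluing along a split with [a] and [b] on different sides *)
Section Glue.
Variables (A : {set W}) (x0 y0 : W).
Hypotheses (AS : A \subset S) (x0A : x0 \in A) (y0S : y0 \in S) (y0A : y0 \notin A).
Let I := mem (a |: A).

(** A tree with the split [a |: A] is obtained from its two sides: the part around [a]
    is read off from [q], the part around [b] from [D]. The base points [x0] and [y0]
    stand for the side that is collapsed. *)
Definition glue := fun x y z w =>
  cut P (fun x y z w => q (collapse_out I y0 x) (collapse_out I y0 y)
                          (collapse_out I y0 z) (collapse_out I y0 w)) x y z w ||
  cut P (fun x y z w => D (collapse_in I x0 x) (collapse_in I x0 y)
                          (collapse_in I x0 z) (collapse_in I x0 w)) x y z w.

Let x0S : x0 \in S. Proof. exact: subsetP AS _ x0A. Qed.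
Let Ia : I a. Proof. exact: setU11. Qed.
Let NIb : ~~ I b.
Proof.
apply/setU1P=> -[ba|bA]; first by move: ab; rewrite ba eqxx.
by move: bS; rewrite (subsetP AS).
Qed.
Let IS t : t \in S -> I t = (t \in A).
Proof.
move=> tS; apply/setU1P/idP => [[tE|]//|tA]; last by right.
by move: aS; rewrite -tE tS.
Qed.
Let outP t : t \in P -> collapse_out I y0 t \in a |: S.
Proof.
rewrite /collapse_out; case: ifP => [/setU1P[->//|tA] _|_ _]; last exact: inSa.
exact/inSa/(subsetP AS).
Qed.
Let out_S t : t \in b |: S -> collapse_out I y0 t \in S.
Proof.
rewrite /collapse_out => /setU1P[->|tS]; first by rewrite (negPf NIb).
by case: ifP.
Qed.
Let in_P t : t \in P -> collapse_in I x0 t \in b |: S.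
Proof.
rewrite /collapse_in => /inP[->|->|tS].
- by rewrite Ia inSb.
- by rewrite (negPf NIb).
- by case: ifP => _; apply: inSb.
Qed.
Let in_S t : t \in a |: S -> collapse_in I x0 t \in S.
Proof.
rewrite /collapse_in => /setU1P[->|tS]; first by rewrite Ia.
by case: ifP.
Qed.

Lemma lift_split_eq p : lift p ->
  {in P & &, forall x y z, forall w, w \in P -> I x -> I y -> ~~ I z -> ~~ I w -> p x y z w} ->
  eq_on P p glue.
Proof.
move=> [pP pq pD] pI x y z w xP yP zP wP; rewrite /glue !cutE //.
have NIy0 : ~~ I y0 by rewrite IS.
have Ix0 : I x0 by rewrite IS.
rewrite (split_decomposition pP pI (SP x0S) (SP y0S) Ix0 NIy0) //.
by rewrite pq ?outP // pD ?in_P.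
Qed.

Hypothesis qI : forall x y z w, x \in a |: A -> y \in a |: A ->
  z \in S -> w \in S -> z \notin A -> w \notin A -> q x y z w.
Hypothesis DI : forall x y z w, x \in A -> y \in A ->
  z \in b |: S -> w \in b |: S -> z \notin A -> w \notin A -> D x y z w.

Lemma lift_glue : lift glue.
Proof.
have NIy0 : ~~ I y0 by rewrite IS.
have Ix0 : I x0 by rewrite IS.
have irrq := sep_irr qP; have irrD := sep_irr DP.
have toS t : t \in a |: S -> ~~ I t -> t \in S.
  by case/setU1P=> [->|//]; rewrite Ia.
have toA t : t \in b |: S -> I t -> t \in A.
  by case/setU1P=> [->|tS]; [rewrite (negPf NIb)|rewrite IS].
have NA t : t \in P -> ~~ I t -> t \in b |: S /\ t \notin A.
  case/inP=> [->|->|tS]; [by rewrite Ia| |by rewrite IS ?inSb].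
  by move=> _; split=> //; apply/negP => /(subsetP AS); apply/negP.
have presep_glue : presep P glue.
  apply: presep_join.
  - exact: (presep_pull qP outP).
  - exact: (presep_pull DP in_P).
  move=> x y z w /cutP[_]; rewrite /cut /collapse_out /collapse_in.
  case: (I x); case: (I y); case: (I z); case: (I w);
    by rewrite ?irrq ?irrD ?andbF.
split.
- split=> // x y z Gx Gy.
  have [xP _ zP _] := sep_mem presep_glue Gx.
  have [yP _ _ _] := sep_mem presep_glue Gy.
  rewrite /glue !cutE //; have [Iz|Iz] := boolP (I z); apply/orP; [left|right].
    have aux t : t \in P -> glue t t z z ->
        q (collapse_out I y0 t) (collapse_out I y0 t) (collapse_out I y0 z) (collapse_out I y0 z).
      move=> tP; rewrite /glue !cutE // /collapse_in /collapse_out Iz.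
      have [It|It] := boolP (I t); first by rewrite irrD orbF.
      by move=> _; rewrite (sep_swap qP); apply: qI.
    by apply: (sep_point qP); apply: aux.
  have aux t : t \in P -> glue t t z z ->
      D (collapse_in I x0 t) (collapse_in I x0 t) (collapse_in I x0 z) (collapse_in I x0 z).
    move=> tP; rewrite /glue !cutE // /collapse_in /collapse_out (negPf Iz).
    have [It|It] := boolP (I t); last by rewrite irrq.
    by have [zb zA] := NA _ zP Iz; move=> _; apply: DI.
  by apply: (sep_point DP); apply: aux.
- move=> x y z w xP yP zP wP; rewrite /glue !cutE ?aSP //.
  rewrite [RHS](split_decomposition qP (I := I) _ (inSa x0S) (inSa y0S) Ix0 NIy0) //.
    by rewrite -qD ?in_S.
  move=> x1 y1 z1 x1P y1P z1P w1 w1P Ix1 Iy1 Iz1 Iw1.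
  by apply: qI; rewrite ?toS // -IS ?toS.
move=> x y z w xP yP zP wP; rewrite /glue !cutE ?bSP //.
rewrite [RHS](split_decomposition DP (I := I) _ (inSb x0S) (inSb y0S) Ix0 NIy0) //.
  by rewrite qD ?out_S.
move=> x1 y1 z1 x1P y1P z1P w1 w1P Ix1 Iy1 Iz1 Iw1.
have [_ z1A] := NA _ (bSP z1P) Iz1; have [_ w1A] := NA _ (bSP w1P) Iw1.
exact: DI (toA _ x1P Ix1) (toA _ y1P Iy1) z1P w1P z1A w1A.
Qed.

End Glue.

(** ** The types of [a] and [b] differ *)
Lemma lift_differ x y z : x \in S -> y \in S -> z \in S ->
  q a x y z -> ~~ D b x y z ->
  exists p0, lift p0 /\ forall p, lift p -> eq_on P p p0.
Proof.
move=> xS yS zS qx NDx.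
pose A := [set t in S | q a t y z].
have AS : A \subset S by apply/subsetP=> t; rewrite inE => /andP[].
have xA : x \in A by rewrite inE xS.
have yA : y \notin A by rewrite inE (sep_irr1 qP) andbF.
exists (glue A x y); split.
  have Da t : t \in A -> D x t y z.
    rewrite inE => /andP[tS qt]; rewrite -qD //; exact: (sep_transl qP qx qt).
  apply: lift_glue => //.
    move=> x1 y1 z1 w1 x1A y1A z1S w1S z1A w1A.
    have qA t : t \in a |: A -> q a t y z.
      by rewrite !inE => /orP[/eqP->|/andP[]//]; apply: (sep_diagl qP qx).
    have NA t : t \in S -> t \notin A -> ~~ q a t y z by move=> tS; rewrite inE tS.
    by apply: (sep_split qP (qA _ x1A) (qA _ y1A)); rewrite ?inSa ?NA.
  have NDA t : t \in b |: S -> t \notin A -> ~~ D x t y z.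
    case/setU1P=> [->|tS]; first by rewrite (sep_flip DP).
    rewrite inE tS /=; apply: contra; rewrite -qD // => qt.
    have qx' : q x a y z by sep_sym qP qx.
    exact: (sep_transl qP qx' qt).
  move=> x1 y1 z1 w1 x1A y1A z1S w1S z1A w1A.
  by apply: (sep_split DP (Da _ x1A) (Da _ y1A)); rewrite ?NDA.
move=> p lp; apply: lift_split_eq => //.
have [pP pq pD] := lp.
have paE t : t \in P -> (t \in a |: A) = p a t y z.
  case/inP=> [->|->|tS].
  - by rewrite setU11 pq ?(aPa, inSa) // (sep_diagl qP qx).
  - rewrite !inE eq_sym (negPf ab) (negPf bS) /=; apply/esym/negP => pab.
    have pax : p a x y z by rewrite pq ?(aPa, inSa).
    by case/negP: NDx; rewrite -pD ?(bPb, inSb) //; apply: (sep_transl pP pab pax).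
  - rewrite !inE pq ?(aPa, inSa) // tS /=; case: eqP => [tE|//].
    by rewrite tE (negPf aS) in tS.
move=> x1 y1 z1 x1P y1P z1P w1 w1P /=; rewrite !paE // => px1 py1 pz1 pw1.
exact: (sep_split pP px1 py1).
Qed.

End Lifts.

(** * Extensions by two points of the same type *)

Section SameType.
Variables (W : finType) (S : {set W}) (a b : W).
Let P := a |: (b |: S).
Variables (q D : W -> W -> W -> W -> bool).
Hypotheses (aS : a \notin S) (bS : b \notin S) (ab : a != b).
Hypotheses (qP : separation (a |: S) q) (DP : separation (b |: S) D).
Hypothesis qD : eq_on S q D.
Hypothesis tsame : {in S & &, forall x y z, q a x y z = D b x y z}.
Hypotheses (Na : ~~ realized q S a) (Nb : ~~ realized D S b).

Let ba : (b == a) = false. Proof. by rewrite eq_sym (negPf ab). Qed.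
Let inP x : x \in P -> [\/ x = a, x = b | x \in S].
Proof. by case/setU1P=> [|/setU1P[]]; [constructor 1|constructor 2|constructor 3]. Qed.
Let SPa : S \subset a |: S. Proof. exact: subsetUr. Qed.
Let SPb : S \subset b |: S. Proof. exact: subsetUr. Qed.
Let aSP x : x \in a |: S -> x \in P.
Proof. by case/setU1P=> [->|xS]; rewrite /P ?setU11 ?setU1r. Qed.
Let bSP x : x \in b |: S -> x \in P.
Proof. by move=> xS; apply: setU1r. Qed.
Let SP x : x \in S -> x \in P.
Proof. by move=> xS; rewrite /P !setU1r. Qed.
Let inSa x : x \in S -> x \in a |: S. Proof. exact: setU1r. Qed.
Let inSb x : x \in S -> x \in b |: S. Proof. exact: setU1r. Qed.
Let aPa : a \in a |: S. Proof. exact: setU11. Qed.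
Let bPb : b \in b |: S. Proof. exact: setU11. Qed.
Let aP : a \in P. Proof. exact: setU11. Qed.
Let bP : b \in P. Proof. exact: bSP. Qed.
Let neqa x : x \in S -> (x == a) = false.
Proof. by move=> xS; apply: contraNF aS => /eqP<-. Qed.
Let neqb x : x \in S -> (x == b) = false.
Proof. by move=> xS; apply: contraNF bS => /eqP<-. Qed.
Let rel := relabel a b.
Let rela : rel a = b. Proof. by rewrite /rel /relabel eqxx. Qed.
Let relS x : x \in S -> rel x = x.
Proof. by move=> xS; rewrite /rel /relabel neqa. Qed.
Let relb : rel b = b. Proof. by rewrite /rel /relabel ba. Qed.
Let bbSS : b \in b |: S := bPb.

Lemma unrealized_pair T (c : W) (E : W -> W -> W -> W -> bool) :
  separation T E -> ~~ realized E S c -> {in S &, forall x y, E c c x y}.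
Proof.
move=> EP Nc x y xS yS; rewrite (sep_swap EP).
by apply: (sep_point EP); rewrite (sep_swap EP); apply: (unrealized Nc).
Qed.

Let qaa x y : x \in S -> y \in S -> q a a x y.
Proof. exact: (unrealized_pair qP Na). Qed.
Let Dbb x y : x \in S -> y \in S -> D b b x y.
Proof. exact: (unrealized_pair DP Nb). Qed.

(** As the types of [a] and [b] agree, exchanging the names [a] and [b] carries one
    extension to the other. *)
Lemma same_type_relabel :
  eq_on (a |: S) q (fun x y z w => D (rel x) (rel y) (rel z) (rel w)).
Proof.
have irr := (sep_irr qP, sep_irr DP).
move=> x y z w /setU1P[->|xS] /setU1P[->|yS] /setU1P[->|zS] /setU1P[->|wS];
  rewrite ?rela ?relS ?irr //.
- by rewrite qaa ?Dbb.
- exact: tsame.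
- by rewrite (sep_flip qP) (sep_flip DP) tsame.
- by rewrite (sep_swap qP) (sep_swap DP) qaa ?Dbb.
- by rewrite (sep_swap qP) (sep_swap DP) tsame.
- by rewrite (sep_flipr qP) (sep_swap qP) (sep_flipr DP) (sep_swap DP) tsame.
- exact: qD.
Qed.

Lemma lift_eq_point : lift S a b q D (duplicate S a b D b).
Proof. exact: (lift_duplicate aS ab DP bPb same_type_relabel). Qed.

(** ** Adding [a] next to [b] without separating it from [b] otherwise *)
Section Twin.
Variable C : W -> W -> W -> W -> bool.
Hypotheses (CP : presep (b |: S) C).
Hypothesis CD : forall x y z w, C x y z w -> D x y z w.
Hypothesis DC : forall x y z w, D x y z w -> C x y z w || point_split b x y z w.
Hypothesis Cbb : {in S, forall z, C b b z z}.

(** The point [a] becomes a copy of [b] for the splits in [C], and [a] and [b] are then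
    isolated from each other and from the rest. Taking [C] to be all the splits gives
    a cherry; leaving out the split that isolates [b] gives two edges at one vertex. *)
Definition twin :=
  isolate P a (isolate P b (cut P (fun x y z w => C (rel x) (rel y) (rel z) (rel w)))).

Lemma twin_presep : presep P twin.
Proof.
do 2!apply: presep_isolate; apply: (presep_pull CP).
exact: (relabelP ab bPb).
Qed.

Lemma twinE x y z w : x \in P -> y \in P -> z \in P -> w \in P ->
  twin x y z w = [|| C (rel x) (rel y) (rel z) (rel w), point_split b x y z w
                   | point_split a x y z w].
Proof. by move=> xP yP zP wP; rewrite /twin /isolate !cutE // orbA. Qed.

Lemma lift_twin : lift S a b q D twin.
Proof.
have irr := sep_irr twin_presep; split.
- split; first exact: twin_presep.
  move=> x y z tx ty; have [xP _ zP _] := sep_mem twin_presep tx.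
  have [yP _ _ _] := sep_mem twin_presep ty.
  have neq t : twin t t z z -> t != z by apply: contraTneq => ->; rewrite irr.
  have [xz yz] := (neq x tx, neq y ty); rewrite twinE //.
  case: (inP zP) => [zE|zE|zS].
  - by rewrite -zE /point_split xz yz eqxx !orbT.
  - by rewrite -zE /point_split xz yz eqxx !orbT.
  have auxD t : t \in P -> twin t t z z -> D (rel t) (rel t) (rel z) (rel z).
    move=> tP; rewrite twinE // (relS zS); case: (inP tP) => [->|->|tS].
    - by rewrite rela Dbb.
    - by rewrite relb Dbb.
    by rewrite /point_split (neqa tS) (neqb tS) (neqa zS) (neqb zS) !andbF !orbF => /CD.
  have := sep_point DP (auxD x xP tx) (auxD y yP ty) => /DC/orP[->//|].
  rewrite (relS zS) /point_split (neqb zS) /= !andbF !orbF andbT.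
  by case/andP=> /eqP-> /eqP->; rewrite Cbb.
- move=> x y z w xS yS zS wS; rewrite same_type_relabel // twinE ?aSP //.
  have relE t : t \in a |: S -> (rel t == b) = (t == a).
    by case/setU1P=> [->|tS]; rewrite ?rela ?eqxx // relS // neqa // neqb.
  have Nb' t : t \in a |: S -> (t == b) = false.
    by case/setU1P=> [->|tS]; [apply: negPf|rewrite neqb].
  have psE : point_split b (rel x) (rel y) (rel z) (rel w) = point_split a x y z w.
    by rewrite /point_split !relE.
  have -> : point_split b x y z w = false by rewrite /point_split !Nb' // !andbF.
  rewrite -psE /=; apply/orP/idP => [[/CD//|]|/DC/orP//].
  have toS t : t \in a |: S -> rel t != b -> rel t \in S.
    by case/setU1P=> [->|tS]; rewrite ?rela ?eqxx ?relS.
  rewrite /point_split => /orP[/and4P[/eqP-> /eqP-> zb wb]|/and4P[xb yb /eqP-> /eqP->]].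
    by apply: Dbb; apply: toS.
  by rewrite (sep_swap DP); apply: Dbb; apply: toS.
move=> x y z w xS yS zS wS; rewrite twinE ?bSP //.
have Na' t : t \in b |: S -> (t == a) = false.
  by case/setU1P=> [->|tS]; [exact: ba|rewrite neqa].
have -> : point_split a x y z w = false by rewrite /point_split !Na' // !andbF.
rewrite orbF /rel !(relabel_id aS ab) //; apply/orP/idP => [[/CD//|]|/DC/orP//].
have toS t : t \in b |: S -> t != b -> t \in S by rewrite !inE => /orP[/eqP->|//]; rewrite eqxx.
rewrite /point_split => /orP[/and4P[/eqP-> /eqP-> zb wb]|/and4P[xb yb /eqP-> /eqP->]].
  by apply: Dbb; apply: toS.
by rewrite (sep_swap DP); apply: Dbb; apply: toS.
Qed.

Lemma twin_cross x y : x \in S -> y \in S -> twin a x b y = false.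
Proof.
move=> xS yS; rewrite twinE ?(aP, bP, SP) // rela relb !relS // (sep_irr2 CP) /point_split.
by rewrite (neqa xS) (neqb yS) !eqxx /= !andbF.
Qed.

Lemma twin_pair x y : x \in S -> y \in S -> twin a b x y = C b b x y.
Proof.
move=> xS yS; rewrite twinE ?(aP, bP, SP) // rela relb !relS // /point_split.
by rewrite ?(neqa xS) ?(neqb xS) ?eqxx ?ba ?(negPf ab) /= ?andbF ?orbF.
Qed.

Lemma twin_distinct : twin a a b b.
Proof. by rewrite twinE // /point_split !eqxx ba /= !orbT. Qed.

Lemma lift_twin_eq p : lift S a b q D p -> p a a b b ->
  {in S &, forall x y, ~~ p a x b y} ->
  {in S &, forall x y, p a b x y = C b b x y} -> eq_on P p twin.
Proof.
move=> [pP pq pD] paabb Np pE x y z w xP yP zP wP.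
have [tP tq tD] := lift_twin.
apply/idP/idP.
  apply: (sep_mono (a := a) (b := b) (S := S) pP tP).
  - by move=> *; rewrite tq // -pq.
  - by move=> *; rewrite tD // -pD.
  - by move=> _; apply: twin_distinct.
  - by move=> u v uS vS; rewrite (negPf (Np u v uS vS)).
  - by move=> u v uS vS; rewrite pE // twin_pair.
apply: (sep_mono (a := a) (b := b) (S := S) tP pP).
- by move=> *; rewrite pq // -tq.
- by move=> *; rewrite pD // -tD.
- by [].
- by move=> u v uS vS; rewrite twin_cross.
- by move=> u v uS vS; rewrite pE // twin_pair.
Qed.

End Twin.

Definition sibling := twin D.

Let CDD x y z w : D x y z w -> D x y z w || point_split b x y z w.
Proof. by move=> ->. Qed.
Let CDbb : {in S, forall z, D b b z z}.
Proof. by move=> z zS; apply: Dbb. Qed.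

Lemma lift_sibling : lift S a b q D sibling.
Proof. exact: (lift_twin DP). Qed.

Lemma sibling_eq p : lift S a b q D p -> p a a b b ->
  {in S &, forall x y, ~~ p a x b y} -> {in S &, forall x y, p a b x y} ->
  eq_on P p sibling.
Proof.
move=> lp pab pc pS; apply: (lift_twin_eq DP) => // x y xS yS.
by rewrite pS // Dbb.
Qed.

(** The relation on [b |: S] without the split that cuts off [b]: as [b] hangs
    from a vertex, that is where [a] attaches to share this vertex. *)
Definition unpend : W -> W -> W -> W -> bool := fun x y z w =>
  [&& D x y z w, (x == b) && (y == b) ==> [exists c in S, D b c z w]
               & (z == b) && (w == b) ==> [exists c in S, D b c x y]].

Definition star_point := twin unpend.

Lemma presep_unpend : presep (b |: S) unpend.
Proof.
have irr := sep_irr DP.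
split.
- by move=> x y z w /and3P[/(sep_supp DP)].
- move=> x y z w; rewrite /unpend (sep_flip DP) [(y == b) && _]andbC.
  congr [&& _, _ & _ ==> _]; apply: eq_existsb => c.
  by rewrite (sep_flipr DP).
- move=> x y z w; rewrite /unpend (sep_swap DP).
  by congr andb; rewrite andbC.
- move=> x y z w /and3P[Dx _ _]; apply/negP => /and3P[Dx' _ _].
  sep_absurd DP Dx Dx'.
have intro x y z w : D x y z w -> ((x == b) && (y == b) -> exists2 c, c \in S & D b c z w) ->
    ((z == b) && (w == b) -> exists2 c, c \in S & D b c x y) -> unpend x y z w.
  move=> Dx H1 H2; apply/and3P; split=> //; apply/implyP.
    by move/H1=> [c cS Dc]; apply/exists_inP; exists c.
  by move/H2=> [c cS Dc]; apply/exists_inP; exists c.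
have toS u : u \in b |: S -> u != b -> u \in S by rewrite !inE => /orP[/eqP->|//]; rewrite eqxx.
have mem x y z w : D x y z w -> [/\ x \in b |: S, y \in b |: S, z \in b |: S & w \in b |: S].
  exact: (sep_mem DP).
have unp t x y z w : t \in b |: S -> D x y z w ->
    ((x == b) && (y == b) -> exists2 c, c \in S & D b c z w) ->
    ((z == b) && (w == b) -> exists2 c, c \in S & D b c x y) ->
    unpend t y z w \/ unpend x y z t.
  move=> tP Dx H1 H2.
  have [xb|xb] := boolP ((x == b) && (y == b)).
    case/andP: (xb) Dx => /eqP-> /eqP-> Dx; have [c cS Dc] := H1 xb.
    have Nzw : (z == b) = false by apply: contraTF Dx => /eqP->; rewrite irr.
    have [tb|tb] := eqVneq t b.
      by left; rewrite tb; apply: intro => //; [exists c|rewrite Nzw].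
    have Dc' : D c b z w by sep_sym DP Dc.
    have [D1|D1] := sep_satP DP tP Dc'.
      left; apply: intro => //; first by rewrite (negPf tb).
      by rewrite Nzw.
    right; apply: intro; last by rewrite Nzw.
      by apply: (sep_diagl DP (y := c)); sep_sym DP D1.
    by exists c => //; sep_sym DP D1.
  have [zb|zb] := boolP ((z == b) && (w == b)).
    case/andP: (zb) Dx => /eqP-> /eqP-> Dx; have [c cS Dc] := H2 zb.
    have Dxy : D x y b c by sep_sym DP Dc.
    have Nxy : (y == b) = false by apply: contraTF Dx => /eqP->; rewrite irr.
    have [D1|D1] := sep_satP DP tP Dxy.
      left; apply: intro; [exact: sep_diagr DP _ _ _ _ D1|by rewrite Nxy andbF|].
      by exists c => //; sep_sym DP D1.
    have [tb|tb] := eqVneq t b; first by move: D1; rewrite tb => D1;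
      right; apply: intro => //; [rewrite Nxy andbF|exists c].
    right; apply: intro => //; first by rewrite Nxy andbF.
    by rewrite (negPf tb) andbF.
  have [D1|D1] := sep_satP DP tP Dx.
    left; apply: intro => //; last by rewrite (negPf zb).
    move=> /andP[/eqP tb /eqP yb]; exists x; last by rewrite -yb; sep_sym DP Dx.
    have [xP _ _ _] := mem _ _ _ _ Dx; apply: toS => //.
    by apply: contraNneq xb => ->; rewrite yb eqxx.
  right; apply: intro => //; first by rewrite (negPf xb).
  move=> /andP[/eqP zE /eqP tb]; exists w; last by rewrite -zE; sep_sym DP Dx.
  have [_ _ _ wP] := mem _ _ _ _ Dx; apply: toS => //.
  by apply: contraNneq zb => ->; rewrite zE eqxx.
move=> t x y z w tP /and3P[Dx /implyP H1 /implyP H2].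
by apply/orP; apply: unp => // [/H1/exists_inP|/H2/exists_inP].
Qed.

Lemma unpendW x y z w : unpend x y z w -> D x y z w.
Proof. by case/and3P. Qed.

Lemma unpend_split x y z w : D x y z w -> unpend x y z w || point_split b x y z w.
Proof.
move=> Dx; rewrite /unpend Dx /=.
have irr := sep_irr DP; have [xP yP zP wP] := sep_mem DP Dx.
have toS t : t \in b |: S -> t != b -> t \in S by rewrite !inE => /orP[/eqP->|//]; rewrite eqxx.
rewrite /point_split; have [xb|xb] := eqVneq x b; have [yb|yb] := eqVneq y b;
have [zb|zb] := eqVneq z b; have [wb|wb] := eqVneq w b; rewrite ?orbT //=;
by move: Dx; rewrite ?xb ?yb ?zb ?wb ?irr.
Qed.

Section Nontrivial.
Variables (u v : W).
Hypotheses (uS : u \in S) (vS : v \in S) (uv : ~~ same D u v).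

Lemma unpend_far : {in S, forall z, unpend b b z z}.
Proof.
move=> z zS; rewrite /unpend Dbb //= (neqb zS) andbT !eqxx /=.
apply/exists_inP; have Pbb := Dbb zS zS.
have [zu|zu] := boolP (same D u z).
  exists v => //; apply: (sep_point DP) => //.
  have := uv; apply: contraR => zv; apply: (same_trans DP (inSb zS)) => //.
  by rewrite (sameC DP).
by exists u => //; apply: (sep_point DP) => //; move: zu; rewrite /same negbK.
Qed.

Lemma lift_star : lift S a b q D star_point.
Proof. exact: (lift_twin presep_unpend unpendW unpend_split unpend_far). Qed.

Lemma star_eq p : lift S a b q D p -> p a a b b ->
  {in S &, forall x y, ~~ p a x b y} ->
  {in S &, forall x y, p a b x y = unpend b b x y} -> eq_on P p star_point.
Proof. exact: (lift_twin_eq presep_unpend unpendW unpend_split unpend_far). Qed.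

End Nontrivial.

(** ** Classification of the lifts *)

(** If no split has [a] and [b] on different sides with points of [S] on both, then [a]
    and [b] hang from one vertex or form a cherry. A pair [x, y] of [S] that is not
    separated from [a, b] decides for the former. *)
Lemma lift_no_glue p : lift S a b q D p -> p a a b b ->
  {in S &, forall x y, ~~ p a x b y} ->
  {in S &, forall x y, p a b x y} \/
  {in S &, forall x y, p a b x y = unpend b b x y}.
Proof.
move=> [pP pq pD] paabb Np.
have Dp x y c : c \in S -> x \in S -> y \in S -> D b c x y = p b c x y.
  by move=> cS xS yS; rewrite pD ?(bPb, inSb).
have unp x y : x \in S -> y \in S -> unpend b b x y = [exists c in S, D b c x y].
  by move=> xS yS; rewrite /unpend Dbb // (neqb xS) !eqxx /= andbT.
have imp x y : x \in S -> y \in S -> unpend b b x y -> p a b x y.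
  move=> xS yS; rewrite unp // => /exists_inP[c cS]; rewrite Dp // => p1.
  have p2 : p c b x y by sep_sym pP p1.
  have [//|p3] := sep_satP pP aP p2.
  by case/negP: (Np x c xS cS); sep_sym pP p3.
case: (boolP [exists x in S, exists y in S, p a b x y && ~~ unpend b b x y]); last first.
  move=> H; right=> x y xS yS; apply/idP/idP; last exact: imp.
  move=> pab; apply: contraNT H => Nu; apply/exists_inP; exists x => //.
  by apply/exists_inP; exists y; rewrite ?pab.
case/exists_inP=> x xS /exists_inP[y yS /andP[pab]]; rewrite unp // => /exists_inPn Nc.
left; have all_c c : c \in S -> p a b x c.
  move=> cS; have p1 : p a b x y by [].
  have [p2|//] := sep_satP pP (SP cS) p1.
  by case/negP: (Nc c cS); rewrite Dp //; sep_sym pP p2.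
by move=> z w zS wS; apply: (sep_transr pP (all_c z zS) (all_c w wS)).
Qed.

Section GlueClasses.
Variables (p : W -> W -> W -> W -> bool) (x0 y0 : W).
Hypotheses (lp : lift S a b q D p) (x0S : x0 \in S) (y0S : y0 \in S).
Hypothesis pxy : p a x0 b y0.
Let A := [set t in S | p a t b y0].

(** When [a] and [b] attach at different places, the points of [S] on the side of [a]
    form one side of a split. *)
Lemma glue_split :
  {in P & &, forall x y z, forall w, w \in P ->
    x \in a |: A -> y \in a |: A -> z \notin a |: A -> w \notin a |: A -> p x y z w}.
Proof.
have [pP pq pD] := lp; have irr := sep_irr pP.
have memA t : t \in P -> (t \in a |: A) = p a t b y0.
  move=> /inP[->|->|tS].
  - by rewrite setU11 (sep_diagl pP pxy).
  - by rewrite !inE ba (negPf bS) irr.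
  - by rewrite !inE (neqa tS) tS.
move=> x y z xP' yP' zP' w wP'; rewrite !memA // => px py pz pw.
exact: (sep_split pP px py).
Qed.

(** No point of [S] hangs between [a] and [b], as it would tell one from the other, so
    that [a] sees exactly the two sides of the split. *)
Lemma glue_sim : {in S &, forall x y, sim q S a x y = ((x \in A) == (y \in A))}.
Proof.
have [pP pq pD] := lp; have irr := sep_irr pP.
have AS t : t \in A -> t \in S by rewrite inE => /andP[].
have aA t : t \in S -> (t \in a |: A) = (t \in A) by move=> tS; rewrite !inE (neqa tS).
have bA : b \notin a |: A by rewrite !inE ba (negPf bS).
have x0A : x0 \in A by rewrite inE x0S.
have y0A : y0 \notin A by rewrite inE irr andbF.
have sP : {in S & &, forall x y z, forall w, w \in S -> x \in A -> y \in A ->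
    z \notin A -> w \notin A -> q x y z w}.
  move=> x y z xS yS zS w wS xA yA zA wA; rewrite -pq ?(aPa, inSa) //.
  by apply: glue_split; rewrite ?(aP, bP, SP) ?aA.
have qa x z w : x \in A -> z \in S -> w \in S -> z \notin A -> w \notin A -> q a x z w.
  move=> xA zS wS zA wA; have xS := AS _ xA; rewrite -pq ?(aPa, inSa) //.
  by apply: glue_split; rewrite ?(aP, bP, SP) ?setU11 ?aA.
have qb x y z : x \in A -> y \in A -> z \in S -> z \notin A -> q a z x y.
  move=> xA yA zS zA; have xS := AS _ xA; have yS := AS _ yA.
  rewrite tsame // -pD ?(bPb, inSb) // (sep_swap pP).
  by apply: glue_split; rewrite ?(aP, bP, SP) ?bA ?aA.
have Ndiff x y : x \in S -> y \in S -> x \in A -> y \notin A -> ~~ sim q S a x y.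
  move=> xS yS xA yA; apply/negP => /simP[|[d dS qd]].
    by rewrite /same (sP x x y xS xS yS y yS).
  have [dA|dA] := boolP (d \in A).
    have q1 := qb _ _ _ xA dA yS yA; sep_absurd qP qd q1.
  have q1 := qa _ _ _ xA yS dS yA dA; sep_absurd qP qd q1.
move=> x y xS yS; have [xA|xA] := boolP (x \in A); have [yA|yA] := boolP (y \in A).
- apply/simP; right; exists y0 => //; have q1 := qb _ _ _ xA yA y0S y0A.
  by sep_sym qP q1.
- by rewrite (negPf (Ndiff _ _ xS yS xA yA)).
- have [_ r2 _] := sim_equiv a qP SPa.
  by rewrite r2 // (negPf (Ndiff _ _ yS xS yA xA)).
- apply/simP; right; exists x0 => //; have q1 := qa _ _ _ x0A xS yS xA yA.
  by sep_sym qP q1.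
Qed.

End GlueClasses.

(** When [S] has exactly two classes, [a] and [b] attach inside the same edge, and
    they can come in either order. *)
Section TwoClasses.
Variable (A : {set W}).
Hypothesis AS : A \subset S.
Hypothesis simA : {in S &, forall x y, sim q S a x y = ((x \in A) == (y \in A))}.
Variables (x0 y0 : W).
Hypotheses (x0A : x0 \in A) (y0S : y0 \in S) (y0A : y0 \notin A).

Lemma sim_far x y z : x \in S -> y \in S -> z \in S -> (y \in A) = (z \in A) ->
  (x \in A) != (y \in A) -> q a x y z.
Proof.
move=> xS yS zS yz xy.
have Nxy : ~~ sim q S a x y by rewrite simA.
have Nxz : ~~ sim q S a x z by rewrite simA // -yz.
have : sim q S a y z by rewrite simA // yz.
have Nsame : ~~ same q x y by apply: contra Nxy => xy'; apply/simP; left.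
case/simP=> [yz'|[d dS qd]].
  have q1 := unrealized_point qP Na xS yS Nsame.
  by apply: (same_sub4 qP _ _ _ _ _ _ _ _ q1); rewrite ?(same_refl qP) ?aPa ?(aPa, inSa).
have [q1|q1] := sep_satP qP (inSa xS) qd; last by sep_sym qP q1.
by case/negP: Nxz; apply/simP; right; exists d.
Qed.

Lemma lift_glue_class : lift S a b q D (glue S a b q D A x0 y0).
Proof.
have sA := subsetP AS.
apply: lift_glue => //.
  have qa x z w : x \in a |: A -> z \in S -> w \in S -> z \notin A -> w \notin A -> q a x z w.
    case/setU1P=> [->|xA] zS wS zA wA; first exact: qaa.
    by have xS := sA _ xA; apply: sim_far; rewrite // ?xA ?(negPf zA) ?(negPf wA).
  move=> x y z w xA yA zS wS zA wA.
  by apply: (sep_transl qP (qa x z w _ _ _ _ _)) => //; first exact: qa.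
have Db x y z : x \in A -> y \in A -> z \in b |: S -> z \notin A -> D b z x y.
  move=> xA yA /setU1P[->|zS] zA; first by apply: Dbb; apply: sA.
  have xS := sA _ xA; have yS := sA _ yA.
  by rewrite -tsame //; apply: sim_far; rewrite // ?xA ?yA ?(negPf zA).
move=> x y z w xA yA zS wS zA wA; rewrite (sep_swap DP).
exact: (sep_transl DP (Db x y z xA yA zS zA) (Db x y w xA yA wS wA)).
Qed.

Lemma glue_class_cross x y : x \in S -> y \in S ->
  glue S a b q D A x0 y0 a x b y = (x \in A) && (y \notin A).
Proof.
have [gP gq gD] := lift_glue_class; have sA := subsetP AS.
move=> xS yS; have aA t : t \in S -> (t \in a |: A) = (t \in A).
  by move=> tS; rewrite !inE (neqa tS).
have bA : (b \in a |: A) = false.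
  by rewrite !inE ba; apply: contraNF bS; apply: sA.
have irr := (sep_irr qP, sep_irr DP).
rewrite /glue !cutE ?(aP, bP, SP) // /collapse_in /collapse_out /=.
rewrite setU11 bA (aA x xS) (aA y yS).
have qD1 : x \in A -> y \notin A -> q a x y0 y0.
  by move=> xA yA; apply: sim_far; rewrite // xA (negPf y0A).
have x0S := sA _ x0A.
have [xA|xA] := boolP (x \in A); have [yA|yA] := boolP (y \in A);
  rewrite ?irr ?orbF ?qD1 //; apply/negP => Dx.
  have q1 : q a y0 x y by apply: sim_far; rewrite // xA ?yA ?(negPf y0A).
  sep_absurd qP Dx q1.
have D1 : D b x0 x y.
  by rewrite -tsame //; apply: sim_far; rewrite // ?x0A (negPf xA) ?(negPf yA).
sep_absurd DP Dx D1.
Qed.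

End TwoClasses.

End SameType.

(** * Extensions by two points of different types *)

Section LiftSet.
Variables (W : finType).

(** A relation stored as a finite function: such relations can be summed over. *)
Definition table := {ffun W * W * W * W -> bool}.
Definition ap (Q : table) : W -> W -> W -> W -> bool := fun x y z w => Q (x, y, z, w).
Definition tab (D : W -> W -> W -> W -> bool) : table :=
  [ffun u => D u.1.1.1 u.1.1.2 u.1.2 u.2].

Lemma tabK D x y z w : ap (tab D) x y z w = D x y z w.
Proof. by rewrite /ap ffunE. Qed.

Lemma table_eq P (Q Q' : table) : presep P (ap Q) -> presep P (ap Q') ->
  eq_on P (ap Q) (ap Q') -> Q = Q'.
Proof.
move=> QP QP' QE; apply/ffunP=> -[[[x y] z] w]; rewrite -/(ap Q x y z w) -/(ap Q' x y z w).
apply/idP/idP => Qx; [have [xP yP zP wP] := sep_mem QP Qx|have [xP yP zP wP] := sep_mem QP' Qx].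
  by rewrite -QE.
by rewrite QE.
Qed.

Lemma presep_ext (P : {set W}) D D' :
  (forall x y z w, D x y z w = D' x y z w) -> presep P D -> presep P D'.
Proof.
move=> DE [s1 s2 s3 s4 s5]; split.
- by move=> x y z w; rewrite -DE; apply: s1.
- by move=> x y z w; rewrite -!DE.
- by move=> x y z w; rewrite -!DE.
- by move=> x y z w; rewrite -!DE; apply: s4.
- by move=> t x y z w; rewrite -!DE; apply: s5.
Qed.

Lemma separation_ext (P : {set W}) D D' :
  (forall x y z w, D x y z w = D' x y z w) -> separation P D -> separation P D'.
Proof.
move=> DE [s1 s2]; split; first exact: presep_ext DE s1.
by move=> x y z; rewrite -!DE; apply: s2.
Qed.

Variables (S : {set W}) (a b : W) (q D : W -> W -> W -> W -> bool).

Definition lifts : {set table} := [set Q | `[< lift S a b q D (ap Q) >]].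

Lemma mem_lifts Q : reflect (lift S a b q D (ap Q)) (Q \in lifts).
Proof. by rewrite inE; apply: asboolP. Qed.

Lemma tab_lifts p : lift S a b q D p -> tab p \in lifts.
Proof.
move=> [pP pq pD]; apply/mem_lifts; split.
- by apply: separation_ext pP => x y z w; rewrite tabK.
- by move=> x y z w xS yS zS wS; rewrite tabK pq.
- by move=> x y z w xS yS zS wS; rewrite tabK pD.
Qed.

Lemma lifts_eq Q p : Q \in lifts -> lift S a b q D p ->
  eq_on (a |: (b |: S)) (ap Q) p -> Q = tab p.
Proof.
move=> /mem_lifts[QP _ _] [pP _ _] Qp; apply: (table_eq QP).
  by apply: presep_ext pP => x y z w; rewrite tabK.
by move=> x y z w xP yP zP wP; rewrite tabK Qp.
Qed.

End LiftSet.

Lemma lift_sym (W : finType) (S : {set W}) a b q D p :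
  lift S a b q D p -> lift S b a D q p.
Proof. by case=> pP pq pD; split=> //; rewrite setUCA. Qed.

Lemma weight_eq_on (W : finType) (P S : {set W}) D D' a
    (A : pzSemiRingType) (t : nat -> nat -> A) :
  presep P D' -> S \subset P -> eq_on (a |: S) D D' -> weight t D S a = weight t D' S a.
Proof.
move=> DP SP DE; rewrite (weight_map (D' := D') (P' := P) (f := id)) ?imset_id //.
Qed.

Section UniqueLift.
Variables (W : finType) (S : {set W}) (a b : W).
Variables (q D : W -> W -> W -> W -> bool).
Hypotheses (aS : a \notin S) (bS : b \notin S) (ab : a != b).
Hypotheses (qP : separation (a |: S) q) (DP : separation (b |: S) D).
Hypothesis qD : eq_on S q D.

(** A point that is already in the tree has its type determined by its place. *)
Lemma realized_relabel c : c \in S -> same q a c ->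
  eq_on (a |: S) q
    (fun x y z w => D (relabel a c x) (relabel a c y) (relabel a c z) (relabel a c w)).
Proof.
move=> cS ac x y z w xS yS zS wS.
have rel t : t \in a |: S -> relabel a c t \in S /\ same q t (relabel a c t).
  rewrite /relabel => /setU1P[->|tS]; first by rewrite eqxx.
  by case: eqVneq tS => [->|] //; rewrite ?(negPf aS) // (same_refl qP).
have [[xP' xx] [yP' yy]] := (rel x xS, rel y yS).
have [[zP' zz] [wP' ww]] := (rel z zS, rel w wS).
rewrite -qD //; apply/idP/idP => px;
  apply: (same_sub4 qP _ _ _ _ _ _ _ _ px) => //; rewrite ?(sameC qP _ x)
  ?(sameC qP _ y) ?(sameC qP _ z) ?(sameC qP _ w) ?setU1r //.
Qed.

Lemma realized_lift : realized q S a ->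
  exists p0, lift S a b q D p0 /\
    forall p, lift S a b q D p -> eq_on (a |: (b |: S)) p p0.
Proof.
case/exists_inP=> c cS ac; have cSb : c \in b |: S by apply: setU1r.
exists (duplicate S a b D c); split.
  exact: (lift_duplicate aS ab DP cSb (realized_relabel cS ac)).
move=> p lp; apply: (lift_same_eq ab cSb lp).
by case: lp => _ pq _; rewrite /same pq ?setU11 ?setU1r.
Qed.

End UniqueLift.

Section DifferentType.
Variables (W : finType) (S : {set W}) (a b : W).
Variables (q D : W -> W -> W -> W -> bool).
Hypotheses (aS : a \notin S) (bS : b \notin S) (ab : a != b).
Hypotheses (qP : separation (a |: S) q) (DP : separation (b |: S) D).
Hypothesis qD : eq_on S q D.

Definition distinguished :=
  [\/ realized q S a, realized D S b |
      ~ {in S & &, forall x y z, q a x y z = D b x y z}].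

Hypothesis dist : distinguished.

(** If the triple [x, y, z] tells [a] from [b], then the split that it provides lies
    between [a] and [b], and the lift is glued along it. *)
Lemma unique_lift : exists p0, lift S a b q D p0 /\
    forall p, lift S a b q D p -> eq_on (a |: (b |: S)) p p0.
Proof.
have Dq : eq_on S D q by move=> *; rewrite qD.
have ba : b != a by rewrite eq_sym.
have sym : (exists p0, lift S b a D q p0 /\
    forall p, lift S b a D q p -> eq_on (b |: (a |: S)) p p0) ->
  exists p0, lift S a b q D p0 /\
    forall p, lift S a b q D p -> eq_on (a |: (b |: S)) p p0.
  move=> [p0 [lp0 p0E]]; exists p0; split; first exact: lift_sym.
  by move=> p /lift_sym/p0E; rewrite setUCA.
case: dist => [ra|rb|Nsame].
- exact: realized_lift.
- by apply: sym; apply: realized_lift.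
have [x [y [z [[xS yS zS] Nxyz]]]] : exists x y z,
    [/\ x \in S, y \in S & z \in S] /\ q a x y z != D b x y z.
  apply: contrapT => Nex; apply: Nsame => x y z xS yS zS; apply/eqP.
  by apply: contra_notT Nex => ?; exists x, y, z.
have /orP[/andP[qa NDb]|/andP[Nqa Db]] :
    (q a x y z) && ~~ (D b x y z) || ~~ (q a x y z) && (D b x y z).
  by move: Nxyz; case: (q a x y z); case: (D b x y z).
- exact: (lift_differ aS bS ab qP DP qD xS yS zS).
- by apply: sym; apply: (lift_differ bS aS ba DP qP Dq xS yS zS).
Qed.

Lemma weight_lift_distinguished (A : pzSemiRingType) (t : nat -> nat -> A) p :
  lift S a b q D p -> weight t p (b |: S) a = weight t q S a.
Proof.
move=> [pP pq pD].
have SP : S \subset a |: (b |: S) by apply/subsetP=> x xS; rewrite !setU1r.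
have aP : a \in a |: (b |: S) by apply: setU11.
have bP : b \in a |: (b |: S) by rewrite setU1r ?setU11.
have <- : weight t p S a = weight t q S a.
  by apply: (weight_eq_on t qP) => //; apply: subsetUr.
case: dist => [ra|rb|Nsame].
- case/exists_inP: ra => c cS ac.
  have pac : same p a c by rewrite /same pq ?setU11 ?setU1r.
  rewrite /weight; have -> : realized p (b |: S) a.
    by apply/exists_inP; exists c; rewrite ?setU1r.
  by have -> : realized p S a by apply/exists_inP; exists c.
- apply: (weight_add_realized pP SP aP bP).
  case/exists_inP: rb => c cS bc; apply/exists_inP; exists c => //.
  by rewrite /same pD ?setU11 ?setU1r.
- apply: (weight_add pP SP aP bP) => Nsame'; apply: Nsame => x y z xS yS zS.
  by rewrite -pq ?setU11 ?setU1r // -pD ?setU11 ?setU1r // Nsame'.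
Qed.

Lemma lifts_distinguished : exists2 Q, lifts S a b q D = [set Q] &
  forall (A : pzSemiRingType) (t : nat -> nat -> A),
    weight t (ap Q) (b |: S) a = weight t q S a.
Proof.
have [p0 [lp0 p0E]] := unique_lift; have Qp0 := tab_lifts lp0.
exists (tab p0); last by move=> A t; apply: weight_lift_distinguished; apply/mem_lifts.
apply/setP=> Q; rewrite inE; apply/idP/eqP => [QL|->//].
apply: (lifts_eq QL lp0); move/mem_lifts: QL; exact: p0E.
Qed.

End DifferentType.

(** Two points [a] and [b] of the same type, with [k] classes of which [s] are
    singletons, can be amalgamated as follows. They may coincide, which gives the
    summand 1. They may form a cherry that hangs from the common place of attachment,
    so that [a] sees the classes [{b}] and [S]. If [k] is at least 2 they may be
    attached at one vertex, so that [b] is a new class for [a]. If [k = 2] that place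
    is inside an edge, and [a] may come before or after [b] along it; the class of
    [S] on the side of [a] remains a class of its own, and the class on the other
    side is joined by [b]. *)
Definition type_step (A : pzSemiRingType) (t : nat -> nat -> A) (k s : nat) : A :=
  match k with
  | 0 => 1 + t 1 0
  | 1 => 1 + t 2 2
  | 2 => 1 + t 2 1 + t 3 0 + t 2 1 *+ s + t 2 0 *+ (2 - s)
  | _ => 1 + t 2 1 + t k.+1 0
  end%R.

Lemma card_imset_bool (T : finType) (h : T -> bool) (S : {set T}) :
  #|h @: S| = [exists x in S, h x] + [exists x in S, ~~ h x].
Proof.
have mT (c : bool) : (c \in h @: S) = [exists x in S, h x == c].
  apply/imsetP/exists_inP => -[x xS E]; exists x => //; first by rewrite E.
  exact/esym/eqP.
have -> : h @: S = [set c | [exists x in S, h x == c]] by apply/setP=> c; rewrite inE mT.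
rewrite -sum1dep_card big_mkcond /= (bigD1 true) //= (bigD1 false) //= big1 => [|[]] //.
rewrite addn0; congr addn.
  rewrite (eq_existsb (P2 := fun x => (x \in S) && h x)); last by move=> x; rewrite eqb_id.
  by case: [exists _, _].
rewrite (eq_existsb (P2 := fun x => (x \in S) && ~~ h x)); last by move=> x; rewrite eqbF_neg.
by case: [exists _, _].
Qed.

(** * The sum of the weights over all extensions *)

Lemma class_num_bool (W : finType) D (S : {set W}) a (h : W -> bool) :
  {in S &, forall x y, sim D S a x y = (h x == h y)} ->
  class_num D S a = [exists x in S, h x] + [exists x in S, ~~ h x].
Proof. by move=> hE; rewrite /class_num (class_count_fun hE) card_imset_bool. Qed.

Lemma lonely_num_bool (W : finType) D (S : {set W}) a (h : W -> bool) :
  {in S &, forall x y, sim D S a x y = (h x == h y)} ->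
  lonely_num D S a =
    [exists x in lonely D S a, h x] + [exists x in lonely D S a, ~~ h x].
Proof.
move=> hE; rewrite -card_imset_bool; apply: class_count_fun => x y.
by rewrite !inE => /andP[xS _] /andP[yS _]; apply: hE.
Qed.

Section SameTypeSum.
Variables (W : finType) (S : {set W}) (a b : W).
Let P := a |: (b |: S).
Variables (q D : W -> W -> W -> W -> bool).
Hypotheses (aS : a \notin S) (bS : b \notin S) (ab : a != b).
Hypotheses (qP : separation (a |: S) q) (DP : separation (b |: S) D).
Hypothesis qD : eq_on S q D.
Hypothesis tsame : {in S & &, forall x y z, q a x y z = D b x y z}.
Hypotheses (Na : ~~ realized q S a) (Nb : ~~ realized D S b).

Let SPa : S \subset a |: S. Proof. exact: subsetUr. Qed.
Let SPb : S \subset b |: S. Proof. exact: subsetUr. Qed.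
Let aSP x : x \in a |: S -> x \in P.
Proof. by case/setU1P=> [->|xS]; rewrite /P ?setU11 ?setU1r. Qed.
Let bSP x : x \in b |: S -> x \in P.
Proof. by move=> xS; apply: setU1r. Qed.
Let SP x : x \in S -> x \in P.
Proof. by move=> xS; rewrite /P !setU1r. Qed.
Let inSa x : x \in S -> x \in a |: S. Proof. exact: setU1r. Qed.
Let inSb x : x \in S -> x \in b |: S. Proof. exact: setU1r. Qed.
Let aPa : a \in a |: S. Proof. exact: setU11. Qed.
Let bPb : b \in b |: S. Proof. exact: setU11. Qed.
Let aP : a \in P. Proof. exact: setU11. Qed.
Let bP : b \in P. Proof. exact: bSP. Qed.
Let SbP : b |: S \subset P. Proof. exact: subsetUr. Qed.
Let neqb x : x \in S -> (x == b) = false.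
Proof. by move=> xS; apply: contraNF bS => /eqP<-. Qed.

Variables (A : pzSemiRingType) (t : nat -> nat -> A).

Section OneLift.
Variable (p : W -> W -> W -> W -> bool).
Hypothesis lp : lift S a b q D p.

Let pP : separation P p. Proof. by case: lp. Qed.
Let pq : eq_on (a |: S) p q. Proof. by case: lp. Qed.
Let pD : eq_on (b |: S) p D. Proof. by case: lp. Qed.

Lemma lift_same x y : x \in S -> y \in S -> same p x y = same q x y.
Proof. by move=> xS yS; rewrite /same pq ?(aPa, inSa). Qed.

Lemma lift_sim x y : x \in S -> y \in S ->
  sim p (b |: S) a x y = sim q S a x y || p x y a b.
Proof.
move=> xS yS; rewrite /sim lift_same // -orbA; congr orb.
apply/exists_inP/orP => [[d /setU1P[->|dS] pd]|[/exists_inP[d dS qd]|pb]].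
- by right.
- by left; apply/exists_inP; exists d; rewrite // -pq ?(aPa, inSa).
- by exists d; rewrite ?(bPb, inSb) // pq ?(aPa, inSa).
- by exists b.
Qed.

Lemma lift_Nsame_b x : x \in S -> ~~ same p b x.
Proof.
move=> xS; rewrite /same pD ?(bPb, inSb) // negbK; exact: (unrealized Nb).
Qed.

Lemma lift_sim_b x : x \in S -> sim p (b |: S) a b x = [exists d in S, p b x a d].
Proof.
move=> xS; rewrite /sim (negPf (lift_Nsame_b xS)) /=.
apply/exists_inP/exists_inP => -[d dS pd]; last by exists d; rewrite ?(bPb, inSb).
by case/setU1P: dS pd => [->|dS] pd; [rewrite (sep_irr4 pP) in pd|exists d].
Qed.

Lemma weight_eq_point : same p a b -> weight t p (b |: S) a = 1%R.
Proof.
move=> sab; rewrite /weight; have -> // : realized p (b |: S) a.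
by apply/exists_inP; exists b.
Qed.

Hypothesis pab : p a a b b.

Lemma lift_unrealized : ~~ realized p (b |: S) a.
Proof.
apply/exists_inPn=> x /setU1P[->|xS]; rewrite /same negbK //.
by rewrite pq ?(aPa, inSa) //; apply: (unrealized Na).
Qed.

Lemma sim_refl_in c : {in b |: S, forall x, sim p (b |: S) c x x}.
Proof. by move=> x _; rewrite /sim (same_refl pP). Qed.

Lemma weight_bool (h : W -> bool) :
  {in b |: S &, forall x y, sim p (b |: S) a x y = (h x == h y)} ->
  (exists2 x, x \in b |: S & h x) -> (exists2 x, x \in b |: S & ~~ h x) ->
  weight t p (b |: S) a =
  t 2 ([exists x in lonely p (b |: S) a, h x] +
       [exists x in lonely p (b |: S) a, ~~ h x]).
Proof.
move=> hE /exists_inP h1 /exists_inP h2.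
rewrite /weight (negPf lift_unrealized).
by rewrite (class_num_bool hE) (lonely_num_bool hE) h1 h2.
Qed.

Section Sibling.
Hypothesis pabS : {in S &, forall x y, p a b x y}.

Lemma sibling_sim : {in b |: S &, forall x y,
  sim p (b |: S) a x y = ((x == b) == (y == b))}.
Proof.
have bx x : x \in S -> sim p (b |: S) a b x = false.
  move=> xS; rewrite lift_sim_b //; apply/exists_inPn=> d dS; apply/negP => pd.
  have p1 := pabS xS dS; sep_absurd pP pd p1.
have [_ r2 _] := sim_equiv a pP SbP.
move=> x y xS yS; case/setU1P: (xS) => [->|xS']; case/setU1P: (yS) => [->|yS'].
- by rewrite sim_refl_in ?eqxx.
- by rewrite bx // eqxx (neqb yS').
- by rewrite r2 // bx // eqxx (neqb xS').
rewrite (neqb xS') (neqb yS') lift_sim // orbC (sep_swap pP).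
by rewrite pabS.
Qed.

Lemma weight_sibling_empty : S = set0 -> weight t p (b |: S) a = t 1 0.
Proof.
move=> S0; rewrite /weight (negPf lift_unrealized) (class_num_bool sibling_sim).
have -> : [exists x in b |: S, x == b].
  by apply/exists_inP; exists b.
suff -> : [exists x in b |: S, x != b] = false by [].
by apply/negbTE/exists_inPn=> x; rewrite S0 setU0 !inE => ->.
Qed.

Lemma weight_sibling_point : S != set0 -> {in S &, forall x y, same q x y} ->
  weight t p (b |: S) a = t 2 2.
Proof.
case/set0Pn=> x xS sameS; rewrite (weight_bool sibling_sim); last 2 first.
- by exists b.
- by exists x; rewrite ?(bPb, inSb) // neqb.
have -> : lonely p (b |: S) a = b |: S.
  apply/setP=> y; rewrite [LHS]inE andb_idr // => yS.
  apply/forall_inP=> z zS; rewrite sibling_sim //; apply/implyP.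
  case/setU1P: yS => [->|yS]; case/setU1P: zS => [->|zS]; rewrite ?eqxx ?neqb //.
    by rewrite (same_refl pP).
  by rewrite lift_same // sameS.
have -> : [exists x in b |: S, x == b] by apply/exists_inP; exists b.
have -> // : [exists x in b |: S, x != b].
by apply/exists_inP; exists x; rewrite ?(bPb, inSb) // neqb.
Qed.

Lemma weight_sibling x y : x \in S -> y \in S -> ~~ same q x y ->
  weight t p (b |: S) a = t 2 1.
Proof.
move=> xS yS xy; rewrite (weight_bool sibling_sim); last 2 first.
- by exists b.
- by exists x; rewrite ?(bPb, inSb) // neqb.
have -> : lonely p (b |: S) a = [set b].
  apply/setP=> z; rewrite [RHS]inE; apply/idP/eqP => [|->].
    rewrite inE => /andP[/setU1P[//|zS] /forall_inP zL].
    have zsame w : w \in S -> same q z w.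
      move=> wS; rewrite -lift_same //; apply: (implyP (zL w (inSb wS))).
      by rewrite sibling_sim ?(bPb, inSb) // !neqb.
    case/negP: xy; apply: (same_trans qP (inSa zS)); last exact: zsame.
    by rewrite (sameC qP) zsame.
  rewrite inE bPb; apply/forall_inP=> w wS; rewrite sibling_sim // eqxx.
  case/setU1P: wS => [->|wS]; first by rewrite (same_refl pP) implybT.
  by rewrite neqb.
have -> : [exists x in [set b], x == b] by apply/exists_inP; exists b; rewrite ?inE.
suff -> : [exists x in [set b], x != b] = false by [].
by apply/negbTE/exists_inPn=> z; rewrite !inE => ->.
Qed.

End Sibling.

Hypothesis pcross : {in S &, forall x y, ~~ p a x b y}.

Lemma weight_star : {in S &, forall x y, p a b x y = unpend S b D b b x y} ->
  1 < class_num q S a -> weight t p (b |: S) a = t (class_num q S a).+1 0.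
Proof.
move=> pabS k2; rewrite /weight (negPf lift_unrealized).
have bx x : x \in S -> ~~ sim p (b |: S) a b x.
  move=> xS; rewrite lift_sim_b //; apply/exists_inPn=> d dS; apply/negP => pd.
  by case/negP: (pcross dS xS); sep_sym pP pd.
have simS : {in S &, forall x y, sim p (b |: S) a x y = sim q S a x y}.
  move=> x y xS yS; rewrite lift_sim // orb_idr // (sep_swap pP) pabS //.
  case/and3P=> _; rewrite !eqxx => /exists_inP[c cS Dc] _.
  apply/simP; right; exists c => //; rewrite (sep_swap qP) tsame //.
suff -> : class_num p (b |: S) a = (class_num q S a).+1.
  by case: eqP => // -[kE]; rewrite kE in k2.
rewrite /class_num (class_count_add bS (sim_equiv a pP SbP)) //; congr _.+1.
apply: (class_count_map (f := id)) => //; first exact: (sim_equiv a qP SPa).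
by move=> x xS; exists x => //; have [r1 _ _] := sim_equiv a qP SPa; apply: r1.
Qed.

End OneLift.

Section TwoClassWeight.
Variables (Al : {set W}) (x0 y0 : W) (p : W -> W -> W -> W -> bool).
Hypothesis AS : Al \subset S.
Hypothesis simA : {in S &, forall x y, sim q S a x y = ((x \in Al) == (y \in Al))}.
Hypotheses (x0A : x0 \in Al) (y0S : y0 \in S) (y0A : y0 \notin Al).
Hypothesis lp : lift S a b q D p.
Hypothesis pcross : {in S &, forall x y, p a x b y = (x \in Al) && (y \notin Al)}.

(** Here [Al] is the class on the side of [a], and [b] joins the other class: only a
    singleton class contained in [Al] is left. *)
Lemma weight_glue : weight t p (b |: S) a = t 2 [exists x in lonely q S a, x \in Al].
Proof.
have [pP pq pD] := lp; have sA := subsetP AS; have x0S := sA _ x0A.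
have p1 : p a x0 b y0 by rewrite pcross // x0A.
have pab : p a a b b := sep_diagr pP (sep_diagl pP p1).
have simS : {in S &, forall x y, sim p (b |: S) a x y = sim q S a x y}.
  move=> x y xS yS; rewrite (lift_sim lp) //; apply: orb_idr => pxy.
  apply: contraLR pxy; rewrite simA // => xy; apply/negP => pxy.
  have [[xA yA]|[xA yA]] : (x \in Al /\ y \notin Al) \/ (x \notin Al /\ y \in Al).
    by move: xy; do 2!case: (_ \in Al); [left|left|right|right].
    have pc : p a x b y by rewrite pcross // xA.
    sep_absurd pP pc pxy.
  have pc : p a y b x by rewrite pcross // yA.
  sep_absurd pP pc pxy.
have bNA : b \notin Al by apply: contra bS; apply: sA.
have simb x : x \in S -> sim p (b |: S) a b x = (x \notin Al).
  move=> xS; rewrite (lift_sim_b lp) //; apply/exists_inP/idP => [[d dS pd]|xA].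
    apply/negP => xA; have dA : d \in Al.
      apply: contraT => dA; have pc : p a x b d by rewrite pcross // xA.
      sep_absurd pP pc pd.
    have q1 : q a y0 x d.
      by apply: (sim_far qP Na simA) => //; rewrite ?xA ?dA ?(negPf y0A).
    have p2 : p a y0 x d by rewrite pq ?(aPa, inSa).
    have p3 : p b y0 x d.
      by rewrite pD ?(bPb, inSb) // -tsame.
    have p4 : p x d y0 a by sep_sym pP p2.
    have p5 : p x d y0 b by sep_sym pP p3.
    have p6 := sep_transr pP p4 p5; sep_absurd pP p6 pd.
  exists x0 => //; have pc : p a x0 b x by rewrite pcross // x0A.
  by sep_sym pP pc.
have [_ r2 _] := sim_equiv a pP SbP.
have hE : {in b |: S &, forall x y, sim p (b |: S) a x y = ((x \in Al) == (y \in Al))}.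
  move=> x y xS yS; case/setU1P: (xS) => [->|xS']; case/setU1P: (yS) => [->|yS'].
  - by rewrite (sim_refl_in lp) ?eqxx.
  - by rewrite simb // (negPf bNA) eq_sym eqbF_neg.
  - by rewrite r2 // simb // (negPf bNA) eqbF_neg.
  - by rewrite simS // simA.
rewrite (weight_bool lp pab hE); last 2 first.
- by exists x0; rewrite ?(bPb, inSb).
- by exists b.
have NL x : x \in lonely p (b |: S) a -> x \in Al.
  rewrite inE => /andP[xS /forall_inP xL]; apply: contraT => xA.
  case/setU1P: (xS) => [xb|xS'].
    have s1 : sim p (b |: S) a x y0.
      by rewrite hE ?(inSb y0S) // (negPf xA) (negPf y0A).
    by case/negP: (lift_Nsame_b lp y0S); rewrite -xb; apply: (implyP (xL _ (inSb y0S))).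
  have s1 : sim p (b |: S) a x b by rewrite hE // (negPf xA) (negPf bNA).
  by case/negP: (lift_Nsame_b lp xS'); rewrite (sameC pP); apply: (implyP (xL _ bPb)).
have -> : [exists x in lonely p (b |: S) a, x \notin Al] = false.
  by apply/negbTE/exists_inPn=> x /NL ->.
rewrite addn0; congr (t _ (nat_of_bool _)).
have LE x : x \in Al -> (x \in lonely p (b |: S) a) = (x \in lonely q S a).
  move=> xA; have xS := sA _ xA; rewrite !inE xS orbT /=.
  apply/forall_inP/forall_inP => xL y yS.
    by rewrite -simS // -(lift_same lp) //; apply: xL; apply: inSb.
  case/setU1P: yS => [->|yS]; last by rewrite simS // (lift_same lp) //; apply: xL.
  by rewrite hE ?(bPb, inSb) // xA (negPf bNA).
apply/exists_inP/exists_inP => -[x xL xA]; exists x => //; first by rewrite -LE.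
by rewrite LE.
Qed.

End TwoClassWeight.

Lemma big_set_seq (T : finType) (L : {set T}) (s : seq T) (F : T -> A) :
  uniq s -> L =i s -> (\sum_(x in L) F x = \sum_(x <- s) F x)%R.
Proof. by move=> us Ls; rewrite big_uniq //; apply: eq_bigl. Qed.

Lemma tab_neq (p p' : W -> W -> W -> W -> bool) x y z w : p x y z w != p' x y z w -> tab p != tab p'.
Proof.
by apply: contraNneq => pp'; rewrite -(tabK p) pp' tabK.
Qed.

(** The enumeration of the amalgams of two points of the same type behind [type_step];
    [lift_eq_point], [lift_sibling], [lift_star] and [lift_glue_class] provide them,
    and the uniqueness statements that go with these lemmas show that there are no
    others. *)
Lemma lifts_same_type :
  (\sum_(Q in lifts S a b q D) weight t (ap Q) (b |: S) a =
  type_step t (class_num q S a) (lonely_num q S a))%R.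
Proof.
have wE p : lift S a b q D p -> weight t (ap (tab p)) (b |: S) a = weight t p (b |: S) a.
  move=> [pP _ _]; apply: (weight_eq_on t pP SbP) => x y z w _ _ _ _; exact: tabK.
have leq := lift_eq_point aS ab qP DP qD tsame Na Nb.
have lsib := lift_sibling aS bS ab qP DP qD tsame Na Nb.
have sibab := twin_distinct S ab D.
have sibc x y : x \in S -> y \in S -> ~~ sibling S a b D a x b y.
  by move=> xS yS; rewrite /sibling (twin_cross aS bS ab DP).
have Dbb := unrealized_pair DP Nb.
have sibp : {in S &, forall x y, sibling S a b D a b x y}.
  by move=> x y xS yS; rewrite /sibling (twin_pair aS bS ab) // Dbb.
have eqab : duplicate S a b D b a a b b = false.
  by rewrite /duplicate cutE // /relabel eqxx eq_sym (negPf ab) (sep_irr DP).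
have eq_sib : tab (duplicate S a b D b) != tab (sibling S a b D).
  by apply: (@tab_neq _ _ a a b b); rewrite eqab /sibling sibab.
have wsameab p : lift S a b q D p -> p a a b b = false -> same p a b by rewrite /same => _ ->.
have class_eq Q : Q \in lifts S a b q D -> ap Q a a b b = false ->
    Q = tab (duplicate S a b D b).
  move=> QL Qab; apply: (lifts_eq QL leq); move/mem_lifts: QL => lQ.
  by apply: (lift_same_eq ab bPb lQ); rewrite /same Qab.
have CDD : forall x y z w, D x y z w -> D x y z w || point_split b x y z w by move=> x y z w ->.
have class_sib Q : Q \in lifts S a b q D -> ap Q a a b b ->
    {in S &, forall x y, ~~ ap Q a x b y} -> {in S &, forall x y, ap Q a b x y} ->
    Q = tab (sibling S a b D).
  move=> QL Qab Qc Qp; apply: (lifts_eq QL lsib); move/mem_lifts: QL => lQ.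
  exact: (sibling_eq aS bS ab qP DP qD tsame Na Nb lQ).
have kE : class_num q S a = class_count (sim q S a) S by [].
case: (boolP [exists x in S, exists y in S, ~~ same q x y]); last first.
  (* All the points of [S] coincide, if there are any: no vertex to share. *)
  move=> Nnt; have sameS : {in S &, forall x y, same q x y}.
    move=> x y xS yS; apply: contraNT Nnt => xy.
    by apply/exists_inP; exists x => //; apply/exists_inP; exists y.
  rewrite (@big_set_seq _ _ [:: tab (duplicate S a b D b); tab (sibling S a b D)]);
    last 2 first.
  - by rewrite /= inE eq_sib.
  - move=> Q; rewrite !in_cons in_nil orbF; apply/idP/orP => [QL|[] /eqP->]; last 2 first.
    + exact: tab_lifts leq.
    + exact: tab_lifts lsib.
    have [Qab|/negbTE Qab] := boolP (ap Q a a b b); last by left; rewrite (class_eq Q) ?eqxx.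
    right; apply/eqP; apply: class_sib => //; have /mem_lifts[QP Qq QD] := QL.
      move=> x y xS yS; apply/negP => Qx.
      have := sameS x y xS yS; rewrite /same -Qq ?(aPa, inSa) //.
      have Qx' : ap Q x a y b by sep_sym QP Qx.
      by rewrite (sep_diagr QP (sep_diagl QP Qx')).
    move=> x y xS yS; have Qx : ap Q a b x x.
      apply: (sep_point QP); first by rewrite Qq ?(aPa, inSa) //; apply: (unrealized Na).
      by rewrite QD ?(bPb, inSb) //; apply: (unrealized Nb).
    apply: (same_sub4 QP _ _ _ _ _ _ _ _ Qx); rewrite ?(same_refl QP) ?(aP, bP, SP) //.
    by rewrite /same Qq ?(aPa, inSa) //; apply: sameS.
  rewrite !big_cons big_nil addr0 !wE // weight_eq_point //; last by rewrite /same eqab.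
  have [S0|S0] := eqVneq S set0.
    rewrite (weight_sibling_empty lsib) //.
    by have /eqP-> : class_num q S a == 0 by rewrite kE class_count0 S0.
  rewrite (weight_sibling_point lsib) //.
  suff -> : class_num q S a = 1 by [].
  have simT : {in S &, forall x y, sim q S a x y = ((fun=> true) x == (fun=> true) y)}.
    by move=> x y xS yS; rewrite eqxx; apply/simP; left; apply: sameS.
  rewrite (class_num_bool simT).
  have [x xS] := set0Pn _ S0; have -> : [exists x in S, true] by apply/exists_inP; exists x.
  suff -> : [exists x in S, ~~ true] = false by [].
  by apply/negbTE/exists_inPn.
case/exists_inP=> u uS /exists_inP[v vS uv].
have uvD : ~~ same D u v by rewrite /same -qD.
have lstar := lift_star aS bS ab qP DP qD tsame Na Nb uS vS uvD.
have unpP := presep_unpend DP.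
have starab := twin_distinct S ab (unpend S b D).
have starc x y : x \in S -> y \in S -> ~~ star_point S a b D a x b y.
  by move=> xS yS; rewrite /star_point (twin_cross aS bS ab unpP).
have starp : {in S &, forall x y, star_point S a b D a b x y = unpend S b D b b x y}.
  by move=> x y xS yS; rewrite /star_point (twin_pair aS bS ab).
have class_star Q : Q \in lifts S a b q D -> ap Q a a b b ->
    {in S &, forall x y, ~~ ap Q a x b y} ->
    {in S &, forall x y, ap Q a b x y = unpend S b D b b x y} ->
    Q = tab (star_point S a b D).
  move=> QL Qab Qc Qp; apply: (lifts_eq QL lstar); move/mem_lifts: QL => lQ.
  exact: (star_eq aS bS ab qP DP qD tsame Na Nb uS vS uvD lQ).
have [u0 [v0 [u0S v0S Nuv]]] : exists u v, [/\ u \in S, v \in S & ~~ sim q S a u v].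
  exact: (sim_separates qP SPa Na uS vS uv).
have star_uv : star_point S a b D a b u0 v0 = false.
  rewrite starp // /unpend Dbb // !eqxx (neqb u0S) /= andbT.
  apply/negbTE/exists_inPn=> c cS; apply: contra Nuv => Dc.
  apply/simP; right; exists c => //; rewrite (sep_swap qP) tsame //.
have eq_star : tab (duplicate S a b D b) != tab (star_point S a b D).
  by apply: (@tab_neq _ _ a a b b); rewrite eqab /star_point starab.
have sib_star : tab (sibling S a b D) != tab (star_point S a b D).
  by apply: (@tab_neq _ _ a b u0 v0); rewrite star_uv sibp.
have k_gt1 : 1 < class_num q S a.
  rewrite kE; case Ek: (class_count _ _) => [|[|k]] //.
    by move/eqP: Ek uS; rewrite class_count0 => /eqP->; rewrite inE.
  by move/eqP: Ek => /(class_count1 (sim_equiv a qP SPa))/(_ u0 v0 u0S v0S); rewrite (negPf Nuv).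
have weq : weight t (ap (tab (duplicate S a b D b))) (b |: S) a = 1%R.
  by rewrite wE // weight_eq_point // /same eqab.
have wsib : weight t (ap (tab (sibling S a b D))) (b |: S) a = t 2 1.
  by rewrite wE // (weight_sibling lsib sibab sibp uS vS uv).
have wstar : weight t (ap (tab (star_point S a b D))) (b |: S) a = t (class_num q S a).+1 0.
  by rewrite wE // (weight_star lstar starab starc starp).
have classify Q : Q \in lifts S a b q D ->
    [\/ Q = tab (duplicate S a b D b), Q = tab (sibling S a b D),
        Q = tab (star_point S a b D) |
        exists x y, [/\ x \in S, y \in S & ap Q a x b y]].
  move=> QL; have [Qab|/negbTE Qab] := boolP (ap Q a a b b); last first.
    by constructor 1; apply: class_eq.
  case: (boolP [exists x in S, exists y in S, ap Q a x b y]) => [|Nc].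
    by case/exists_inP=> x xS /exists_inP[y yS Qc]; constructor 4; exists x, y.
  have Qc : {in S &, forall x y, ~~ ap Q a x b y}.
    move=> x y xS yS; apply: contra Nc => Qx.
    by apply/exists_inP; exists x => //; apply/exists_inP; exists y.
  have /mem_lifts lQ := QL.
  have [Qp|Qp] := lift_no_glue bS DP Nb lQ Qab Qc.
    by constructor 2; apply: class_sib.
  by constructor 3; apply: class_star.
(* At a vertex of the tree of [S] nothing comes between [a] and [b]. *)
have [k2|k2] := eqVneq (class_num q S a) 2; last first.
  rewrite (@big_set_seq _ _ [:: tab (duplicate S a b D b); tab (sibling S a b D);
    tab (star_point S a b D)]); last 2 first.
  - by rewrite /= !inE negb_or eq_sib eq_star sib_star.
  - move=> Q; rewrite !in_cons in_nil orbF; apply/idP/idP; last first.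
      by case/or3P=> /eqP->; apply: tab_lifts.
    move=> QL; case: (classify Q QL) => [->|->|->|[x [y [xS yS Qc]]]]; rewrite ?eqxx ?orbT //.
    have /mem_lifts lQ := QL; case/eqP: k2.
    have hE := glue_sim aS bS ab qP tsame lQ xS yS Qc.
    rewrite (class_num_bool hE).
    have -> : [exists z in S, z \in [set t | t \in S & ap Q a t b y]].
      by apply/exists_inP; exists x; rewrite // inE xS.
    have -> // : [exists z in S, z \notin [set t | t \in S & ap Q a t b y]].
    by apply/exists_inP; exists y; rewrite // inE yS (sep_irr3 (let: And3 QP _ _ := lQ in QP)).
  rewrite !big_cons big_nil addr0 weq wsib wstar !addrA.
  by move: k_gt1 k2; case: (class_num _ _ _) => [|[|[|k]]].
(* Inside an edge there are two more lifts, one for each order of [a] and [b]. *)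
have {u0 v0 u0S v0S Nuv star_uv} [u0 [v0 [u0S v0S Nuv uvE]]] := class_count2 (sim_equiv a qP SPa) k2.
have [r1 r2 r3] := sim_equiv a qP SPa.
pose cl x := [set z in S | sim q S a x z].
have clS x : cl x \subset S by apply/subsetP=> z; rewrite inE => /andP[].
have simu : {in S &, forall x y, sim q S a x y = ((x \in cl u0) == (y \in cl u0))}.
  move=> x y xS yS; rewrite !inE xS yS /=.
  have trans z : z \in S -> sim q S a z x -> sim q S a x y = sim q S a z y.
    move=> zS zx; apply/idP/idP => h; first exact: (r3 x).
    by apply: (r3 z) => //; rewrite r2.
  have [ux|ux] := boolP (sim q S a u0 x); first by rewrite (trans u0).
  rewrite uvE // negbK in ux; rewrite (trans v0) // uvE //.
  by case: (sim q S a v0 y).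
have simv : {in S &, forall x y, sim q S a x y = ((x \in cl v0) == (y \in cl v0))}.
  move=> x y xS yS; rewrite simu // !inE xS yS /= !uvE //.
  by do 2!case: (sim _ _ _ _ _).
have u0u : u0 \in cl u0 by rewrite inE u0S r1.
have v0v : v0 \in cl v0 by rewrite inE v0S r1.
have v0u : v0 \notin cl u0 by rewrite inE v0S.
have u0v : u0 \notin cl v0 by rewrite inE u0S r2.
have lgu := lift_glue_class aS bS ab qP DP qD tsame Na Nb (clS u0) simu u0u v0S v0u.
have lgv := lift_glue_class aS bS ab qP DP qD tsame Na Nb (clS v0) simv v0v u0S u0v.
have cgu : {in S &, forall x y, _} := glue_class_cross aS bS ab qP DP qD tsame Na Nb (clS u0) simu u0u v0S v0u.
have cgv : {in S &, forall x y, _} := glue_class_cross aS bS ab qP DP qD tsame Na Nb (clS v0) simv v0v u0S u0v.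
set gu := glue S a b q D (cl u0) u0 v0 in lgu cgu.
set gv := glue S a b q D (cl v0) v0 u0 in lgv cgv.
have guab : gu a a b b.
  have [gP _ _] := lgu; have gx : gu a u0 b v0 by rewrite cgu // u0u.
  exact: (sep_diagr gP (sep_diagl gP gx)).
have gvab : gv a a b b.
  have [gP _ _] := lgv; have gx : gv a v0 b u0 by rewrite cgv // v0v.
  exact: (sep_diagr gP (sep_diagl gP gx)).
have eq_gu : tab (duplicate S a b D b) != tab gu.
  by apply: (@tab_neq _ _ a a b b); rewrite eqab guab.
have eq_gv : tab (duplicate S a b D b) != tab gv.
  by apply: (@tab_neq _ _ a a b b); rewrite eqab gvab.
have sib_gu : tab (sibling S a b D) != tab gu.
  by apply: (@tab_neq _ _ a u0 b v0); rewrite cgu // u0u v0u (negPf (sibc _ _ u0S v0S)).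
have sib_gv : tab (sibling S a b D) != tab gv.
  by apply: (@tab_neq _ _ a v0 b u0); rewrite cgv // v0v u0v (negPf (sibc _ _ v0S u0S)).
have star_gu : tab (star_point S a b D) != tab gu.
  by apply: (@tab_neq _ _ a u0 b v0); rewrite cgu // u0u v0u (negPf (starc _ _ u0S v0S)).
have star_gv : tab (star_point S a b D) != tab gv.
  by apply: (@tab_neq _ _ a v0 b u0); rewrite cgv // v0v u0v (negPf (starc _ _ v0S u0S)).
have gu_gv : tab gu != tab gv.
  by apply: (@tab_neq _ _ a u0 b v0); rewrite cgu // cgv // u0u v0u (negPf u0v).
rewrite (@big_set_seq _ _ [:: tab (duplicate S a b D b); tab (sibling S a b D);
    tab (star_point S a b D); tab gu; tab gv]); last 2 first.
- by rewrite /= !inE !negb_or eq_sib eq_star eq_gu eq_gv sib_star sib_gu sib_gv star_gu star_gv gu_gv.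
- move=> Q; rewrite !in_cons in_nil orbF; apply/idP/idP; last first.
    by case/or4P=> [| | |/orP[]] /eqP->; apply: tab_lifts.
  move=> QL; case: (classify Q QL) => [->|->|->|[x [y [xS yS Qc]]]]; rewrite ?eqxx ?orbT //.
  have /mem_lifts lQ := QL; have [QP _ _] := lQ.
  have hE := glue_sim aS bS ab qP tsame lQ xS yS Qc.
  have sE := glue_split aS bS ab lQ Qc.
  set B := [set t in S | ap Q a t b y] in hE sE.
  have BS : B \subset S by apply/subsetP=> z; rewrite inE => /andP[].
  have BE z : z \in S -> z \in B -> B = cl z.
    move=> zS zB; apply/setP=> w; rewrite [RHS]inE.
    have [wS|wS] := boolP (w \in S); first by rewrite hE // zB.
    by apply: contraNF wS => /(subsetP BS).
  have [uB|uB] := boolP (u0 \in B).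
    have BE' := BE u0 u0S uB; suff -> : Q = tab gu by rewrite eqxx !orbT.
    apply: (lifts_eq QL lgu); apply: (lift_split_eq aS bS ab (clS u0) u0u v0S v0u lQ).
    by rewrite -BE'.
  have vB : v0 \in B by have := hE u0 v0 u0S v0S; rewrite (negPf Nuv) (negPf uB); case: (v0 \in B).
  have BE' := BE v0 v0S vB; suff -> : Q = tab gv by rewrite eqxx !orbT.
  apply: (lifts_eq QL lgv); apply: (lift_split_eq aS bS ab (clS v0) v0v u0S u0v lQ).
  by rewrite -BE'.
rewrite !big_cons big_nil addr0 weq wsib wstar !wE //.
rewrite (weight_glue (clS u0) simu u0u v0S v0u lgu cgu).
rewrite (weight_glue (clS v0) simv v0v u0S u0v lgv cgv).
rewrite (lonely_num_bool simu) k2 /=.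
have -> : [exists x in lonely q S a, x \in cl v0] = [exists x in lonely q S a, x \notin cl u0].
  apply: eq_existsb => x; rewrite !inE; case xS: (x \in S) => //=.
  by rewrite uvE // negbK.
case: [exists x in _, x \in cl u0]; case: [exists x in _, x \notin cl u0] => /=.
- by rewrite mulr2n mulr0n addr0 !addrA.
- by rewrite mulr1n mulr1n !addrA.
- by rewrite mulr1n mulr1n [(t 2 0 + _)%R]addrC !addrA.
- by rewrite mulr2n mulr0n addr0 !addrA.
Qed.

End SameTypeSum.

(** * Measures on types and chains of points *)

Definition subtable (W : finType) (P : {set W}) (Q : table W) : table W := tab (cut P (ap Q)).

Section Measure.
Variables (A : comPzRingType) (t : nat -> nat -> A).

(** The first condition makes the weights additive over amalgams of two one-point
    extensions. The second one makes the weight of a pair of points independent of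
    their order: it is needed when the two points attach inside one edge, because
    then one order may meet the types [2 1] and [2 1] where the other one meets the
    types [2 1] and [2 0]. *)
Record type_measure : Prop := TypeMeasure {
  tm_step : forall k s, s <= 2 -> t k (if k == 2 then s else 0) = type_step t k s;
  tm_comm : (t 2 1 * t 2 1 = t 2 1 * t 2 0)%R }.

Hypothesis tm : type_measure.

Lemma lonely_num_le2 (W : finType) (P S : {set W}) D a :
  presep P D -> S \subset P -> class_num D S a = 2 -> lonely_num D S a <= 2.
Proof.
move=> DP SP k2; have [x [y [xS yS Nxy xyE]]] := class_count2 (sim_equiv a DP SP) k2.
have [r1 r2 r3] := sim_equiv a DP SP.
have hE : {in S &, forall z w, sim D S a z w = (sim D S a x z == sim D S a x w)}.
  move=> z w zS wS.
  have trans u : u \in S -> sim D S a u z -> sim D S a z w = sim D S a u w.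
    move=> uS uz; apply/idP/idP => h; first exact: (r3 z).
    by apply: (r3 u) => //; rewrite r2.
  have [xz|xz] := boolP (sim D S a x z); first by rewrite (trans x).
  have yz : sim D S a y z by rewrite xyE // negbK in xz.
  by rewrite (trans y) // xyE //; case: (sim D S a y w).
by rewrite (lonely_num_bool hE) -[2]/(1 + 1) leq_add ?leq_b1.
Qed.

Lemma sum_lifts (W : finType) (S : {set W}) a b q D :
  a \notin S -> b \notin S -> a != b ->
  separation (a |: S) q -> separation (b |: S) D -> eq_on S q D ->
  (\sum_(Q in lifts S a b q D) weight t (ap Q) (b |: S) a = weight t q S a)%R.
Proof.
move=> aS bS ab qP DP qD.
have [dist|Ndist] := pselect (distinguished S a b q D).
  have [Q -> QE] := lifts_distinguished aS bS ab qP DP qD dist.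
  by rewrite big_set1 QE.
have Na : ~~ realized q S a by apply/negP => h; apply: Ndist; constructor 1.
have Nb : ~~ realized D S b by apply/negP => h; apply: Ndist; constructor 2.
have tsame : {in S & &, forall x y z, q a x y z = D b x y z}.
  by have [//|h] := pselect {in S & &, forall x y z, q a x y z = D b x y z};
    case: Ndist; constructor 3.
rewrite (lifts_same_type aS bS ab qP DP qD tsame Na Nb) /weight (negPf Na).
have SPa : S \subset a |: S by apply: subsetUr.
have [k2|k2] := eqVneq (class_num q S a) 2.
  have := tm_step tm 2 (lonely_num_le2 qP SPa k2); rewrite k2 eqxx => <-.
  by [].
have := tm_step tm (class_num q S a) (leqnn 2); rewrite (negPf k2) => ->.
by move: k2; case: (class_num q S a) => [|[|[|]]].
Qed.

Section OneTypes.
Variables (W : finType) (S : {set W}) (a : W) (D q : W -> W -> W -> W -> bool).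

Definition one_types (P : {set W}) : {set table W} :=
  [set Q | `[< [/\ separation (a |: P) (ap Q), eq_on P (ap Q) D & eq_on (a |: S) (ap Q) q] >]].

Lemma mem_one_types P Q :
  reflect [/\ separation (a |: P) (ap Q), eq_on P (ap Q) D & eq_on (a |: S) (ap Q) q]
          (Q \in one_types P).
Proof. by rewrite inE; apply: asboolP. Qed.

Lemma eq_on_sub (P P' : {set W}) (D1 D2 : W -> W -> W -> W -> bool) :
  P \subset P' -> eq_on P' D1 D2 -> eq_on P D1 D2.
Proof. by move=> /subsetP sub DE x y z w xP yP zP wP; apply: DE; apply: sub. Qed.

Lemma eq_on_sym (P : {set W}) (D1 D2 : W -> W -> W -> W -> bool) : eq_on P D1 D2 -> eq_on P D2 D1.
Proof. by move=> DE x y z w xP yP zP wP; rewrite DE. Qed.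

Lemma eq_on_trans (P : {set W}) (D1 D2 D3 : W -> W -> W -> W -> bool) :
  eq_on P D1 D2 -> eq_on P D2 D3 -> eq_on P D1 D3.
Proof. by move=> E1 E2 x y z w xP yP zP wP; rewrite E1 ?E2. Qed.

Lemma subtableE (P : {set W}) (Q : table W) : eq_on P (ap (subtable P Q)) (ap Q).
Proof. by move=> x y z w xP yP zP wP; rewrite tabK cutE. Qed.

Lemma separation_subtable (P P' : {set W}) (Q : table W) :
  separation P' (ap Q) -> P \subset P' -> separation P (ap (subtable P Q)).
Proof.
move=> QP sub; apply: separation_ext (separation_cut QP sub) => x y z w.
by rewrite tabK.
Qed.

Lemma subtable_eq (P P' : {set W}) (Q Q' : table W) :
  separation P' (ap Q) -> P \subset P' -> separation P (ap Q') ->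
  eq_on P (ap Q) (ap Q') -> subtable P Q = Q'.
Proof.
move=> QP sub QP' QE; apply: (table_eq (separation_subtable QP sub) QP').
exact: eq_on_trans (@subtableE P Q) QE.
Qed.

Hypotheses (qP : separation (a |: S) q).

Lemma separation_cut_sub (P P' : {set W}) E :
  separation P (cut P E) -> P' \subset P -> separation P' (cut P' E).
Proof.
move=> EP sub; apply: separation_ext (separation_cut EP sub) => x y z w.
rewrite /cut; have sP u : u \in P' -> u \in P := subsetP sub u.
case xP: (x \in P'); case yP: (y \in P'); case zP: (z \in P'); case wP: (w \in P') => //=.
by rewrite !sP.
Qed.

(** One point of [P] outside [S] is added at a time: the extensions of the type over [P]
    are sorted by their restriction to one point less, and [sum_lifts] sums each
    group. *)
Lemma sum_one_types (P : {set W}) : separation P (cut P D) -> S \subset P -> a \notin P ->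
  eq_on S q D ->
  (\sum_(Q in one_types P) weight t (ap Q) P a = weight t q S a)%R.
Proof.
have [n] := ubnP #|P :\: S|; elim: n => // n IHn in P *; rewrite ltnS => lePn DP SP aP qD.
have [PS|/subsetPn[b bP bS]] := boolP (P \subset S).
  have {PS}PS : P = S by apply/eqP; rewrite eqEsubset PS.
  rewrite PS in aP *; have qP' : separation (a |: S) (ap (tab (cut (a |: S) q))).
    by apply: separation_ext (separation_cut qP (subxx _)) => x y z w; rewrite tabK.
  have qE : eq_on (a |: S) (ap (tab (cut (a |: S) q))) q.
    by move=> x y z w xS yS zS wS; rewrite tabK cutE.
  have SaS : S \subset a |: S by apply: subsetUr.
  have -> : one_types S = [set tab (cut (a |: S) q)].
    apply/setP=> Q; rewrite [RHS]inE; apply/mem_one_types/eqP => [[QP QD Qq]|->].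
      apply: (table_eq QP qP'); exact: eq_on_trans Qq (eq_on_sym qE).
    split=> //; apply: eq_on_trans qD; exact: eq_on_sub SaS qE.
  by rewrite big_set1 (weight_eq_on t qP).
pose P' := P :\ b; have PE : P = b |: P' by rewrite setD1K.
have bP' : b \notin P' by rewrite !inE eqxx.
have SP' : S \subset P' by rewrite subsetD1 SP.
have P'P : P' \subset P by apply: subsetDl.
have aP' : a \notin P' by apply: contra aP; apply: (subsetP P'P).
have ab : a != b by apply: contraNneq aP => ->.
have aP'P : a |: P' \subset a |: P by apply: setUS.
have P'aP' : P' \subset a |: P' by apply: subsetUr.
have SaP' : a |: S \subset a |: P' by apply: setUS.
have PaP : P \subset a |: P by apply: subsetUr.
have DP' : separation P' (cut P' D) := separation_cut_sub DP P'P.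
have card_P' : #|P' :\: S| < n.
  apply: leq_trans lePn; apply: proper_card; apply/properP; split.
    exact: setSD.
  by exists b; rewrite !inE ?bP ?bS // eqxx.
have cutD : eq_on P (cut P D) D by move=> x y z w *; rewrite cutE.
rewrite (partition_big (subtable (a |: P')) (mem (one_types P'))) /=; last first.
  move=> Q /mem_one_types[QP QD Qq]; apply/mem_one_types; split.
  - exact: separation_subtable QP aP'P.
  - apply: eq_on_trans (eq_on_sub P'P QD).
    exact: eq_on_sub P'aP' (@subtableE (a |: P') Q).
  - apply: eq_on_trans Qq; exact: eq_on_sub SaP' (@subtableE (a |: P') Q).
rewrite -[RHS](IHn P' card_P') //; apply: eq_bigr => Q' /mem_one_types[Q'P Q'D Q'q].
have DP2 : separation (b |: P') (cut P D) by rewrite -PE.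
have Q'D2 : eq_on P' (ap Q') (cut P D).
  exact: eq_on_trans Q'D (eq_on_sub P'P (eq_on_sym cutD)).
rewrite -[RHS](sum_lifts aP' bP' ab Q'P DP2 Q'D2) -PE.
apply: eq_bigl => Q; apply/andP/mem_lifts => [[/mem_one_types[QP QD Qq] /eqP QE]|].
  split; rewrite -?PE //; last exact: eq_on_trans QD (eq_on_sym cutD).
  by rewrite -QE; apply/eq_on_sym/subtableE.
move=> [QP QQ' QD]; rewrite -PE in QP QD; split; last first.
  apply/eqP; apply: (subtable_eq QP) => //; exact: QQ'.
apply/mem_one_types; split=> //; first exact: eq_on_trans QD cutD.
exact: eq_on_trans (eq_on_sub SaP' QQ') Q'q.
Qed.

End OneTypes.

Fixpoint chain_weight (W : finType) (D : W -> W -> W -> W -> bool) (S : {set W}) (l : seq W) : A :=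
  if l is a :: l' then (weight t D S a * chain_weight D (a |: S) l')%R else 1%R.

Section Chain.
Variable W : finType.
Implicit Types (D : W -> W -> W -> W -> bool) (S P : {set W}) (l : seq W).

Lemma chain_weight_cat D S l1 l2 : chain_weight D S (l1 ++ l2) =
  (chain_weight D S l1 * chain_weight D (S :|: [set x in l1]) l2)%R.
Proof.
elim: l1 S => [|a l1 IH] S /=.
  by rewrite mul1r; congr chain_weight; apply/setP=> x; rewrite !inE orbF.
rewrite IH mulrA; congr (_ * chain_weight _ _ _)%R.
by apply/setP=> x; rewrite !inE; case: (x == a); rewrite ?orbT.
Qed.

Lemma chain_weight_map (W' : finType) (D' : W' -> W' -> W' -> W' -> bool)
    (P' : {set W'}) (f : W -> W') D S l :
  presep P' D' -> {in S :|: [set x in l], forall x, f x \in P'} ->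
  {in S :|: [set x in l] & &, forall x y z, {in S :|: [set x in l], forall w,
    D x y z w = D' (f x) (f y) (f z) (f w)}} ->
  chain_weight D S l = chain_weight D' (f @: S) (map f l).
Proof.
move=> DP'; elim: l S => [|a l IH] S //= fP DE.
have sub : a |: S \subset S :|: [set x in a :: l].
  by apply/subsetP=> x; rewrite !inE => /orP[]->; rewrite ?orbT.
have UE : (a |: S) :|: [set x in l] = S :|: [set x in a :: l].
  by apply/setP=> x; rewrite !inE; case: (x == a); case: (x \in S).
rewrite IH ?UE // imsetU1; congr (_ * _)%R.
apply: (weight_map DP').
  by apply/subsetP=> _ /imsetP[x xS ->]; apply: fP; rewrite inE xS.
by move=> x y z w xS yS zS wS; apply: DE; apply: (subsetP sub).
Qed.

Lemma chain_weight_realized D S l : {in l, forall a, realized D S a} ->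
  chain_weight D S l = 1%R.
Proof.
elim: l S => //= a l IH S rl; rewrite /weight rl ?mem_head // mul1r.
apply: IH => x xl; have /exists_inP[y yS xy] : realized D S x by apply: rl; rewrite inE xl orbT.
by apply/exists_inP; exists y; rewrite // setU1r.
Qed.

End Chain.
End Measure.

(** * Independence of the order and amalgamation sums *)

Section SameTypeSwap.
Variables (W : finType) (S : {set W}) (a b : W).
Variables (q D p : W -> W -> W -> W -> bool).
Hypotheses (aS : a \notin S) (bS : b \notin S) (ab : a != b).
Hypotheses (qP : separation (a |: S) q) (DP : separation (b |: S) D).
Hypothesis qD : eq_on S q D.
Hypothesis tsame : {in S & &, forall x y z, q a x y z = D b x y z}.
Hypotheses (Na : ~~ realized q S a) (Nb : ~~ realized D S b).
Hypothesis lp : lift S a b q D p.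

Variables (A : comPzRingType) (t : nat -> nat -> A).
Hypothesis tm : type_measure t.

Let ba : b != a. Proof. by rewrite eq_sym. Qed.
Let Dq : eq_on S D q. Proof. exact: eq_on_sym. Qed.
Let tsame' : {in S & &, forall x y z, D b x y z = q a x y z}.
Proof. by move=> *; rewrite tsame. Qed.
Let SPa : S \subset a |: S. Proof. exact: subsetUr. Qed.
Let SPb : S \subset b |: S. Proof. exact: subsetUr. Qed.
Let neqa x : x \in S -> (x == a) = false.
Proof. by move=> xS; apply: contraNF aS => /eqP<-. Qed.
Let neqb x : x \in S -> (x == b) = false.
Proof. by move=> xS; apply: contraNF bS => /eqP<-. Qed.

Lemma same_type_sim : {in S &, forall x y, sim q S a x y = sim D S b x y}.
Proof.
move=> x y xS yS; rewrite /sim /same qD //; congr orb.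
apply: eq_existsb => d; case dS: (d \in S) => //=.
by rewrite (sep_swap qP) (sep_flipr qP) (sep_flip qP) (sep_swap DP) (sep_flipr DP)
  (sep_flip DP) [q d a _ _](sep_flip qP) [D d b _ _](sep_flip DP) tsame.
Qed.

Lemma same_type_weight : weight t q S a = weight t D S b.
Proof.
have relE : relabel a b a = b by rewrite /relabel eqxx.
have relS : relabel a b @: S = S.
  rewrite -[RHS]imset_id; apply: eq_in_imset => x xS.
  by rewrite /relabel neqa.
rewrite (weight_map DP (f := relabel a b)) ?relS ?relE //.
exact: (same_type_relabel aS qP DP qD tsame Na Nb).
Qed.

Lemma same_type_lonely : lonely q S a = lonely D S b.
Proof.
apply/setP=> x; rewrite !inE; case xS: (x \in S) => //=.
by apply: eq_forallb => y; case yS: (y \in S) => //=; rewrite same_type_sim // /same qD.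
Qed.

(** If [a] and [b] attach inside one edge at different places, then the class on the
    side of [a] counts for the weight of [a] and the other class for the weight of [b];
    with exactly one singleton class the two products are [t 2 1 * t 2 1] and
    [t 2 1 * t 2 0]. In the other cases exchanging [a] and [b] is an automorphism. *)
Lemma lift_swap_weight : (weight t q S a * weight t p (a |: S) b =
  weight t D S b * weight t p (b |: S) a)%R.
Proof.
have [pP pq pD] := lp; rewrite same_type_weight.
have lp' := lift_sym lp.
have [pab|/negPn pab] := boolP (same p a b).
  rewrite (weight_eq_point _ _ pab); congr (_ * _)%R.
  by apply: weight_eq_point; rewrite (sameC pP).
case: (boolP [exists x in S, exists y in S, p a x b y]) => [|Nc].
  case/exists_inP=> x0 x0S /exists_inP[y0 y0S pc].
  have simA := glue_sim aS bS ab qP tsame lp x0S y0S pc.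
  have spl := glue_split aS bS ab lp pc.
  set Al := [set u in S | p a u b y0] in simA spl.
  have AlS : Al \subset S by apply/subsetP=> u; rewrite inE => /andP[].
  have x0A : x0 \in Al by rewrite inE x0S.
  have y0A : y0 \notin Al by rewrite inE (sep_irr3 pP) andbF.
  have pE := lift_split_eq aS bS ab AlS x0A y0S y0A lp spl.
  have PS u : u \in S -> u \in a |: (b |: S) by move=> uS; rewrite !setU1r.
  have aP : a \in a |: (b |: S) by apply: setU11.
  have bP : b \in a |: (b |: S) by rewrite setU1r ?setU11.
  have pcr : {in S &, forall x y, p a x b y = (x \in Al) && (y \notin Al)}.
    move=> x y xS yS; rewrite pE ?(aP, bP, PS) //.
    exact: (glue_class_cross aS bS ab qP DP qD tsame Na Nb AlS simA x0A y0S y0A).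
  pose Bl := S :\: Al; have BlS : Bl \subset S by apply: subsetDl.
  have simB : {in S &, forall x y, sim D S b x y = ((x \in Bl) == (y \in Bl))}.
    move=> x y xS yS; rewrite -same_type_sim // simA // !in_setD xS yS !andbT.
    by do 2!case: (_ \in Al).
  have y0B : y0 \in Bl by rewrite in_setD y0A y0S.
  have x0B : x0 \notin Bl by rewrite in_setD x0A.
  have pcr' : {in S &, forall x y, p b x a y = (x \in Bl) && (y \notin Bl)}.
    move=> x y xS yS; rewrite (sep_swap pP) pcr // !in_setD xS yS !andbT negbK.
    by rewrite andbC.
  rewrite (weight_glue aS DP tsame' Nb Na t BlS simB y0B x0S x0B lp' pcr').
  rewrite (weight_glue bS qP tsame Na Nb t AlS simA x0A y0S y0A lp pcr).
  rewrite -same_type_weight -same_type_lonely /weight (negPf Na) (class_num_bool simA).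
  have -> : [exists x in S, x \in Al] by apply/exists_inP; exists x0.
  have -> : [exists x in S, x \notin Al] by apply/exists_inP; exists y0.
  rewrite (lonely_num_bool simA) /=.
  have -> : [exists x in lonely q S a, x \in Bl] = [exists x in lonely q S a, x \notin Al].
    apply: eq_existsb => x; rewrite in_setD; case xL: (x \in lonely q S a) => //=.
    by move: xL; rewrite inE => /andP[-> _]; rewrite andbT.
  by case: [exists x in _, x \in Al]; case: [exists x in _, x \notin Al];
    rewrite //= ?(tm_comm tm).
have pc : {in S &, forall x y, p a x b y = false}.
  move=> x y xS yS; apply: contraNF Nc => pc.
  by apply/exists_inP; exists x => //; apply/exists_inP; exists y.
congr (_ * _)%R.
(* The exchange of [a] and [b] is an automorphism of [p]. *)
pose f x := if x == a then b else if x == b then a else x.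
have fa : f a = b by rewrite /f eqxx.
have fb : f b = a by rewrite /f (negPf ba) eqxx.
have fS x : x \in S -> f x = x by move=> xS; rewrite /f neqa ?neqb.
have fE : f @: (a |: S) = b |: S.
  rewrite imsetU1 fa; congr (_ |: _); rewrite -[RHS]imset_id.
  by apply: eq_in_imset => x; apply: fS.
have fP : f @: (a |: S) \subset a |: (b |: S) by rewrite fE; apply: subsetUr.
have pfa : eq_on (a |: S) p (fun x y z w => p (f x) (f y) (f z) (f w)).
  have frel x : x \in a |: S -> f x = relabel a b x.
    case/setU1P=> [->|xS]; first by rewrite fa /relabel eqxx.
    by rewrite fS // /relabel neqa.
  have fb' x : x \in a |: S -> f x \in b |: S by move=> xS; rewrite -fE imset_f.
  move=> x y z w xS yS zS wS; rewrite pq // pD ?fb' // !frel //.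
  exact: (same_type_relabel aS qP DP qD tsame Na Nb).
have ff x : x \in b |: S -> f (f x) = x.
  by case/setU1P=> [->|xS]; rewrite ?fb ?fa // !fS.
have fa' x : x \in b |: S -> f x \in a |: S.
  by case/setU1P=> [->|xS]; rewrite ?fb ?setU11 // fS // setU1r.
have pfb : eq_on (b |: S) p (fun x y z w => p (f x) (f y) (f z) (f w)).
  by move=> x y z w xS yS zS wS; rewrite [RHS]pfa ?fa' // !ff.
have fPP : {in a |: (b |: S), forall x, f x \in a |: (b |: S)}.
  move=> x /setU1P[->|/setU1P[->|xS]]; rewrite ?fa ?fb ?fS // !inE ?eqxx ?orbT //.
  by rewrite xS !orbT.
have QP := separation_pull pP fPP.
set Q := cut _ _ in QP.
have QE : eq_on (a |: (b |: S)) Q (fun x y z w => p (f x) (f y) (f z) (f w)).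
  by move=> x y z w xP yP zP wP; rewrite /Q cutE.
have aP : a \in a |: (b |: S) by apply: setU11.
have bP : b \in a |: (b |: S) by rewrite setU1r ?setU11.
have inP x : x \in S -> x \in a |: (b |: S) by move=> xS; rewrite !setU1r.
have QEa x y z w : x \in a |: S -> y \in a |: S -> z \in a |: S -> w \in a |: S ->
    Q x y z w = p x y z w.
  have sub : a |: S \subset a |: (b |: S) by apply: setUS; apply: subsetUr.
  by move=> xS yS zS wS; rewrite pfa // QE //; apply: (subsetP sub).
have QEb x y z w : x \in b |: S -> y \in b |: S -> z \in b |: S -> w \in b |: S ->
    Q x y z w = p x y z w.
  by move=> xS yS zS wS; rewrite pfb // QE //; apply: setU1r.
have pQ x y z w : p x y z w = Q x y z w.
  apply/idP/idP.
    apply: (sep_mono pP QP) => [{}x {}y {}z {}w xS yS zS wS|{}x {}y {}z {}w xS yS zS wS|_|u v uS vS|u v uS vS].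
    - by rewrite QEa.
    - by rewrite QEb.
    - by rewrite QE // fa fb (sep_swap pP).
    - by rewrite pc.
    - by rewrite QE ?(aP, bP, inP) // fa fb !fS // (sep_flip pP).
  apply: (sep_mono QP pP) => [{}x {}y {}z {}w xS yS zS wS|{}x {}y {}z {}w xS yS zS wS|_|u v uS vS|u v uS vS].
  - by rewrite QEa.
  - by rewrite QEb.
  - exact: pab.
  - by rewrite QE ?(aP, bP, inP) // fa fb !fS // (sep_swap pP) pc.
  - by rewrite QE ?(aP, bP, inP) // fa fb !fS // (sep_flip pP).
rewrite (weight_map pP fP) ?fE ?fb // => x y z w xP yP zP wP.
by rewrite pQ QE // setUCA.
Qed.

End SameTypeSwap.

Section ChainTheory.
Variables (A : comPzRingType) (t : nat -> nat -> A).
Hypothesis tm : type_measure t.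
Variable W : finType.
Implicit Types (D : W -> W -> W -> W -> bool) (S P : {set W}) (l : seq W).
Variables (P : {set W}) (D : W -> W -> W -> W -> bool).
Hypothesis DP : separation P D.

Lemma weight_realized_eq1 S a : realized D S a -> weight t D S a = 1%R.
Proof. by move=> ra; rewrite /weight ra. Qed.

Lemma realized_sub S S' a : S \subset S' -> realized D S a -> realized D S' a.
Proof.
by move=> /subsetP sub /exists_inP[x xS ax]; apply/exists_inP; exists x; rewrite ?sub.
Qed.

Lemma mem_realized S a : a \in S -> realized D S a.
Proof. by move=> aS; apply/exists_inP; exists a; rewrite // (same_refl DP). Qed.

(** If the types of [a] and [b] over [S] differ, then neither point changes the
    weight of the other. If they agree, the two points play symmetric roles unless
    they attach inside the same edge, and this last case is [lift_swap_weight]. *)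
Lemma weight_swap S a b : S \subset P -> a \in P -> b \in P ->
  (weight t D S a * weight t D (a |: S) b = weight t D S b * weight t D (b |: S) a)%R.
Proof.
move=> SP aP bP.
have [->|ab] := eqVneq a b; first by [].
have [ra|Na] := boolP (realized D S a).
  rewrite (weight_realized_eq1 ra) mul1r (weight_add_realized DP SP bP aP) //.
  by rewrite (weight_realized_eq1 (realized_sub (subsetUr [set b] S) ra)) mulr1.
have [rb|Nb] := boolP (realized D S b).
  rewrite (weight_realized_eq1 rb) mul1r (weight_add_realized DP SP aP bP) //.
  by rewrite (weight_realized_eq1 (realized_sub (subsetUr [set a] S) rb)) mulr1.
have [tsame|Nsame] := pselect {in S & &, forall x y z, D a x y z = D b x y z}; last first.
  have Nsame' : ~ {in S & &, forall x y z, D b x y z = D a x y z}.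
    by move=> ts; apply: Nsame => x y z xS yS zS; rewrite ts.
  rewrite (weight_add DP SP aP bP Nsame t) (weight_add DP SP bP aP Nsame' t).
  exact: mulrC.
have aS : a \notin S by apply: contra Na; apply: mem_realized.
have bS : b \notin S by apply: contra Nb; apply: mem_realized.
have sa : a |: S \subset P by rewrite subUset sub1set aP.
have sb : b |: S \subset P by rewrite subUset sub1set bP.
have sab : a |: (b |: S) \subset P by rewrite subUset sub1set aP.
have qP := separation_cut DP sa; have DbP := separation_cut DP sb.
have pP := separation_cut DP sab.
have sub1 : a |: S \subset a |: (b |: S) by apply: setUS; apply: subsetUr.
have sub2 : b |: S \subset a |: (b |: S) by apply: subsetUr.
have cutD (P' P'' : {set W}) : P' \subset P'' -> eq_on P' (cut P'' D) D.
  by move=> /subsetP s x y z w xS yS zS wS; rewrite cutE ?s.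
have Sa : S \subset a |: S by apply: subsetUr.
have Sb : S \subset b |: S by apply: subsetUr.
have qD : eq_on S (cut (a |: S) D) (cut (b |: S) D).
  exact: eq_on_trans (cutD _ _ Sa) (eq_on_sym (cutD _ _ Sb)).
have lp : lift S a b (cut (a |: S) D) (cut (b |: S) D) (cut (a |: (b |: S)) D).
  split=> //; first exact: eq_on_trans (cutD _ _ sub1) (eq_on_sym (cutD _ _ (subxx _))).
  exact: eq_on_trans (cutD _ _ sub2) (eq_on_sym (cutD _ _ (subxx _))).
have tsame' : {in S & &, forall x y z, cut (a |: S) D a x y z = cut (b |: S) D b x y z}.
  by move=> x y z xS yS zS; rewrite !cutE ?setU11 ?setU1r // tsame.
have Na' : ~~ realized (cut (a |: S) D) S a.
  apply: contra Na => /exists_inP[x xS]; rewrite /same cutE ?setU11 ?setU1r // => ax.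
  by apply/exists_inP; exists x.
have Nb' : ~~ realized (cut (b |: S) D) S b.
  apply: contra Nb => /exists_inP[x xS]; rewrite /same cutE ?setU11 ?setU1r // => ax.
  by apply/exists_inP; exists x.
have := lift_swap_weight aS bS ab qP DbP qD tsame' Na' Nb' lp tm.
have SP4 (S' : {set W}) c : S' \subset P -> c |: S' \subset a |: (b |: S) ->
    weight t (cut (a |: (b |: S)) D) S' c = weight t D S' c.
  by move=> S'P sub; apply: (weight_eq_on t DP S'P); apply: cutD.
rewrite !SP4 //; last by rewrite setUCA.
by rewrite !(weight_eq_on t DP SP) //; apply: cutD.
Qed.

Lemma chain_weight_swap S l a : S \subset P -> {subset a :: l <= P} ->
  (chain_weight t D S (l ++ [:: a]) = weight t D S a * chain_weight t D (a |: S) l)%R.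
Proof.
elim: l S => [|b l IH] S SP lP //=.
have aP : a \in P by apply: lP; rewrite mem_head.
have bP : b \in P by apply: lP; rewrite !inE eqxx orbT.
rewrite IH; last 2 first.
- by rewrite subUset sub1set bP.
- by move=> x; rewrite inE => /orP[/eqP->//|xl]; apply: lP; rewrite !inE xl !orbT.
by rewrite !mulrA weight_swap // setUCA.
Qed.

Lemma chain_weight_perm S l l' : S \subset P -> {subset l <= P} -> perm_eq l l' ->
  chain_weight t D S l = chain_weight t D S l'.
Proof.
elim: l S l' => [|a l IH] S l' SP lP.
  by move/perm_size; case: l'.
move=> pe; have al' : a \in l' by rewrite -(perm_mem pe) mem_head.
have aP : a \in P by apply: lP; rewrite mem_head.
have aSP : a |: S \subset P by rewrite subUset sub1set aP.
case/splitPr: al' pe => l1 l2 pe.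
have pe' : perm_eq l (l1 ++ l2).
  rewrite -(perm_cons a); apply: (perm_trans pe).
  by rewrite -[a :: l2]cat1s perm_catCA.
rewrite /= (IH _ (l1 ++ l2)) //; last by move=> x xl; apply: lP; rewrite inE xl orbT.
have l1P : {subset a :: l1 <= P}.
  move=> x xl; apply: lP; rewrite (perm_mem pe) mem_cat inE.
  by move: xl; rewrite inE => /orP[->|->]; rewrite ?orbT.
rewrite -[a :: l2]cat1s catA (chain_weight_cat t D S (l1 ++ [:: a])) chain_weight_swap //.
rewrite chain_weight_cat mulrA; congr (_ * chain_weight _ _ _ _)%R.
by apply/setP=> x; rewrite !inE mem_cat !inE; do ![case: (x \in _) => //=]; case: eqP.
Qed.

(** Transposing neighbours turns any chain into any other one with the same points,
    and a point that is already realized contributes the factor 1. *)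
Lemma chain_weight_ext S l l' : S \subset P -> {subset l <= P} ->
  {subset l' <= P} -> S :|: [set x in l] = S :|: [set x in l'] ->
  chain_weight t D S l = chain_weight t D S l'.
Proof.
move=> SP lP l'P SE.
have aux l1 l2 : S :|: [set x in l1] = S :|: [set x in l2] ->
    chain_weight t D S l1 = chain_weight t D S (l1 ++ l2).
  move=> E; rewrite chain_weight_cat [X in (_ * X)%R]chain_weight_realized ?mulr1 //.
  by move=> x xl; apply: mem_realized; rewrite E !inE xl orbT.
rewrite (aux l l') // (aux l' l) //; apply: chain_weight_perm => //.
  by move=> x; rewrite mem_cat => /orP[/lP|/l'P].
by rewrite perm_catC.
Qed.

End ChainTheory.

Section AmalgamSum.
Variables (A : comPzRingType) (t : nat -> nat -> A).
Hypothesis tm : type_measure t.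
Variables (W : finType) (S P2 : {set W}) (Q1 Q2 : W -> W -> W -> W -> bool).

Definition amalgams (l : seq W) : {set table W} :=
  [set Q | `[< [/\ separation (P2 :|: [set x in l]) (ap Q), eq_on P2 (ap Q) Q2
                 & eq_on (S :|: [set x in l]) (ap Q) Q1] >]].

Lemma mem_amalgams l Q :
  reflect [/\ separation (P2 :|: [set x in l]) (ap Q), eq_on P2 (ap Q) Q2
             & eq_on (S :|: [set x in l]) (ap Q) Q1] (Q \in amalgams l).
Proof. by rewrite inE; apply: asboolP. Qed.

Hypotheses (SP2 : S \subset P2) (Q2P : separation P2 Q2) (Q12 : eq_on S Q1 Q2).

(** Additivity of the weight under amalgamation: the points of [l] are added one by
    one, and each of them is handled by [sum_one_types]. *)
Lemma sum_amalgams l : uniq l -> {in l, forall x, x \notin P2} ->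
  separation (S :|: [set x in l]) (cut (S :|: [set x in l]) Q1) ->
  (\sum_(Q in amalgams l) chain_weight t (ap Q) P2 l = chain_weight t Q1 S l)%R.
Proof.
elim/last_ind: l => [|l a IH] ul lP2 Q1P.
  rewrite /= (eq_bigl (mem [set tab (cut P2 Q2)])) ?big_set1 // => Q.
  have U0 (B : {set W}) : B :|: [set x in [::]] = B by apply/setP=> x; rewrite !inE orbF.
  have QP' : separation P2 (ap (tab (cut P2 Q2))).
    by apply: separation_ext (separation_cut Q2P (subxx _)) => x y z w; rewrite tabK.
  have QE : eq_on P2 (ap (tab (cut P2 Q2))) Q2.
    by move=> x y z w *; rewrite tabK cutE.
  rewrite [RHS]inE; apply/mem_amalgams/eqP => [|->]; rewrite !U0.
    by move=> [QP QQ2 _]; apply: (table_eq QP QP'); apply: eq_on_trans QQ2 (eq_on_sym QE).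
  split=> //; apply: eq_on_trans (eq_on_sub SP2 QE) (eq_on_sym Q12).
have rE (B : {set W}) : B :|: [set x in rcons l a] = a |: (B :|: [set x in l]).
  by apply/setP=> x; rewrite !inE mem_rcons inE orbCA.
move: ul; rewrite rcons_uniq => /andP[al ul].
have aP2 : a \notin P2 by apply: lP2; rewrite mem_rcons mem_head.
have lP2' : {in l, forall x, x \notin P2} by move=> x xl; apply: lP2; rewrite mem_rcons inE xl orbT.
rewrite rE in Q1P.
have rE' (B : {set W}) : B :|: [set x in l ++ [:: a]] = a |: (B :|: [set x in l]).
  by rewrite cats1 rE.
have sub : S :|: [set x in l] \subset a |: (S :|: [set x in l]) by apply: subsetUr.
have Q1P' := separation_cut_sub Q1P sub.
rewrite -cats1 chain_weight_cat /= mulr1 -(IH ul lP2' Q1P') mulr_suml.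
pose P2l := P2 :|: [set x in l].
have aP2l : a \notin P2l by rewrite !inE negb_or aP2.
have SlP2l : S :|: [set x in l] \subset P2l by apply: setSU.
rewrite (partition_big (subtable P2l) (mem (amalgams l))) /=; last first.
  move=> Q /mem_amalgams[]; rewrite !rE' => QP QQ2 QQ1; apply/mem_amalgams; split.
  - by apply: (separation_subtable QP); apply: subsetUr.
  - apply: eq_on_trans QQ2; exact: eq_on_sub (subsetUl _ _) (@subtableE _ P2l Q).
  - apply: eq_on_trans (eq_on_sub SlP2l (@subtableE _ P2l Q)) _.
    exact: eq_on_sub sub QQ1.
apply: eq_bigr => Q' /mem_amalgams[Q'P Q'Q2 Q'Q1].
have Q'P' : separation P2l (cut P2l (ap Q')) by apply: separation_cut Q'P (subxx _).
have Q1Q' : eq_on (S :|: [set x in l]) (cut (a |: (S :|: [set x in l])) Q1) (ap Q').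
  move=> x y z w xS yS zS wS; rewrite cutE ?(subsetP sub) // Q'Q1 //.
have Q1w : weight t (cut (a |: (S :|: [set x in l])) Q1) (S :|: [set x in l]) a =
    weight t Q1 (S :|: [set x in l]) a.
  symmetry; apply: (weight_eq_on t Q1P sub) => x y z w *; by rewrite cutE.
rewrite -Q1w -(sum_one_types tm Q1P Q'P' SlP2l aP2l Q1Q') big_distrr /=.
rewrite (eq_bigl (mem (one_types (S :|: [set x in l]) a (ap Q')
  (cut (a |: (S :|: [set x in l])) Q1) P2l))); last first.
  move=> Q; apply/andP/mem_one_types => [[/mem_amalgams[]]|[QP QQ' QQ1]].
    rewrite !rE' => QP QQ2 QQ1 /eqP QE; split=> //.
      by rewrite -QE; apply/eq_on_sym/subtableE.
    by apply: eq_on_trans QQ1 _ => x y z w *; rewrite cutE.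
  split; last first.
    by apply/eqP; apply: (subtable_eq QP) => //; apply: subsetUr.
  apply/mem_amalgams; rewrite !rE'; split=> //.
    exact: eq_on_trans (eq_on_sub (subsetUl _ _) QQ') Q'Q2.
  by apply: eq_on_trans QQ1 _ => x y z w *; rewrite cutE.
apply: eq_bigr => Q /mem_one_types[QP QQ' _].
rewrite chain_weight_cat /= mulr1; congr (_ * _)%R.
rewrite (chain_weight_map t Q'P (f := id)) ?imset_id ?map_id // => x y z xS yS zS w wS.
exact: QQ'.
Qed.

End AmalgamSum.

(** * Sides of an edge of a tree *)

Section TreeSides.
Variables (V : finType) (e : rel V).
Hypothesis eT : is_tree e.

Definition cut_edge (p q : V) : rel V :=
  fun x y => e x y && ~~ ((x == p) && (y == q) || (x == q) && (y == p)).

Definition side (p q : V) : pred V := connect (cut_edge p q) q.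

Lemma cut_edge_sym p q : symmetric (cut_edge p q).
Proof.
move=> x y; rewrite /cut_edge (tree_sym eT) orbC.
by rewrite [(x == q) && _]andbC [(x == p) && _]andbC.
Qed.

Lemma cut_edgeC p q : cut_edge p q =2 cut_edge q p.
Proof. by move=> x y; rewrite /cut_edge orbC. Qed.

Lemma side_refl p q : side p q q. Proof. exact: connect0. Qed.

Lemma side_opp p q : e p q -> ~~ side p q p.
Proof.
move=> epq; apply/negP => /connectP[s0 s0P lp].
move: lp; case/shortenP: s0P => s sP us _ lp.
have ep : path e q s by apply: sub_path sP => x y /andP[].
have uc : ucycle e (q :: s).
  by rewrite /ucycle /= rcons_path ep -lp epq /=; rewrite /= in us.
have := tree_acyclic eT uc; case: s sP lp {ep us uc} => [|x [|]] //=.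
  by move=> _ pq; rewrite pq (tree_irr eT) in epq.
by rewrite /cut_edge => /andP[/andP[_ Nqx] _] px; rewrite px !eqxx orbT in Nqx.
Qed.

Lemma side_step p q x y : e x y -> side p q x != side p q y ->
  (x = p /\ y = q) \/ (x = q /\ y = p).
Proof.
move=> exy; have [/orP[]/andP[/eqP-> /eqP->]|Nxy] :=
  boolP ((x == p) && (y == q) || (x == q) && (y == p)); [by left|by right|].
rewrite /side => /eqP[]; apply: same_connect_r; last by apply: connect1; rewrite /cut_edge exy.
exact: sym_connect_sym (cut_edge_sym p q).
Qed.

Lemma sideC p q x : e p q -> side q p x = ~~ side p q x.
Proof.
move=> epq; have eqp : e q p by rewrite (tree_sym eT).
have csym := sym_connect_sym (cut_edge_sym p q).
have connE u v : connect (cut_edge q p) u v = connect (cut_edge p q) u v.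
  by apply: eq_connect => ? ?; apply: cut_edgeC.
have step u v : e u v -> side p q u || side q p u -> side p q v || side q p v.
  move=> euv; have [Nuv|/negPn] := boolP (~~ ((u == p) && (v == q) || (u == q) && (v == p))).
    have cuv : connect (cut_edge p q) u v by apply: connect1; rewrite /cut_edge euv.
    rewrite /side !connE => /orP[] h; apply/orP; [left|right]; exact: connect_trans h cuv.
  by case/orP=> /andP[_ /eqP->]; rewrite !side_refl ?orbT.
have both : side p q x || side q p x.
  have /connectP[s sP ->] := tree_conn eT q x.
  suff aux u : path e u s -> side p q u || side q p u ->
      side p q (last u s) || side q p (last u s) by apply: aux; rewrite ?side_refl.
  by elim: s u {sP} => //= y s IH u /andP[euy sP] /(step _ _ euy); apply: IH.
case px: (side p q x) both; last by []. move=> _ /=; apply: negbTE.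
apply/negP => qx; case/negP: (side_opp epq); apply: connect_trans px _.
by rewrite csym -connE.
Qed.

Lemma path_crosses p q x s : path e x s -> side p q x != side p q (last x s) ->
  edge_of x s p q.
Proof.
elim: s x => [|y s IH] x /=; first by rewrite eqxx.
case/andP=> exy sP; have [xy|xy] := eqVneq (side p q x) (side p q y).
  rewrite xy => /(IH _ sP)/orP[] h; rewrite /edge_of /= !inE h ?orbT //.
by move=> _; case: (side_step exy xy) => -[-> ->]; rewrite /edge_of /= !inE eqxx ?orbT.
Qed.

Lemma simple_path_crosses p q x s : e p q -> path e x s -> uniq (x :: s) ->
  (p, q) \in zip (x :: s) s -> ~~ side p q x /\ side p q (last x s).
Proof.
move=> epq; elim: s x => [|y s IH] x //= /andP[exy sP] /andP[xs us].
rewrite inE => /orP[/eqP[px qy]|pqs].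
  rewrite -px; split; first exact: side_opp.
  suff aux u s' : path e u s' -> p \notin u :: s' -> path (cut_edge p q) u s'.
    apply/connectP; exists s; last by rewrite qy.
    by rewrite qy -qy; apply: aux; rewrite ?qy ?px.
  elim: s' u => //= z s' IHs u /andP[euz sP'] ps.
  rewrite IHs //; last by move: ps; rewrite !inE negb_or => /andP[].
  rewrite andbT /cut_edge euz; move: ps; rewrite !inE !negb_or => /and3P[/negPf pu /negPf pz _].
  by rewrite [u == p]eq_sym [z == p]eq_sym pu pz andbF.
have [Ny sl] := IH y sP us pqs; split=> //.
apply: contra xs => sx; have xy : side p q x != side p q y by rewrite sx (negPf Ny).
case: (side_step exy xy) => -[xE yE].
  by move: sx; rewrite xE (negPf (side_opp epq)).
rewrite xE inE; apply/orP; right.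
have : q \in unzip2 (zip (y :: s) s) by apply/mapP; exists (p, q).
by rewrite unzip2_zip //= leqnSn.
Qed.

Lemma edge_of_e x s p q : path e x s -> edge_of x s p q -> e p q.
Proof.
suff aux u v : path e x s -> (u, v) \in zip (x :: s) s -> e u v.
  by move=> sP /orP[/(aux _ _ sP)//|/(aux _ _ sP)]; rewrite (tree_sym eT).
elim: s x => //= y s IH x /andP[exy sP]; rewrite inE => /orP[/eqP[-> ->] //|].
exact: IH.
Qed.

Lemma edge_of_side p q x s : path e x s -> uniq (x :: s) ->
  edge_of x s p q -> side p q x != side p q (last x s).
Proof.
move=> sP us epqs; have epq := edge_of_e sP epqs.
case/orP: epqs => [/(simple_path_crosses epq sP us)[/negPf-> ->]//|].
have eqp : e q p by rewrite (tree_sym eT).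
move=> /(simple_path_crosses eqp sP us); rewrite !(sideC _ epq).
by rewrite negbK => -[-> /negPf->].
Qed.

Lemma shortest_path_exists x y : exists s, shortest_path e x y s.
Proof.
have ex_n : exists n, `[< exists s, [/\ path e x s, last x s = y & size s = n] >].
  have /connectP[s sP ->] := tree_conn eT x y.
  by exists (size s); apply/asboolP; exists s.
case: (ex_minnP ex_n) => n /asboolP[s [sP ls sz]] min_n.
exists s; split=> // s' sP' ls'; rewrite sz; apply: min_n.
by apply/asboolP; exists s'.
Qed.

(** In a tree two paths share an edge exactly when that edge disconnects the ends of
    both, so the relation of a tree structure depends on the splits only. *)
Lemma path_relP x1 x2 y1 y2 : path_rel e x1 x2 y1 y2 <->
  uniq [:: x1; x2; y1; y2] /\ exists p q, [/\ e p q,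
    side p q x1 != side p q x2 & side p q y1 != side p q y2].
Proof.
split=> -[u]; last first.
  move=> [p [q [epq sx sy]]]; split=> //.
  have [s sP] := shortest_path_exists x1 x2; have [s' sP'] := shortest_path_exists y1 y2.
  have [es ls _] := sP; have [es' ls' _] := sP'.
  by exists s, s', p, q; split=> //; apply: path_crosses; rewrite ?ls ?ls'.
move=> [s [s' [p [q [sP sP' ep ep']]]]]; split=> //; exists p, q.
have [es ls _] := sP; have [es' ls' _] := sP'.
split; first exact: edge_of_e ep.
  by rewrite -ls; apply: edge_of_side => //; apply: shortest_path_uniq sP.
by rewrite -ls'; apply: edge_of_side => //; apply: shortest_path_uniq sP'.
Qed.

Lemma side_connected p q p' q' x : e p q ->
  ~~ side p q p' -> ~~ side p q q' -> side p q x -> side p' q' q = side p' q' x.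
Proof.
move=> epq Np' Nq' /connectP[s sP ->].
suff aux u : path (cut_edge p q) u s -> side p q u ->
  side p' q' u = side p' q' (last u s) by apply: aux; rewrite ?side_refl.
elim: s u {sP} => //= y s IH u /andP[cuy sP] su.
have sy : side p q y by apply: connect_trans su (connect1 cuy).
rewrite -(IH y sP sy); have /andP[euy _] := cuy.
apply/eqP; apply: contraT => /(side_step euy)[[uE yE]|[uE yE]].
  by move: su; rewrite uE (negPf Np').
by move: su; rewrite uE (negPf Nq').
Qed.

(** The edge [p' q'] lies on one side of [p q] unless they coincide. The other side of
    [p q] is connected without it, hence contained in one side of [p' q']. *)
Lemma sides_compatible p q p' q' x y z w : e p q -> e p' q' ->
  side p q x -> side p q y -> ~~ side p q z -> ~~ side p q w ->
  side p' q' x -> side p' q' z -> ~~ side p' q' y -> ~~ side p' q' w -> False.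
Proof.
move=> epq epq' sx sy sz sw tx tz ty tw.
have eqp : e q p by rewrite (tree_sym eT).
have [sp'|sp'] := eqVneq (side p q p') (side p q q'); last first.
  case: (side_step epq' sp') => -[pE qE]; last by move: tx; rewrite pE qE sideC // sx.
  by move: ty; rewrite pE qE sy.
have [sq'|sq'] := boolP (side p q q'); rewrite ?sq' ?(negPf sq') in sp'.
  have h v : ~~ side p q v -> side p' q' p = side p' q' v.
    rewrite -sideC // => qv; apply: (side_connected eqp) => //; rewrite sideC ?sp' ?sq' //.
  by have := h z sz; rewrite (h w sw) tz (negPf tw).
have h v : side p q v -> side p' q' q = side p' q' v.
  by move=> sv; apply: side_connected epq _ sq' sv; rewrite sp'.
by have := h x sx; rewrite (h y sy) tx (negPf ty).
Qed.

Lemma leaf_side z w x : [set y | e z y] = [set w] -> side w z x = (x == z).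
Proof.
move=> zE; apply/idP/eqP => [/connectP[[|y s] //= /andP[/andP[ezy Nc] _] _]|->]; last exact: side_refl.
have : y \in [set w] by rewrite -zE inE.
by move/set1P=> yw; rewrite yw !eqxx orbT in Nc.
Qed.

End TreeSides.

(** * The separation relation of a tree structure *)

(** The splits of the leaf set given by the oriented edges of a tree. The edge at a leaf
    cuts off this leaf, whence the last clause. *)
Lemma treeStr_splits (Y : treeStr) : exists (I : Type) (sg : I -> pred Y),
  [/\ forall x1 x2 y1 y2, qrel x1 x2 y1 y2 <->
        uniq [:: x1; x2; y1; y2] /\
        exists i, sg i x1 != sg i x2 /\ sg i y1 != sg i y2,
      forall i j x y z w, sg i x -> sg i y -> ~~ sg i z -> ~~ sg i w ->
        sg j x -> sg j z -> ~~ sg j y -> ~~ sg j w -> False,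
      forall i, exists j, forall x, sg j x = ~~ sg i x &
      forall z x, x != z -> exists i, forall y, sg i y = (y == z)].
Proof.
have [V [e [eT [f [f_bij fR]]]]] := treeStrP Y.
have f_inj := bij_inj f_bij.
pose g y := val (f y); have g_inj : injective g by move=> x y /val_inj/f_inj.
exists {u : V * V | e u.1 u.2}, (fun u y => side e (val u).1 (val u).2 (g y)); split.
- move=> x1 x2 y1 y2; rewrite fR /leaf_rel path_relP //.
  have -> : uniq [:: val (f x1); val (f x2); val (f y1); val (f y2)] =
    uniq [:: x1; x2; y1; y2] by rewrite -(map_inj_uniq g_inj).
  split=> -[u]; first by move=> [p [q [epq h1 h2]]]; split=> //; exists (exist _ (p, q) epq).
  by move=> [[[p q] /= epq] [h1 h2]]; split=> //; exists p, q.
- move=> [[p q] /= epq] [[p' q'] /= epq'] x y z w.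
  exact: (sides_compatible eT epq epq').
- move=> [[p q] /= epq]; have eqp : e q p by rewrite (tree_sym eT).
  by exists (exist _ (q, p) eqp) => x /=; rewrite sideC.
move=> z x xz; have /orP[/cards1P[w zE]|/eqP/fintype1[v vE]] := valP (f z); last first.
  by case/eqP: xz; apply: g_inj; rewrite (vE (g x)) (vE (g z)).
have ewz : e w (g z).
  by have := set11 w; rewrite -zE inE (tree_sym eT).
exists (exist (fun u => e u.1 u.2) (w, g z) ewz) => y /=.
by rewrite (leaf_side _ zE) (inj_eq g_inj).
Qed.

(** [qsep x y z w] holds when the path from [x] to [y] does not meet the path from
    [z] to [w], the two paths being allowed to be reduced to a leaf. *)
Definition qsep (Y : treeStr) (x y z w : Y) : bool :=
  [&& x != z, x != w, y != z & y != w] &&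
  [|| x == y, z == w | `[< qrel x z y w /\ qrel x w y z >]].

Section Qsep.
Variable Y : treeStr.
Implicit Types x y z w : Y.

Lemma qsep_splits : exists (I : Type) (sg : I -> pred Y),
  [/\ forall x y z w, qsep x y z w <-> exists i,
        [/\ sg i x, sg i y, ~~ sg i z & ~~ sg i w],
      forall x1 x2 y1 y2, qrel x1 x2 y1 y2 <->
        uniq [:: x1; x2; y1; y2] /\
        exists i, sg i x1 != sg i x2 /\ sg i y1 != sg i y2,
      forall i j x y z w, sg i x -> sg i y -> ~~ sg i z -> ~~ sg i w ->
        sg j x -> sg j z -> ~~ sg j y -> ~~ sg j w -> False,
      forall i, exists j, forall x, sg j x = ~~ sg i x &
      forall z x, x != z -> exists i, forall y, sg i y = (y == z)].
Proof.
have [I [sg [sgR sgc sgN sg1]]] := treeStr_splits Y.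
exists I, sg; split=> // x y z w; split; last first.
  move=> [i [ix iy iz iw]].
  have neq u v : sg i u -> ~~ sg i v -> u != v by move=> iu; apply: contraNneq => <-.
  rewrite /qsep !neq //=; have [//|xy] := eqVneq x y; have [//|zw] := eqVneq z w.
  have [yz yw] := (neq y z iy iz, neq y w iy iw).
  have [xz xw] := (neq x z ix iz, neq x w ix iw).
  apply/asboolP; split; apply/sgR; split.
  - by rewrite /= !inE !negb_or xz xy xw zw eq_sym yz yw.
  - by exists i; rewrite ix iy (negPf iz) (negPf iw).
  - by rewrite /= !inE !negb_or xz xy xw [w == y]eq_sym yw [w == z]eq_sym zw yz.
  - by exists i; rewrite ix iy (negPf iz) (negPf iw).
case/andP=> /and4P[xz xw yz yw] /or3P[/eqP xy|/eqP zw|/asboolP[/sgR[_ [i [i1 i2]]] /sgR[_ [j [j1 j2]]]]].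
- have zx : z != x by rewrite eq_sym.
  have [i iE] := sg1 x z zx; exists i.
  by rewrite !iE -xy eqxx zx eq_sym xw.
- have [i iE] := sg1 z x xz; have [j jE] := sgN i; exists j.
  by rewrite !jE !iE -zw eqxx xz yz.
have flip k : exists k', sg k' x /\ forall u v, (sg k' u == sg k' v) = (sg k u == sg k v).
  have [kx|kx] := boolP (sg k x); first by exists k.
  have [k' k'E] := sgN k; exists k'; split; first by rewrite k'E.
  by move=> u v; rewrite !k'E; do 2!case: (sg k _).
have [i' [ix iE]] := flip i; have [j' [jx jE]] := flip j.
move: i1 i2 j1 j2; rewrite -!iE -!jE ix jx => iz iyw jw jyz.
have {}iz : ~~ sg i' z by move: iz; case: (sg i' z).
have {}jw : ~~ sg j' w by move: jw; case: (sg j' w).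
have [iy|iy] := boolP (sg i' y).
  by exists i'; split=> //; move: iyw; rewrite iy; case: (sg i' w).
have [jy|jy] := boolP (sg j' y).
  by exists j'; split=> //; move: jyz; rewrite jy; case: (sg j' z).
have iw : sg i' w by move: iyw; rewrite (negPf iy); case: (sg i' w).
have jz : sg j' z by move: jyz; rewrite (negPf jy); case: (sg j' z).
by case: (sgc i' j' x w z y ix iw iz iy jx jz jw jy).
Qed.

(** The axioms express that the splits of a tree are pairwise compatible and that each
    leaf is cut off by a split. *)
Lemma qsep_separation : separation [set: Y] (@qsep Y).
Proof.
have [I [sg [sgE _ sgc sgN sg1]]] := qsep_splits.
split; first split.
- by [].
- by move=> x y z w; apply/idP/idP => /sgE[i [? ? ? ?]]; apply/sgE; exists i.
- move=> x y z w; apply/idP/idP => /sgE[i [? ? ? ?]]; apply/sgE;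
    by have [j jE] := sgN i; exists j; rewrite !jE; split=> //; apply/negPn.
- move=> x y z w /sgE[i [ix iy iz iw]]; apply/negP => /sgE[j [jx jz jy jw]].
  exact: (sgc i j x y z w).
- move=> t x y z w _ /sgE[i [ix iy iz iw]]; apply/orP.
  by have [it|it] := boolP (sg i t); [left|right]; apply/sgE; exists i.
move=> x y z Dx Dy; have neq u : qsep u u z z -> u != z by case/andP=> /and4P[].
have [i iE] := sg1 z x (neq x Dx); have [j jE] := sgN i.
by apply/sgE; exists j; rewrite !jE !iE eqxx (neq x Dx) (neq y Dy).
Qed.

Lemma qsep_same x y : same (@qsep Y) x y = (x == y).
Proof. by rewrite /same /qsep eqxx /= andbT; case: eqP. Qed.

(** Two paths with four different ends meet along an edge exactly when one of the two
    other pairings of the ends gives disjoint paths. *)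
Lemma qrel_qsep x1 x2 y1 y2 : qrel x1 x2 y1 y2 <->
  uniq [:: x1; x2; y1; y2] /\ (qsep x1 y1 x2 y2 \/ qsep x1 y2 x2 y1).
Proof.
have [I [sg [sgE sgR sgc sgN sg1]]] := qsep_splits; rewrite sgR.
split=> -[u h]; split=> //; last first.
  by case: h => /sgE[i [h1 h2 h3 h4]]; exists i;
     rewrite h1 h2 (negPf h3) (negPf h4).
case: h => i [i1 i2].
have [j [jx jE]] : exists j, sg j x1 /\ forall u v, (sg j u == sg j v) = (sg i u == sg i v).
  have [kx|kx] := boolP (sg i x1); first by exists i.
  have [j jE] := sgN i; exists j; split; first by rewrite jE.
  by move=> a b; rewrite !jE; do 2!case: (sg i _).
move: i1 i2; rewrite -!jE jx => jx2 jy.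
have [jy1|jy1] := boolP (sg j y1); [left|right]; apply/sgE; exists j; split=> //.
  by move: jy; rewrite jy1; case: (sg j y2).
by move: jy; rewrite (negPf jy1); case: (sg j y2).
Qed.

End Qsep.

Lemma emb_qsep (X Y : treeStr) (i : embedding X Y) x y z w :
  qsep (i x) (i y) (i z) (i w) = qsep x y z w.
Proof.
rewrite /qsep !(inj_eq (@emb_inj _ _ i)); congr (_ && [|| _, _ | _]).
by apply/asboolP/asboolP; rewrite -!(emb_rel i).
Qed.

Lemma qsep_emb (X Y : treeStr) (i : X -> Y) : injective i ->
  (forall x y z w, qsep (i x) (i y) (i z) (i w) = qsep x y z w) ->
  exists f : embedding X Y, emb_fun f = i.
Proof.
move=> i_inj iE; unshelve eexists (@Embedding X Y i i_inj _) => //.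
move=> x1 x2 y1 y2; rewrite !qrel_qsep !iE.
by rewrite -(map_inj_uniq i_inj [:: x1; x2; y1; y2]).
Qed.

(** * Trees from separation relations *)

Section Realization.
Variables (X : finType) (D : X -> X -> X -> X -> bool).
Hypothesis DP : separation [set: X] D.
Hypothesis Dinj : forall x y, same D x y -> x = y.

Definition sep_rel : quat X := fun x1 x2 y1 y2 =>
  uniq [:: x1; x2; y1; y2] /\ (D x1 y1 x2 y2 \/ D x1 y2 x2 y1).

Definition is_split (C : {set X}) : bool :=
  [forall p in C, forall q in C, forall s in ~: C, forall t in ~: C, D p q s t].

Lemma is_splitP (C : {set X}) :
  reflect (forall p q s t, p \in C -> q \in C -> s \notin C -> t \notin C -> D p q s t)
          (is_split C).
Proof.
apply: (iffP forall_inP) => [h p q s t pC qC sC tC|h p pC].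
  by have /forall_inP/(_ _ qC)/forall_inP/(_ s)/[!inE]/(_ sC)/forall_inP/(_ t)/[!inE]/(_ tC) := h p pC.
apply/forall_inP=> q qC; apply/forall_inP=> s; rewrite inE => sC.
by apply/forall_inP=> t; rewrite inE => tC; apply: h.
Qed.

Lemma sep_neq x y z : z != x -> z != y -> D z z x y.
Proof.
have aux u v : u != v -> D u u v v.
  by move=> uv; apply: contraNT uv => Nuv; apply/eqP/Dinj.
move=> zx zy; rewrite (sep_swap DP); apply: (sep_point DP); apply: aux; by rewrite eq_sym.
Qed.

Lemma split_compl (C : {set X}) : is_split C -> is_split (~: C).
Proof.
move/is_splitP=> h; apply/is_splitP=> p q s t; rewrite !inE !negbK => pC qC sC tC.
by rewrite (sep_swap DP); apply: h.
Qed.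

Variables (r : X).
Hypothesis X2 : 1 < #|X|.

(** Rooting the tree at the leaf [r], a vertex other than [r] is the set of leaves
    below it. *)
Definition cluster (C : {set X}) : bool :=
  (C == setT) || [&& C != set0, r \notin C & is_split C].

Definition cvertex : finType := {C : {set X} | cluster C}.
Definition croot : cvertex := Sub [set: X] (introT orP (or_introl (eqxx _))).

(** Two clusters that meet and are not nested would give crossing splits, the root
    being outside both. *)
Lemma cluster_laminar (C C' : {set X}) x : cluster C -> cluster C' -> x \in C -> x \in C' ->
  (C \subset C') || (C' \subset C).
Proof.
case/orP=> [/eqP-> _ _ _|/and3P[_ rC /is_splitP hC]]; first by rewrite subsetT orbT.
case/orP=> [/eqP-> _ _|/and3P[_ rC' /is_splitP hC']]; first by rewrite subsetT.
move=> xC xC'; have [//|/subsetPn[y yC yC']] := boolP (C \subset C').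
apply/subsetP=> z zC'; apply: contraT => zC.
have D1 := hC x y z r xC yC zC rC; have D2 := hC' x z y r xC' zC' yC' rC'.
sep_absurd DP D1 D2.
Qed.

Lemma cluster_neq0 C : cluster C -> C != set0.
Proof.
case/orP=> [/eqP->|/and3P[]//]; apply/set0Pn; exists r; exact: in_setT.
Qed.

Definition cparent (C : cvertex) : cvertex :=
  [arg min_(B < croot | val C \proper val B) #|val B|].

Lemma cparentP C : C != croot -> val C \proper val (cparent C) /\
  forall B : cvertex, val C \proper val B -> val (cparent C) \subset val B.
Proof.
move=> Cr; have CT : val C \proper val croot.
  rewrite properEneq subsetT andbT; apply: contraNneq Cr => CT.
  by apply/eqP/val_inj.
rewrite /cparent; case: arg_minnP => // B CB minB; split=> // B' CB'.
have /set0Pn[x xC] := cluster_neq0 (valP C).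
have [sB sB'] := (proper_sub CB, proper_sub CB').
have := cluster_laminar (valP B) (valP B') (subsetP sB _ xC) (subsetP sB' _ xC).
case/orP=> // sBB'; suff -> : val B = val B' by [].
by apply/eqP; rewrite eq_sym eqEcard sBB' minB.
Qed.

Definition cedge : rel cvertex :=
  fun x y => (x != croot) && (y == cparent x) || (y != croot) && (x == cparent y).

Lemma cedge_tree : is_tree cedge.
Proof.
apply: (@is_tree_parent _ _ croot cparent (fun C => #|~: val C|)) => // C Cr.
have [/properP[sub [x xP xC]] _] := cparentP Cr.
apply: proper_card; apply/properP; split; first by rewrite setCS.
by exists x; rewrite !inE ?xP.
Qed.

(** The far side of the edge above [C] consists of the clusters contained in [C]. *)
Lemma cside C B : C != croot -> side cedge (cparent C) C B = (val B \subset val C).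
Proof.
move=> Cr; have [Cpar minpar] := cparentP Cr; have eT := cedge_tree.
have closedE : closed (cut_edge cedge (cparent C) C) [pred B : cvertex | val B \subset val C].
  have aux B1 : B1 != croot -> ~~ ((cparent B1 == cparent C) && (B1 == C)) ->
      (val B1 \subset val C) = (val (cparent B1) \subset val C).
    move=> B1r NB; have [B1p min1] := cparentP B1r.
    apply/idP/idP => [s|]; last exact: subset_trans (proper_sub B1p).
    apply: min1; rewrite properEneq s andbT; apply: contraNneq NB => E.
    by rewrite (val_inj E) !eqxx.
  move=> B1 B2 /andP[e12 Nc]; rewrite !inE.
  case/orP: e12 => /andP[Br /eqP BE]; last first.
    by rewrite BE; apply/esym/aux => //; apply: contra Nc => /andP[/eqP E /eqP->];
      rewrite BE E !eqxx.
  by rewrite BE; apply: aux => //; apply: contra Nc => /andP[/eqP E /eqP->];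
      rewrite BE E !eqxx orbT.
have eC : cedge (cparent C) C by rewrite /cedge Cr eqxx orbT.
apply/idP/idP => [/(closed_connect closedE)|BC].
  by rewrite !inE subxx => <-.
apply: contraT; rewrite -(sideC eT _ eC) /side => h.
have closedE' : closed (cut_edge cedge C (cparent C)) [pred B : cvertex | val B \subset val C].
  by move=> B1 B2; rewrite cut_edgeC; apply: closedE.
have := closed_connect closedE' h; rewrite !inE BC.
by have /andP[_ /negPf->] := Cpar.
Qed.

Lemma cluster1 x : x != r -> cluster [set x].
Proof.
move=> xr; apply/orP; right; apply/and3P; split.
- by apply/set0Pn; exists x; rewrite inE.
- by rewrite inE eq_sym.
apply/is_splitP=> p q s t; rewrite !inE => /eqP-> /eqP-> sx tx.
by apply: sep_neq; rewrite eq_sym.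
Qed.

Definition cleaf (x : X) : cvertex :=
  if boolP (x != r) is AltTrue xr then Sub [set x] (cluster1 xr) else croot.

Lemma cleafE x : val (cleaf x) = if x == r then [set: X] else [set x].
Proof.
rewrite /cleaf; case: {-}_ / boolP => [xr|]; first by rewrite (negPf xr).
by rewrite negbK => ->.
Qed.

Lemma set1_neqT x : [set x] != [set: X].
Proof. by apply: contraTneq X2 => E; rewrite -cardsT -E cards1. Qed.

Lemma cleaf_root x : (cleaf x == croot) = (x == r).
Proof.
rewrite -val_eqE /= cleafE; case: (eqVneq x r) => [_|_]; first exact: eqxx.
exact/negbTE/set1_neqT.
Qed.

Lemma cleaf_inj : injective cleaf.
Proof.
move=> x y /(congr1 val); rewrite !cleafE.
case: eqP => [->|_]; case: eqP => [->|_] // E.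
- by have := set1_neqT y; rewrite E eqxx.
- by have := set1_neqT x; rewrite E eqxx.
- exact: set1_inj.
Qed.

Lemma cluster_sub C : C != croot -> val C \subset ~: [set r].
Proof.
move=> Cr; have /orP[/eqP CT|/and3P[_ rC _]] := valP C.
  by case/eqP: Cr; apply: val_inj.
by apply/subsetP=> x xC; rewrite !inE; apply: contraNneq rC => <-.
Qed.

Lemma clusterC1 : cluster (~: [set r]).
Proof.
apply/orP; right; apply/and3P; split.
- case/card_gt1P: X2 => x [y [_ _ xy]]; have [xr|xr] := eqVneq x r.
    by apply/set0Pn; exists y; rewrite !inE -xr eq_sym.
  by apply/set0Pn; exists x; rewrite !inE.
- by rewrite !inE eqxx.
apply/is_splitP=> p q s t; rewrite !inE !negbK => pr qr /eqP-> /eqP->.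
by rewrite (sep_swap DP); apply: sep_neq; rewrite eq_sym.
Qed.

Lemma cleaf_leaf x : leaf cedge (cleaf x).
Proof.
apply/orP; left; apply/cards1P; have [xr|xr] := eqVneq (cleaf x) croot; last first.
  exists (cparent (cleaf x)); apply/setP=> B; rewrite !inE /cedge xr /=.
  case: (eqVneq B (cparent (cleaf x))) => //= NB.
  apply/negP => /andP[Br /eqP xB]; have [BB _] := cparentP Br.
  move: xr; rewrite cleaf_root => xr; move: BB; rewrite -xB cleafE (negPf xr).
  move=> /properP[sub [y]]; rewrite inE => /eqP-> xB'.
  have /set0Pn[z zB] := cluster_neq0 (valP B).
  by have := subsetP sub _ zB; rewrite inE => /eqP zx; rewrite -zx zB in xB'.
pose C1 : cvertex := Sub (~: [set r]) clusterC1.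
have C1r : C1 != croot.
  by rewrite -val_eqE /=; apply/eqP => /setP/(_ r); rewrite !inE eqxx.
exists C1; apply/setP=> B; rewrite !inE /cedge xr eqxx /=.
have parC1 : cparent C1 = croot.
  apply/eqP; apply: contraT => Pr; have [/properP[_ [y yP yC]] _] := cparentP C1r.
  have := subsetP (cluster_sub Pr) _ yP; move: yC; rewrite !inE negbK => /eqP->.
  by rewrite eqxx.
apply/andP/eqP => [[Br /eqP par]|->]; last by rewrite parC1.
apply/val_inj/eqP; rewrite /= eqEsubset cluster_sub //=.
apply: contraT => NB; have [_ minB] := cparentP Br.
have /minB : val B \proper val C1 by rewrite /proper cluster_sub.
by rewrite -par /= subTset => /eqP/setP/(_ r); rewrite !inE eqxx.
Qed.

Lemma cside_leaf C x : C != croot -> side cedge (cparent C) C (cleaf x) = (x \in val C).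
Proof.
move=> Cr; rewrite cside // cleafE; case: eqP => [->|_]; last by rewrite sub1set.
rewrite subTset; have := subsetP (cluster_sub Cr) r; rewrite !inE eqxx /=.
case: (r \in val C) => [/(_ isT)//|_]; apply/negbTE; apply: contra Cr => /eqP CT.
by apply/eqP/val_inj.
Qed.

(** Each edge of the tree lies above a cluster, whose elements are the leaves on the far
    side; conversely [sep_split] makes a split out of every separated quadruple. *)
Lemma sep_rel_path x1 x2 y1 y2 :
  sep_rel x1 x2 y1 y2 <-> path_rel cedge (cleaf x1) (cleaf x2) (cleaf y1) (cleaf y2).
Proof.
rewrite path_relP; last exact: cedge_tree.
have -> : uniq [:: cleaf x1; cleaf x2; cleaf y1; cleaf y2] = uniq [:: x1; x2; y1; y2].
  by rewrite -(map_inj_uniq cleaf_inj).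
have eT := cedge_tree; split=> -[u h]; split=> //.
  have [C [Cr sx sy]] : exists C : cvertex, [/\ C != croot,
      (x1 \in val C) != (x2 \in val C) & (y1 \in val C) != (y2 \in val C)].
    have aux s t s' t' : D s t s' t' -> exists C : cvertex, [/\ C != croot,
        (s \in val C) = (t \in val C), (s' \in val C) = (t' \in val C) &
        (s \in val C) != (s' \in val C)].
      move=> Ds; pose C0 := [set u | D s u s' t'].
      have C0s : is_split C0.
        apply/is_splitP=> p q v w; rewrite !inE => Dp Dq Nv Nw.
        by apply: (sep_split DP Dp Dq); rewrite ?inE.
      have sC : s \in C0 by rewrite inE (sep_diagl DP Ds).
      have tC : t \in C0 by rewrite inE.
      have sC' : s' \in C0 = false by rewrite inE (sep_irr1 DP).
      have tC' : t' \in C0 = false by rewrite inE (sep_irr3 DP).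
      have [rC|rC] := boolP (r \in C0).
        have cC : cluster (~: C0).
          apply/orP; right; apply/and3P; split; last exact: split_compl.
            by apply/set0Pn; exists s'; rewrite inE sC'.
          by rewrite inE negbK.
        exists (Sub _ cC); rewrite -val_eqE /= !in_setC sC tC sC' tC'; split=> //.
        by apply/eqP => /setP/(_ s); rewrite in_setC sC inE.
      have cC : cluster C0.
        apply/orP; right; apply/and3P; split=> //.
        by apply/set0Pn; exists s.
      exists (Sub _ cC); rewrite -val_eqE /=; split.
      - by apply/eqP => /setP/(_ s'); rewrite sC' inE.
      - by rewrite sC tC.
      - by rewrite sC' tC'.
      - by rewrite sC sC'.
    case: h => /aux[C [Cr E1 E2 N]]; exists C; split=> //.
      by rewrite -E1 -E2.
    by rewrite -E1 -E2 eq_sym.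
  exists (cparent C), C; rewrite !cside_leaf //; split=> //.
  by rewrite /cedge Cr eqxx orbT.
have [C [Cr sx sy]] : exists C : cvertex, [/\ C != croot,
    (x1 \in val C) != (x2 \in val C) & (y1 \in val C) != (y2 \in val C)].
  case: h => p [q [epq sx sy]]; have /orP[/andP[pr /eqP qE]|/andP[qr /eqP pE]] := epq.
    exists p; have eqp : cedge q p by rewrite (tree_sym eT).
    rewrite !(sideC eT _ eqp) qE !cside_leaf // in sx sy; split=> //.
      by move: sx; do 2!case: (_ \in _).
    by move: sy; do 2!case: (_ \in _).
  by exists q; rewrite pE !cside_leaf // in sx sy.
have /orP[/eqP CT|/and3P[_ _ /is_splitP CS]] := valP C.
  by case/eqP: Cr; apply: val_inj.
have CS' p q s t : p \notin val C -> q \notin val C -> s \in val C -> t \in val C -> D p q s t.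
  by move=> *; rewrite (sep_swap DP); apply: CS.
have x2E : (x2 \in val C) = (x1 \notin val C).
  by move: sx; case: (x1 \in _); case: (x2 \in _).
have y2E : (y2 \in val C) = (y1 \notin val C).
  by move: sy; case: (y1 \in _); case: (y2 \in _).
have [x1C|x1C] := boolP (x1 \in val C); have [y1C|y1C] := boolP (y1 \in val C);
  [left|right|right|left].
- by apply: CS; rewrite ?x2E ?y2E ?negbK.
- by apply: CS; rewrite ?x2E ?y2E ?negbK.
- by apply: CS'; rewrite ?x2E ?y2E ?negbK.
- by apply: CS'; rewrite ?x2E ?y2E ?negbK.
Qed.

End Realization.

(** A separation relation without coinciding points comes from the tree whose edges
    are its splits, rooted at one of the points. With at most one point there is no
    split, and the one-point tree does. *)
Lemma separation_tree (X : finType) (D : X -> X -> X -> X -> bool) :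
  separation [set: X] D -> (forall x y, same D x y -> x = y) ->
  is_tree_structure (sep_rel D).
Proof.
move=> DP Dinj; have [X2|X1] := ltnP 1 #|X|.
  have [r _] : exists r : X, true by case/card_gt0P: (ltnW X2) => r; exists r.
  apply: (@is_tree_structure_sub X _ _ _ (@cleaf X D DP Dinj r)).
  - exact: cedge_tree.
  - exact: cleaf_inj.
  - exact: cleaf_leaf.
  - exact: sep_rel_path.
have Xeq (x y : X) : x = y.
  by apply: (fintype_le1P X1).
apply: (@is_tree_structure_sub X _ _ _ (fun=> tt) point_is_tree).
- by move=> x y _; apply: Xeq.
- by move=> _; apply: point_leaf.
- move=> x1 x2 y1 y2; split=> -[u _]; last by [].
  by move: u; rewrite (Xeq x1 x2) /= inE eqxx.
Qed.

Definition sep_str (X : finType) (D : X -> X -> X -> X -> bool)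
  (DP : separation [set: X] D) (Dinj : forall x y, same D x y -> x = y) : treeStr :=
  TreeStr (separation_tree DP Dinj).

Lemma qsep_sep_str (X : finType) (D : X -> X -> X -> X -> bool)
  (DP : separation [set: X] D) (Dinj : forall x y, same D x y -> x = y) x y z w :
  @qsep (sep_str DP Dinj) x y z w = D x y z w.
Proof.
have neq u v : D u u v v -> u != v.
  by move=> Du; apply/eqP => uv; move: Du; rewrite uv (sep_irr DP).
have D4 := sep_neq DP Dinj.
rewrite /qsep; apply/andP/idP => [[/and4P[xz xw yz yw] h]|Dx].
  case/or3P: h => [/eqP xy|/eqP zw|/asboolP[[u [h1|h1]] [_ [h2|h2]]]] //.
  - by rewrite -xy; apply: D4; rewrite eq_sym // eq_sym.
  - by rewrite -zw (sep_swap DP); apply: D4; rewrite eq_sym // eq_sym.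
  - by sep_sym DP h2.
  - sep_absurd DP h1 h2.
have [xP yP zP wP] := sep_mem DP Dx.
have xz : x != z by apply: neq; apply: (sep_diagr DP (sep_diagl DP Dx)).
have xw : x != w.
  by apply: neq; have D1 : D x y w z := etrans (sep_flipr DP _ _ _ _) Dx;
     apply: (sep_diagr DP (sep_diagl DP D1)).
have yz : y != z.
  by apply: neq; have D1 : D y x z w := etrans (sep_flip DP _ _ _ _) Dx;
     apply: (sep_diagr DP (sep_diagl DP D1)).
have yw : y != w.
  apply: neq; have D1 : D y x w z by sep_sym DP Dx.
  exact: (sep_diagr DP (sep_diagl DP D1)).
split; first by rewrite xz xw yz.
have [//|xy] := eqVneq x y; have [//|zw] := eqVneq z w.
apply/asboolP; split; split.
- by rewrite /= !inE !negb_or xz xy xw zw eq_sym yz yw.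
- by left.
- by rewrite /= !inE !negb_or xz xy xw [w == y]eq_sym yw [w == z]eq_sym zw yz.
- by left; sep_sym DP Dx.
Qed.

(** * Amalgamations as relations on the disjoint union *)

(** Pullback of a relation along a partial map. *)
Definition popt (W Y : finType) (o : W -> option Y) (D : Y -> Y -> Y -> Y -> bool) :
    W -> W -> W -> W -> bool := fun x y z w =>
  if (o x, o y, o z, o w) is (Some x', Some y', Some z', Some w') then D x' y' z' w' else false.

Lemma separation_popt (W Y : finType) (o : W -> option Y) D :
  separation [set: Y] D -> separation [set u | isSome (o u)] (popt o D).
Proof.
move=> DP; split; first split.
- by move=> x y z w; rewrite /popt inE; case: (o x).
- move=> x y z w; rewrite /popt; case: (o x); case: (o y) => // x' y'.
  by case: (o z); case: (o w) => // z' w'; apply: (sep_flip DP).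
- move=> x y z w; rewrite /popt; case: (o x); case: (o y); case: (o z); case: (o w) => // *.
  by apply: (sep_swap DP).
- move=> x y z w; rewrite /popt; case: (o x); case: (o y); case: (o z); case: (o w) => // *.
  by apply: (sep_thin DP).
- move=> t x y z w; rewrite inE /popt.
  case: (o t); case: (o x); case: (o y); case: (o z); case: (o w) => // *.
  by apply: (sep_sat DP).
by move=> x y z; rewrite /popt; case: (o x); case: (o y); case: (o z) => // *; apply: (sep_point DP).
Qed.

(** The structure that a relation with coinciding points induces on its classes. *)
Section Quotient.
Variables (W : finType) (Q : W -> W -> W -> W -> bool).
Hypothesis QP : separation [set: W] Q.

Definition class_repr u := odflt u [pick v | same Q u v].

Lemma class_reprP u : same Q u (class_repr u).
Proof. by rewrite /class_repr; case: pickP => //= _; apply: (same_refl QP). Qed.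

Lemma class_repr_eq u v : same Q u v -> class_repr u = class_repr v.
Proof.
move=> uv; rewrite /class_repr.
have E : same Q u =1 same Q v.
  move=> w; apply/idP/idP; apply: (same_trans QP (in_setT _)) => //.
  by rewrite (sameC QP).
rewrite (eq_pick E); case: pickP => // /(_ v); by rewrite (same_refl QP).
Qed.

Lemma class_repr_id u : class_repr (class_repr u) == class_repr u.
Proof. by apply/eqP/esym/class_repr_eq/class_reprP. Qed.

Definition class_type : finType := {u : W | class_repr u == u}.
Definition class_of (u : W) : class_type := exist _ (class_repr u) (class_repr_id u).
Definition class_sep (x y z w : class_type) := Q (val x) (val y) (val z) (val w).

Lemma class_sepE x y z w :
  class_sep (class_of x) (class_of y) (class_of z) (class_of w) = Q x y z w.
Proof.
apply/idP/idP => Qx; apply: (same_sub4 QP _ _ _ _ _ _ _ _ Qx); rewrite ?in_setT //=;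
  by rewrite ?class_reprP // (sameC QP) class_reprP.
Qed.

Lemma class_sep_separation : separation [set: class_type] class_sep.
Proof.
have h := separation_pull (P := [set: class_type]) (f := val) QP (fun _ _ => in_setT _).
by apply: separation_ext h => x y z w; rewrite cutE ?in_setT.
Qed.

Lemma class_sep_inj x y : same class_sep x y -> x = y.
Proof.
move=> xy; apply/val_inj; rewrite -(eqP (valP x)) -(eqP (valP y)).
exact: class_repr_eq.
Qed.

Definition class_str := sep_str class_sep_separation class_sep_inj.

Lemma class_of_surj (c : class_type) : class_of (val c) = c.
Proof. apply/val_inj; exact: (eqP (valP c)). Qed.

End Quotient.

Section Rank.
Variable X : treeStr.

Definition rank_fun (x : X) : skel_of X := enum_rank x.

Lemma rank_rel x1 x2 y1 y2 : qrel x1 x2 y1 y2 <->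
  qrel (rank_fun x1) (rank_fun x2) (rank_fun y1) (rank_fun y2).
Proof. by rewrite /= !enum_rankK. Qed.

Definition rank_emb : embedding X (skel_of X) :=
  @Embedding X (skel_of X) rank_fun (@enum_rank_inj X) rank_rel.

Lemma rank_bij : bijective rank_emb.
Proof. exact: enum_rank_bij. Qed.

End Rank.

Section AmalgamationData.
Variables (X Y X' : skel) (i : embedding X Y) (k : embedding X X').

Definition glued : finType := (Y + X')%type.

Definition am_map (a : amalgamation i k) (u : glued) : a :=
  match u with inl y => am1 a y | inr x => am2 a x end.

(** An amalgamation is determined up to isomorphism by the relation that it induces on
    the disjoint union of its two pieces, where glued points coincide. *)
Definition am_data (a : amalgamation i k) : table glued :=
  tab (fun x y z w => qsep (am_map a x) (am_map a y) (am_map a z) (am_map a w)).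

Lemma am_dataE a x y z w : ap (am_data a) x y z w =
  qsep (am_map a x) (am_map a y) (am_map a z) (am_map a w).
Proof. by rewrite tabK. Qed.

Lemma am_map_surj a z : exists u, am_map a u = z.
Proof. by case: (am_surj z) => -[y <-]; [exists (inl y)|exists (inr y)]. Qed.

Lemma am_data_same a u v : same (ap (am_data a)) u v = (am_map a u == am_map a v).
Proof. by rewrite -qsep_same /same am_dataE. Qed.

Lemma am_data_separation a : separation [set: glued] (ap (am_data a)).
Proof.
have h := separation_pull (P := [set: glued]) (f := am_map a)
  (qsep_separation a) (fun _ _ => in_setT _).
by apply: separation_ext h => x y z w; rewrite cutE ?in_setT // am_dataE.
Qed.

Lemma am_iso_data a b : amalg_iso a b -> am_data a = am_data b.
Proof.
case=> h [_ h1 h2]; have hE u : h (am_map a u) = am_map b u by case: u => y /=.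
by apply/ffunP=> -[[[x y] z] w]; rewrite !ffunE /= -!hE emb_qsep.
Qed.

(** Both amalgamations are covered by the two pieces, so that equal relations induce a
    map between them. *)
Lemma am_data_emb a b : am_data a = am_data b ->
  exists h : embedding a b, forall u, h (am_map a u) = am_map b u.
Proof.
move=> ab; pose h0 z := xchoose (let: ex_intro u e := am_map_surj (a := a) z in
  ex_intro (fun u => am_map a u == z) u (introT eqP e)).
pose h z := am_map b (h0 z).
have h0K z : am_map a (h0 z) = z by apply/eqP/(xchooseP (P := fun u => am_map a u == z)).
have hE u : h (am_map a u) = am_map b u.
  apply/eqP; rewrite /h -am_data_same -ab am_data_same; apply/eqP/h0K.
have h_inj : injective h.
  move=> z w /eqP; rewrite -(h0K z) -(h0K w) !hE -am_data_same -ab am_data_same.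
  by move/eqP.
have hq x y z w : qsep (h x) (h y) (h z) (h w) = qsep x y z w.
  by rewrite -(h0K x) -(h0K y) -(h0K z) -(h0K w) !hE -!am_dataE ab.
by have [f fE] := qsep_emb h_inj hq; exists f => u; rewrite -hE fE.
Qed.

Lemma am_data_iso a b : am_data a = am_data b -> amalg_iso a b.
Proof.
move=> ab; have [h hE] := am_data_emb ab; have [h' h'E] := am_data_emb (esym ab).
exists h; split; last 2 first.
- by move=> y; apply: (hE (inl y)).
- by move=> y; apply: (hE (inr y)).
exists h' => z; have [u <-] := am_map_surj z; by rewrite ?hE ?h'E ?hE.
Qed.

Definition inY (u : glued) : option Y := if u is inl y then Some y else None.
Definition inX' (u : glued) : option X' :=
  match u with inl y => omap k [pick x | i x == y] | inr x => Some x end.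

Definition am_base : {set glued} := [set inl (i x) | x : X].
(** The right-hand piece together with the left-hand copy of [X] serves as the base, to
    which the points of [Y] outside [X] are added. *)
Definition am_right : {set glued} := [set u | isSome (inX' u)].
Definition am_new : seq glued := [seq inl y | y <- enum (~: (i @: [set: X]))].
Definition am_tables : {set table glued} :=
  amalgams am_base am_right (popt inY (@qsep Y)) (popt inX' (@qsep X')) am_new.

Lemma inX'P u x' : inX' u = Some x' -> u = inr x' \/ exists x, u = inl (i x) /\ x' = k x.
Proof.
case: u => [y|x] /=; last by case=> ->; left.
by case: pickP => //= x /eqP <- [<-]; right; exists x.
Qed.

Lemma inX'_i x : inX' (inl (i x)) = Some (k x).
Proof.
rewrite /=; case: pickP => [x1 /eqP/(@emb_inj _ _ i)-> //|/(_ x)]; by rewrite eqxx.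
Qed.

Lemma am_base_sub : am_base \subset am_right.
Proof. by apply/subsetP=> _ /imsetP[x _ ->]; rewrite inE inX'_i. Qed.

Lemma am_base_new : am_base :|: [set u in am_new] = [set inl y | y : Y].
Proof.
apply/setP=> u; rewrite !inE; apply/orP/imsetP => [[/imsetP[x _ ->]|/mapP[y _ ->]]|[y _ ->]].
- by exists (i x).
- by exists y.
have [/imsetP[x _ ->]|yN] := boolP (y \in i @: [set: X]); [left|right].
  by apply/imsetP; exists x.
by apply/mapP; exists y; rewrite // mem_enum inE.
Qed.

Lemma am_right_new : am_right :|: [set u in am_new] = [set: glued].
Proof.
apply/setP=> u; rewrite in_setT; case: u => [y|x]; last by rewrite !inE.
have : inl y \in am_base :|: [set u in am_new] by rewrite am_base_new imset_f.
by case/setUP=> [/(subsetP am_base_sub) h|h]; apply/setUP; [left|right].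
Qed.

Lemma am_map_right a u x' : inX' u = Some x' -> am_map a u = am2 a x'.
Proof. by case/inX'P=> [->//|[x [-> ->]]] /=; apply: am_comm. Qed.

Lemma am_data_tables a : am_data a \in am_tables.
Proof.
apply/mem_amalgams; rewrite am_right_new am_base_new; split.
- exact: am_data_separation.
- move=> x y z w; rewrite !inE am_dataE /popt.
  case Ex: (inX' x) => [x'|//]; case Ey: (inX' y) => [y'|//] _ _.
  case Ez: (inX' z) => [z'|//]; case Ew: (inX' w) => [w'|//] _ _.
  rewrite (am_map_right a Ex) (am_map_right a Ey) (am_map_right a Ez) (am_map_right a Ew).
  exact: emb_qsep.
- move=> _ _ _ _ /imsetP[x _ ->] /imsetP[y _ ->] /imsetP[z _ ->] /imsetP[w _ ->].
  by rewrite am_dataE /popt /= emb_qsep.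
Qed.

(** A relation on the disjoint union becomes a tree structure on its classes of
    coinciding points. *)
Lemma am_tables_data Q : Q \in am_tables -> exists a : amalgamation i k, am_data a = Q.
Proof.
move=> /mem_amalgams; rewrite am_right_new am_base_new => -[QP QX' QY].
pose Z := class_str QP; pose p (u : glued) : Z := class_of QP u.
have pE x y z w : qsep (p x) (p y) (p z) (p w) = ap Q x y z w.
  exact: etrans (qsep_sep_str _ _ _ _) (class_sepE QP x y z w).
have p_eq u v : same (ap Q) u v -> p u = p v.
  by move=> uv; apply: val_inj; apply: (class_repr_eq QP).
have inlQ x y z w : ap Q (inl x) (inl y) (inl z) (inl w) = qsep x y z w.
  by rewrite QY ?imset_f.
have inrQ x y z w : ap Q (inr x) (inr y) (inr z) (inr w) = qsep x y z w.
  by rewrite QX' ?inE.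
have f1_inj : injective (fun y : Y => p (inl y)).
  by move=> y y' /eqP; rewrite -qsep_same /same pE inlQ -/(same _ _ _) qsep_same => /eqP.
have f2_inj : injective (fun x : X' => p (inr x)).
  by move=> y y' /eqP; rewrite -qsep_same /same pE inrQ -/(same _ _ _) qsep_same => /eqP.
have [f1 f1E] : exists f : embedding Y Z, emb_fun f = fun y : Y => p (inl y).
  by apply: (qsep_emb f1_inj) => x y z w; rewrite pE inlQ.
have [f2 f2E] : exists f : embedding X' Z, emb_fun f = fun x : X' => p (inr x).
  by apply: (qsep_emb f2_inj) => x y z w; rewrite pE inrQ.
have comm x : emb_comp (rank_emb Z) f1 (i x) = emb_comp (rank_emb Z) f2 (k x).
  rewrite /= f1E f2E; apply: (congr1 (@rank_fun Z)); apply: p_eq.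
  rewrite /same QX' ?inE ?inX'_i // /popt inX'_i /=.
  by rewrite -[~~ _]/(same (@qsep X') (k x) (k x)) qsep_same.
have surj (z : skel_of Z) : (exists y, emb_comp (rank_emb Z) f1 y = z) \/
    (exists y, emb_comp (rank_emb Z) f2 y = z).
  pose c : Z := enum_val z; have zE : z = rank_emb Z c by rewrite /= /rank_fun enum_valK.
  have cE : c = p (val c) by apply/esym/class_of_surj.
  case vE: (val c) cE => [y|x] cE; [left; exists y|right; exists x].
    by rewrite zE cE /= f1E.
  by rewrite zE cE /= f2E.
pose am := @Amalgamation X Y X' i k (skel_of Z) _ _ comm surj.
exists am; apply/ffunP=> -[[[x y] z] w].
rewrite -/(ap _ x y z w) -/(ap Q x y z w) am_dataE -pE.
have mE u : am_map am u = rank_emb Z (p u) by case: u => v; rewrite /= ?f1E ?f2E.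
by rewrite !mE emb_qsep.
Qed.

End AmalgamationData.

(** * The weight of an embedding *)

Section EmbeddingWeight.
Variables (A : comPzRingType) (t : nat -> nat -> A).

(** Points in the image are realized and contribute the factor 1. *)
Definition emb_weight (X Y : treeStr) (i : embedding X Y) : A :=
  chain_weight t (@qsep Y) (i @: [set: X]) (enum Y).

Hypothesis tm : type_measure t.

Lemma emb_weight_chain (X Y : treeStr) (i : embedding X Y) (l : seq Y) :
  (i @: [set: X]) :|: [set y in l] = [set: Y] ->
  emb_weight i = chain_weight t (@qsep Y) (i @: [set: X]) l.
Proof.
move=> lE; apply: (chain_weight_ext tm (qsep_separation Y)); rewrite ?subsetT //.
- by move=> y _; rewrite in_setT.
- by move=> y _; rewrite in_setT.
by rewrite lE; apply/setP=> y; rewrite !inE mem_enum orbT.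
Qed.

Lemma emb_weight_iso (X Y : treeStr) (i : embedding X Y) : bijective i -> emb_weight i = 1%R.
Proof.
case=> j ij ji; rewrite (@emb_weight_chain _ _ _ [::]) //.
apply/setP=> y; rewrite !inE orbF; apply/imsetP; exists (j y) => //.
Qed.

Lemma emb_weight_comp (X Y Z : treeStr) (j : embedding Y Z) (i : embedding X Y) :
  emb_weight (emb_comp j i) = (emb_weight j * emb_weight i)%R.
Proof.
rewrite (@emb_weight_chain _ _ _ (map j (enum Y) ++ enum Z)); last first.
  by apply/setP=> z; rewrite !inE mem_cat mem_enum !orbT.
rewrite chain_weight_cat mulrC; congr (_ * _)%R.
  congr chain_weight; apply/setP=> z; rewrite !inE; apply/orP/imsetP => [[/imsetP[x _ ->]|/mapP[y _ ->]]|[y _ ->]].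
  - by exists (i x).
  - by exists y.
  - by right; apply: map_f; rewrite mem_enum.
rewrite [RHS](chain_weight_map t (qsep_separation Z) (f := j)).
- by rewrite -imset_comp.
- by move=> y _; rewrite in_setT.
by move=> x y z _ _ _ w _; rewrite emb_qsep.
Qed.

(** This is the sum over all amalgams of [sum_amalgams], transported to [am_data]. *)
Lemma emb_weight_amalg (X Y X' : skel) (i : embedding X Y) (k : embedding X X')
    (n : nat) (s : 'I_n -> amalgamation i k) :
  (forall a : amalgamation i k, exists! t, amalg_iso (s t) a) ->
  emb_weight i = (\sum_(r < n) emb_weight (am2 (s r)))%R.
Proof.
move=> s_all.
have Q1P : separation (am_base X' i :|: [set u in am_new X' i])
    (cut (am_base X' i :|: [set u in am_new X' i]) (popt (@inY Y X') (@qsep Y))).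
  rewrite am_base_new; have h := separation_popt (@inY Y X') (qsep_separation Y).
  have -> : [set inl y | y : Y] = [set u : glued Y X' | isSome (inY u)].
    apply/setP=> u; rewrite inE; apply/imsetP/idP => [[y _ ->] //|].
    by case: u => //= y _; exists y.
  exact: separation_cut h (subxx _).
have Q2P := separation_popt (inX' i k) (qsep_separation X').
have uniq_new : uniq (am_new X' i) by rewrite map_inj_uniq ?enum_uniq // => x y [].
have new_right : {in am_new X' i, forall u, u \notin am_right i k}.
  move=> u /mapP[y]; rewrite mem_enum inE => yN ->; rewrite inE /=.
  by case: pickP => //= x /eqP iy; rewrite -iy imset_f in yN.
have Q12 : eq_on (am_base X' i) (popt (@inY Y X') (@qsep Y)) (popt (inX' i k) (@qsep X')).
  move=> _ _ _ _ /imsetP[x _ ->] /imsetP[y _ ->] /imsetP[z _ ->] /imsetP[w _ ->].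
  by rewrite /popt !inX'_i /= !emb_qsep.
have := sum_amalgams tm (am_base_sub i k) Q2P Q12 uniq_new new_right Q1P.
rewrite -/(am_tables i k).
have -> : chain_weight t (popt (@inY Y X') (@qsep Y)) (am_base X' i) (am_new X' i) = emb_weight i.
  rewrite (@emb_weight_chain _ _ _ (enum (~: (i @: [set: X])))); last first.
    by apply/setP=> y; rewrite !inE mem_enum inE orbN.
  rewrite (chain_weight_map t (separation_popt (@inY Y X') (qsep_separation Y)) (f := inl)).
  - congr chain_weight; apply/setP=> u.
    apply/imsetP/imsetP => [[x _ ->]|[_ /imsetP[x _ ->] ->]]; last by exists x.
    by exists (i x); rewrite ?imset_f.
  - by move=> y _; rewrite inE.
  - by move=> x y z _ _ _ w _.
move=> <-.
have -> : am_tables i k = [set am_data (s r) | r : 'I_n].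
  apply/setP=> Q; apply/idP/imsetP => [/am_tables_data[a <-]|[r _ ->]]; last exact: am_data_tables.
  have [r [ra _]] := s_all a; exists r => //; exact/esym/am_iso_data.
rewrite big_imset /=; last first.
  move=> r r' _ _ /am_data_iso rr'; have [r0 [_ r0E]] := s_all (s r').
  have -> : r = r0 by apply/esym/r0E.
  by apply: r0E; apply: am_data_iso.
apply: eq_bigr => r _.
rewrite (@emb_weight_chain _ _ _ (map (am_map (s r)) (am_new X' i))); last first.
  apply/setP=> z; rewrite in_setT; have [u <-] := am_map_surj z.
  have : u \in am_right i k :|: [set u in am_new X' i] by rewrite am_right_new in_setT.
  case/setUP; rewrite !inE; last by move=> h; rewrite map_f ?orbT.
  case E: (inX' i k u) => [x'|//] _; apply/orP; left.
  by rewrite (am_map_right (s r) E) imset_f.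
rewrite (chain_weight_map t (qsep_separation (s r)) (f := am_map (s r))).
- congr chain_weight; apply/setP=> z; apply/imsetP/imsetP => [[u]|[x _ ->]].
    rewrite inE; case E: (inX' i k u) => [x'|//] _ ->; exists x' => //.
    exact: am_map_right.
  by exists (inr x); rewrite ?inE.
- by move=> u _; rewrite in_setT.
- by move=> x y z _ _ _ w _; rewrite am_dataE.
Qed.

End EmbeddingWeight.

(** * Morphisms out of presented commutative rings *)

Local Open Scope ring_scope.

Definition mono (G : choiceType) (m : {cmonom G}) : freeComRing G := << m >>.

Section FreeComRing.
Variables (G : choiceType) (A : comPzRingType).

Lemma monoM (m1 m2 : {cmonom G}) : mono m1 * mono m2 = mono (mmul m1 m2).
Proof. by rewrite /mono malgM_def fgmulUU mulr1. Qed.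

Lemma mono1 : mono (@mone {cmonom G}) = 1. Proof. by []. Qed.

Lemma mono_coef (c : int) (m : {cmonom G}) : (<< c *g m >> : {malg int[{cmonom G}]}) = mono m *~ c.
Proof.
apply/malgP=> k; rewrite raddfMz mcoeffU.
transitivity ((1 *+ (m == k) : int) *~ c); last by congr (_ *~ c); apply/esym/mcoeffU.
by case: (m == k); rewrite ?mulr1n ?mulr0n ?mul0rz // intz.
Qed.

Lemma mono_sum (x : freeComRing G) :
  x = \sum_(m <- msupp (x : {malg int[{cmonom G}]})) mono m *~ mcoeff m x.
Proof. by rewrite {1}[x]monalgE; apply: eq_bigr => m _; rewrite mono_coef. Qed.

Lemma mono_split (m : {cmonom G}) : m != (@mone {cmonom G}) ->
  exists (g : G) (m' : {cmonom G}), m = (mmul (ucm g) m') /\ (mdeg m' < mdeg m)%N.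
Proof.
move=> m1; have [g gm] : exists g, (0 < m g)%N.
  apply: contrapT => Nex; case/eqP: m1; apply/eqP/cmP => g; rewrite cm1.
  by apply/eqP; rewrite -leqn0 leqNgt; apply/negP => h; apply: Nex; exists g.
exists g, (divcm m (ucm g)).
have E : m = (mmul (ucm g) (divcm m (ucm g))).
  apply/eqP/cmP => j; rewrite cmM divcmE ucmE.
  by case: eqVneq => [<-|_]; rewrite ?subn0 // addnC subnK.
split=> //; rewrite {2}E mdegM.
suff -> : mdeg (ucm g) = 1%N by rewrite add1n.
exact: mdegU.
Qed.

Lemma free_ext (phi psi : {rmorphism freeComRing G -> A}) :
  (forall g, phi (var g) = psi (var g)) -> phi =1 psi.
Proof.
move=> pv; have mon m : phi (mono m) = psi (mono m).
  have [n] := ubnP (mdeg m); elim: n m => // n IH m; rewrite ltnS => mn.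
  have [->|/mono_split[g [m' [mE lt]]]] := eqVneq m (@mone {cmonom G}).
    by rewrite mono1 !rmorph1.
  have h (th : {rmorphism freeComRing G -> A}) : th (mono m) = th (var g) * th (mono m').
    by rewrite mE -(monoM (ucm g) m'); apply: rmorphM.
  apply: etrans (h phi) (etrans _ (esym (h psi))).
  exact: (congr2 _ (pv g) (IH m' (leq_trans lt mn))).
move=> x; rewrite (mono_sum x) (raddf_sum phi) (raddf_sum psi).
apply: eq_bigr => m _; apply: etrans (raddfMz phi _ _) (etrans _ (esym (raddfMz psi _ _))).
exact: (congr1 (fun a => a *~ _) (mon m)).
Qed.

Variable f : G -> A.

Definition meval (m : {cmonom G}) : A := \prod_(g <- finsupp m) f g ^+ m g.

Lemma mevalEw (d : {fset G}%fset) (m : {cmonom G}) : (finsupp m `<=` d)%fset ->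
  meval m = \prod_(g <- d) f g ^+ m g.
Proof.
move=> sub; rewrite /meval (big_fset_incl _ sub) // => g _.
by rewrite -cmE_eq0 => /eqP->.
Qed.

Lemma mevalM m1 m2 : meval (mmul m1 m2) = meval m1 * meval m2.
Proof.
rewrite (mevalEw (fsubsetUl (finsupp m1) (finsupp m2))).
rewrite (mevalEw (fsubsetUr (finsupp m1) (finsupp m2))) -big_split /=.
rewrite /meval mdomD.
by apply: eq_bigr => g _; rewrite cmM exprD.
Qed.

Lemma meval1 : meval (@mone {cmonom G}) = 1.
Proof. by rewrite /meval mdom1 big_seq_fset0. Qed.

Lemma mevalU g : meval (ucm g) = f g.
Proof.
by rewrite /meval mdomU big_seq_fset1 cmUU expr1.
Qed.

Definition free_eval (x : freeComRing G) : A :=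
  \sum_(m <- msupp (x : {malg int[{cmonom G}]})) meval m *~ mcoeff m x.

Lemma free_evalEw (d : {fset {cmonom G}}%fset) (x : freeComRing G) :
  (msupp (x : {malg int[{cmonom G}]}) `<=` d)%fset ->
  free_eval x = \sum_(m <- d) meval m *~ mcoeff m x.
Proof.
move=> sub; rewrite /free_eval (big_fset_incl _ sub) // => m _ /mcoeff_outdom ->.
by rewrite mulr0z.
Qed.

Lemma free_eval_zmod : zmod_morphism free_eval.
Proof.
move=> x y; set d := (msupp (x : {malg int[{cmonom G}]}) `|` msupp (y : {malg int[{cmonom G}]}))%fset.
rewrite (free_evalEw (msuppB_le x y)) (free_evalEw (fsubsetUl _ _ : (_ `<=` d)%fset)).
rewrite (free_evalEw (fsubsetUr _ _ : (_ `<=` d)%fset)) -sumrB.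
by apply: eq_bigr => m _; rewrite mcoeffB mulrzBr.
Qed.

Lemma free_eval_mono c m : free_eval (<< c *g m >> : {malg int[{cmonom G}]}) = meval m *~ c.
Proof.
by rewrite (free_evalEw (msuppU_le : (_ `<=` [fset m])%fset)) big_seq_fset1 mcoeffUU.
Qed.

HB.instance Definition _ := GRing.isZmodMorphism.Build (freeComRing G) A free_eval free_eval_zmod.

Lemma free_eval_monoid : monoid_morphism free_eval.
Proof.
split=> [|x y]; first by rewrite -mono1 free_eval_mono meval1.
rewrite (malgME (x : {malg int[{cmonom G}]})) raddf_sum /free_eval mulr_suml.
apply: eq_bigr => m1 _; rewrite raddf_sum mulr_sumr.
apply: eq_bigr => m2 _; rewrite /= free_eval_mono mevalM.
by rewrite mulrzAl mulrzAr -mulrzA (mulrC (mcoeff m2 y)).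
Qed.

HB.instance Definition _ := GRing.isMonoidMorphism.Build (freeComRing G) A free_eval free_eval_monoid.

Lemma free_eval_var g : free_eval (var g) = f g.
Proof. by rewrite free_eval_mono mevalU. Qed.

End FreeComRing.

Section QuotientMorphism.
Variables (R : comNzRingType) (S : R -> Prop) (A : comPzRingType).

Lemma proj_gen x : S x -> proj S x = 0.
Proof.
by move=> Sx; rewrite -(raddf0 (proj S)); apply/projP; rewrite subr0; apply: gen_ideal_gen.
Qed.

Variable (phi : {rmorphism R -> A}).
Hypothesis phiS : forall x, S x -> phi x = 0.

Lemma gen_ideal_ker x : gen_ideal S x -> phi x = 0.
Proof.
elim=> {x} [x /phiS //||x y _ hx _ hy|a x _ hx]; first exact: rmorph0.
  by rewrite rmorphD hx hy addr0.
by rewrite rmorphM hx mulr0.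
Qed.

(** The proof that [phi] kills the relations is an argument, so that the morphism
    structure can be attached to the map. *)
Definition quot_map of (forall x, S x -> phi x = 0) : ideal_quotient S -> A :=
  fun x => phi (proj_repr x).

Lemma quot_map_proj x : quot_map phiS (proj S x) = phi x.
Proof.
apply/eqP; rewrite -subr_eq0 -rmorphB; apply/eqP/gen_ideal_ker.
by apply/projP; rewrite proj_reprK.
Qed.

Lemma quot_map_zmod : zmod_morphism (quot_map phiS).
Proof.
move=> x y; have [a <-] := proj_surj x; have [b <-] := proj_surj y.
by rewrite -rmorphB !quot_map_proj rmorphB.
Qed.

Lemma quot_map_monoid : monoid_morphism (quot_map phiS).
Proof.
split=> [|x y]; first by rewrite -(rmorph1 (proj S)) quot_map_proj rmorph1.
have [a <-] := proj_surj x; have [b <-] := proj_surj y.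
by rewrite -rmorphM !quot_map_proj rmorphM.
Qed.

HB.instance Definition _ := GRing.isZmodMorphism.Build (ideal_quotient S) A (quot_map phiS) quot_map_zmod.
HB.instance Definition _ := GRing.isMonoidMorphism.Build (ideal_quotient S) A (quot_map phiS) quot_map_monoid.

End QuotientMorphism.

Lemma free_quot_ext (G : choiceType) (S : freeComRing G -> Prop) (A : comPzRingType)
    (phi psi : {rmorphism ideal_quotient S -> A}) :
  (forall g, phi (proj S (var g)) = psi (proj S (var g))) -> phi =1 psi.
Proof.
move=> h x; have [a <-] := proj_surj x.
exact: (free_ext (phi := phi \o proj S) (psi := psi \o proj S) h a).
Qed.

(** * The measures on types *)

(** The only measures on types: [y] is the value for a cherry with two classes, one of
    them a singleton, and [z] the value for two classes without singletons. *)
Definition type_value (A : comPzRingType) (y z : A) (k s : nat) : A :=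
  match k with
  | 0 => y + (y - z) + 2
  | 1 => y + (y - z) + 1
  | 2 => z + (y - z) *+ s
  | n.+1 => y - z + 1 - n%:R * (y + 1)
  end.

Lemma type_value_measure (A : comPzRingType) (y z : A) :
  y * y = y * z -> type_measure (type_value y z).
Proof.
move=> yz; split; last by rewrite /= mulr1n addrC subrK mulr0n addr0.
case=> [|[|[|k]]] s s2 /=; rewrite ?mulr1n ?mulr0n ?mulr2n; try by ring.
by case: s s2 => [|[|[|s]]] // _ /=; rewrite ?subSS ?subn0; ring.
Qed.

(** The conditions [tm_step] for [k = 2] with [s = 0] and [s = 2] give [t 3 0] and
    [t 2 2]; those for larger [k] go upwards from there, those for [k = 1] and [k = 0]
    downwards. *)
Lemma type_measure_value (A : comPzRingType) (t : nat -> nat -> A) k s :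
  type_measure t -> (s <= 2)%N ->
  t k (if k == 2 then s else 0%N) = type_value (t 2 1%N) (t 2 0%N) k s.
Proof.
case=> step _; set y := t 2 1%N; set z := t 2 0%N => s2.
have h0 : z = 1 + y + t 3 0%N + y *+ 0 + z *+ 2 := step 2 0%N isT.
have h2 : t 2 2 = 1 + y + t 3 0%N + y *+ 2 + z *+ 0 := step 2 2 isT.
have e3 : t 3 0%N = - y - z - 1.
  have -> : t 3 0%N = (1 + y + t 3 0%N + y *+ 0 + z *+ 2) - z *+ 2 - 1 - y by ring.
  by rewrite -h0; ring.
have e2 : t 2 2 = y + (y - z) by rewrite h2 e3; ring.
have e1 : t 1 0%N = y + (y - z) + 1 by rewrite (step 1 0%N isT) /= e2; ring.
case: k => [|[|[|k]]] //=.
- by rewrite (step 0 0%N isT) /= e1; ring.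
- case: s s2 => [|[|[|]]] // _; rewrite -/y -/z ?e2; ring.
elim: k => [|k IH]; first by rewrite e3; ring.
have : t k.+3 0%N = 1 + y + t k.+4 0%N := step k.+3 0%N isT.
move=> h; have -> : t k.+4 0%N = t k.+3 0%N - 1 - y by rewrite h addrC; ring.
by rewrite IH -[in RHS]natr1; ring.
Qed.

(** * Classes of embeddings *)

Lemma embedding_ext (X Y : treeStr) (i j : embedding X Y) : i =1 j -> i = j.
Proof.
case: i j => [f fi fr] [g gi gr] /= /funext fg; subst g.
by rewrite (Prop_irrelevance fi gi) (Prop_irrelevance fr gr).
Qed.

Section SkelClass.
Implicit Types X Y Z : skel.

(** The class of an embedding between structures carried by ordinals; on these it agrees
    with [cls], which first transports an embedding to such structures. *)
Definition scls X Y (i : embedding X Y) : Theta := proj Theta_rel (sym i).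

Lemma scls_iso X Y (i : embedding X Y) : bijective i -> scls i = 1.
Proof.
move=> bi; apply/eqP; rewrite -subr_eq0 -[X in _ - X](rmorph1 (proj Theta_rel)) -rmorphB.
by apply/eqP/proj_gen/Theta_iso.
Qed.

Lemma scls_comp X Y Z (j : embedding Y Z) (i : embedding X Y) :
  scls (emb_comp j i) = scls j * scls i.
Proof.
apply/eqP; rewrite -subr_eq0 -rmorphM -rmorphB.
by apply/eqP/proj_gen/Theta_comp.
Qed.

Lemma scls_amalg X Y X' (i : embedding X Y) (k : embedding X X') n
    (s : 'I_n -> amalgamation i k) :
  (forall a, exists! t, amalg_iso (s t) a) -> scls i = \sum_(t < n) scls (am2 (s t)).
Proof.
move=> sP; apply/eqP; rewrite -subr_eq0 -rmorph_sum -rmorphB.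
by apply/eqP/proj_gen/Theta_amalg.
Qed.

Lemma scls_square X Y X1 Y1 (i : embedding X Y) (j : embedding X1 Y1)
    (g : embedding X X1) (h : embedding Y Y1) :
  bijective g -> bijective h -> (forall x, h (i x) = j (g x)) -> scls i = scls j.
Proof.
move=> bg bh E; have : emb_comp h i = emb_comp j g by apply: embedding_ext.
move/(congr1 (@scls _ _)); rewrite !scls_comp (scls_iso bg) (scls_iso bh).
by move=> e; apply: etrans (esym (mul1r _)) (etrans e (mulr1 _)).
Qed.

Variables (X Y X' : skel) (i : embedding X Y) (k : embedding X X').
Variables (T : finType) (L : {set T}) (d : amalgamation i k -> T).
Hypothesis dL : forall a, d a \in L.
Hypothesis dsurj : forall Q, Q \in L -> exists a, d a = Q.
Hypothesis dinj : forall a b, d a = d b -> amalg_iso a b.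
Hypothesis dwell : forall a b, amalg_iso a b -> d a = d b.

(** Amalgamations may be indexed by the values of any complete invariant. *)
Lemma scls_sum (F : T -> Theta) :
  (forall a, scls (am2 a) = F (d a)) -> scls i = \sum_(Q in L) F Q.
Proof.
move=> FE; pose s (r : 'I_#|L|) := projT1 (cid (dsurj (enum_valP r))).
have sE r : d (s r) = enum_val r by rewrite /s; case: cid.
rewrite (@scls_amalg _ _ _ _ _ _ s) => [|a].
  rewrite (big_enum_val F) /=.
  by apply: eq_bigr => r _; rewrite FE sE.
exists (enum_rank_in (dL a) (d a)); split=> [|r /dwell]; last first.
  by rewrite sE => sra; rewrite -[RHS](enum_valK_in (dL a)) sra.
by apply: dinj; rewrite sE enum_rankK_in.
Qed.

End SkelClass.

Lemma skel_emb_comp (X Y Z : treeStr) (j : embedding Y Z) (i : embedding X Y) :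
  skel_emb (emb_comp j i) = emb_comp (skel_emb j) (skel_emb i).
Proof. by apply: embedding_ext => x; rewrite /= /skel_fun /= enum_rankK. Qed.

Lemma skel_emb_bij (X Y : treeStr) (i : embedding X Y) : bijective i -> bijective (skel_emb i).
Proof.
case=> g ig gi; exists (fun y => enum_rank (g (enum_val y))) => x; rewrite /= /skel_fun.
  by rewrite enum_rankK ig enum_valK.
by rewrite enum_rankK gi enum_valK.
Qed.

Lemma cls_scls (X Y : skel) (i : embedding X Y) : cls i = scls i.
Proof.
apply/esym; apply: (@scls_square _ _ _ _ _ _ (rank_emb X) (rank_emb Y)); try exact: rank_bij.
by move=> x; rewrite /= /rank_fun /= /skel_fun enum_rankK.
Qed.

Lemma cls_iso (X Y : treeStr) (i : embedding X Y) : bijective i -> cls i = 1.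
Proof. by move=> /skel_emb_bij/scls_iso. Qed.

Lemma cls_comp (X Y Z : treeStr) (j : embedding Y Z) (i : embedding X Y) :
  cls (emb_comp j i) = cls j * cls i.
Proof. by rewrite {1}/cls skel_emb_comp; apply: scls_comp. Qed.

Lemma cls_square (X Y X1 Y1 : treeStr) (i : embedding X Y) (j : embedding X1 Y1)
    (g : embedding X X1) (h : embedding Y Y1) :
  bijective g -> bijective h -> (forall x, h (i x) = j (g x)) -> cls i = cls j.
Proof.
move=> bg bh E; have : emb_comp h i = emb_comp j g by apply: embedding_ext.
move/(congr1 (@cls _ _)); rewrite !cls_comp (cls_iso bg) (cls_iso bh).
by move=> e; apply: etrans (esym (mul1r _)) (etrans e (mulr1 _)).
Qed.

(** * Amalgams of two one-point extensions *)

Local Close Scope ring_scope.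

Section OnePointPair.
Variables (X Y X' : skel) (i : embedding X Y) (k : embedding X X') (y0 : Y) (x0 : X').
Hypotheses (iE : i @: [set: X] = ~: [set y0]) (kE : k @: [set: X] = ~: [set x0]).

Let W : finType := option Y.
Let S : {set W} := [set Some (i x) | x : X].
Let a : W := Some y0.
Let b : W := None.

Definition to_right (u : W) : option X' :=
  if u is Some y then omap k [pick x | i x == y] else Some x0.

(** The amalgams of [Y = X + y0] and [X' = X + x0] live on the set [option Y], where
    [None] stands for [x0]; they are the lifts of the two relations below. *)
Definition pair_left := popt (fun u : W => u) (@qsep Y).
Definition pair_right := popt to_right (@qsep X').
Lemma to_right_i x : to_right (Some (i x)) = Some (k x).
Proof.
rewrite /=; case: pickP => [x' /eqP/(@emb_inj _ _ i)->//|/(_ x)].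
by rewrite eqxx.
Qed.

Lemma i_cover y : y != y0 -> exists x, i x = y.
Proof.
move=> yy0; have : y \in i @: [set: X] by rewrite iE !inE.
by case/imsetP=> x _ ->; exists x.
Qed.

Lemma i_miss x : i x != y0.
Proof. by have : i x \in ~: [set y0] by [rewrite -iE imset_f]; rewrite !inE. Qed.

Lemma k_cover x' : x' != x0 -> exists x, k x = x'.
Proof.
move=> xx0; have : x' \in k @: [set: X] by rewrite kE !inE.
by case/imsetP=> x _ ->; exists x.
Qed.

Lemma k_miss x : k x != x0.
Proof. by have : k x \in ~: [set x0] by [rewrite -kE imset_f]; rewrite !inE. Qed.

Lemma pair_left_set : a |: S = [set u : W | isSome u].
Proof.
apply/setP=> u; rewrite !inE; apply/orP/idP => [[/eqP->//|/imsetP[x _ ->]//]|].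
case: u => // y _; have [->|/i_cover[x <-]] := eqVneq y y0; first by left.
by right; apply: imset_f.
Qed.

Lemma pair_right_set : b |: S = [set u : W | isSome (to_right u)].
Proof.
apply/setP=> u; rewrite !inE; apply/orP/idP => [[/eqP->//|/imsetP[x _ ->]]|].
  by rewrite to_right_i.
case: u => [y|_]; last by left.
rewrite /=; case: pickP => //= x /eqP <- _; right; exact: imset_f.
Qed.

Lemma pair_all : a |: (b |: S) = [set: W].
Proof.
rewrite setUCA pair_left_set; apply/setP=> -[y|]; by rewrite !inE.
Qed.

Lemma pair_left_sep : separation (a |: S) pair_left.
Proof. by rewrite pair_left_set; apply: separation_popt (qsep_separation Y). Qed.

Lemma pair_right_sep : separation (b |: S) pair_right.
Proof. by rewrite pair_right_set; apply: separation_popt (qsep_separation X'). Qed.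

Lemma pair_agree : eq_on S pair_left pair_right.
Proof.
move=> _ _ _ _ /imsetP[x _ ->] /imsetP[y _ ->] /imsetP[z _ ->] /imsetP[w _ ->].
by rewrite /pair_left /pair_right /popt !to_right_i !emb_qsep.
Qed.

Lemma pair_aS : a \notin S.
Proof. by apply/imsetP => -[x _ [E]]; have := i_miss x; rewrite -E eqxx. Qed.

Lemma pair_bS : b \notin S.
Proof. by apply/imsetP => -[]. Qed.

Lemma pair_ab : a != b. Proof. by []. Qed.

Definition pair_lifts := lifts S a b pair_left pair_right.

Definition pair_map (am : amalgamation i k) (u : W) : am :=
  if u is Some y then am1 am y else am2 am x0.

Definition pair_data (am : amalgamation i k) : table W :=
  tab (fun x y z w => qsep (pair_map am x) (pair_map am y) (pair_map am z) (pair_map am w)).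

Lemma pair_map_right am u x' : to_right u = Some x' -> pair_map am u = am2 am x'.
Proof.
case: u => [y|] /=; last by case=> ->.
by case: pickP => //= x /eqP <- [<-]; apply: am_comm.
Qed.

Lemma pair_data_lifts am : pair_data am \in pair_lifts.
Proof.
apply: tab_lifts; split.
- rewrite pair_all; have := separation_pull (P := [set: W]) (f := pair_map am)
    (qsep_separation am) (fun x _ => in_setT _).
  by apply: separation_ext => x y z w; rewrite cutE // in_setT.
- rewrite pair_left_set => -[x|] [y|] [z|] [w|]; rewrite !inE // => _ _ _ _.
  by rewrite /pair_left /popt /= emb_qsep.
- rewrite pair_right_set => x y z w; rewrite !inE /pair_right /popt.
  case xE: (to_right x) => [x'|//] _; case yE: (to_right y) => [y'|//] _.
  case zE: (to_right z) => [z'|//] _; case wE: (to_right w) => [w'|//] _.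
  by rewrite !(pair_map_right _ xE, pair_map_right _ yE, pair_map_right _ zE, pair_map_right _ wE) emb_qsep.
Qed.

(** The disjoint union maps onto the set [option Y], in which the two copies of [X]
    are identified; [englue] is a section. *)
Definition unglue (u : glued Y X') : W :=
  match u with inl y => Some y | inr x' => omap i [pick x | k x == x'] end.
Definition englue (u : W) : glued Y X' := if u is Some y then inl y else inr x0.

Lemma englueK : cancel englue unglue.
Proof.
case=> //=; case: pickP => //= x /eqP kx; have := k_miss x; by rewrite kx eqxx.
Qed.

Lemma pair_map_englue am u : am_map am (englue u) = pair_map am u.
Proof. by case: u. Qed.

Lemma unglueP u x' : inX' i k u = Some x' -> to_right (unglue u) = Some x'.
Proof.
case/inX'P=> [->|[x [-> ->]]]; last exact: to_right_i.
rewrite /unglue; case: pickP => [x /eqP <-|N]; first exact: to_right_i.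
have [->//|/k_cover[x kx]] := eqVneq x' x0.
by move: (N x); rewrite kx eqxx.
Qed.

Lemma unglue_map am u : pair_map am (unglue u) = am_map am u.
Proof.
case: u => [y //|x']; exact: (pair_map_right am (unglueP (erefl : inX' i k (inr x') = Some x'))).
Qed.

Lemma pair_data_surj Q : Q \in pair_lifts -> exists am, pair_data am = Q.
Proof.
move=> /[dup] QL /mem_lifts[QP Ql Qr]; rewrite pair_all in QP.
pose Q' : table (glued Y X') := tab (fun x y z w => ap Q (unglue x) (unglue y) (unglue z) (unglue w)).
have Q'T : Q' \in am_tables i k.
  apply/mem_amalgams; rewrite am_right_new am_base_new; split.
  - have := separation_pull (P := [set: glued Y X']) (f := unglue) QP (fun x _ => in_setT _).
    by apply: separation_ext => x y z w; rewrite cutE ?in_setT // tabK.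
  - move=> x y z w; rewrite !inE.
    case xE: (inX' i k x) => [x'|//] _; case yE: (inX' i k y) => [y'|//] _.
    case zE: (inX' i k z) => [z'|//] _; case wE: (inX' i k w) => [w'|//] _.
    rewrite tabK Qr ?pair_right_set ?inE ?(unglueP xE, unglueP yE, unglueP zE, unglueP wE) //.
    by rewrite /pair_right /popt !(unglueP xE, unglueP yE, unglueP zE, unglueP wE) xE yE zE wE.
  - move=> _ _ _ _ /imsetP[x _ ->] /imsetP[y _ ->] /imsetP[z _ ->] /imsetP[w _ ->].
    by rewrite tabK Ql ?pair_left_set ?inE.
have [am amE] := am_tables_data Q'T; exists am.
apply/ffunP=> -[[[x y] z] w]; rewrite -/(ap (pair_data am) x y z w) -/(ap Q x y z w).
by rewrite tabK -!pair_map_englue -am_dataE amE tabK !englueK.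
Qed.

Lemma pair_data_iso am am' : pair_data am = pair_data am' -> amalg_iso am am'.
Proof.
move=> E; apply: am_data_iso; apply/ffunP=> -[[[x y] z] w].
rewrite -/(ap (am_data am) x y z w) -/(ap (am_data am') x y z w) !am_dataE -!unglue_map.
have := congr1 (fun Q => ap Q (unglue x) (unglue y) (unglue z) (unglue w)) E.
by rewrite !tabK.
Qed.

Lemma pair_iso_data am am' : amalg_iso am am' -> pair_data am = pair_data am'.
Proof.
move/am_iso_data=> E; apply/ffunP=> -[[[x y] z] w].
rewrite -/(ap (pair_data am) x y z w) -/(ap (pair_data am') x y z w) !tabK.
by rewrite -!pair_map_englue -!am_dataE E.
Qed.

Lemma pair_weight (A : pzSemiRingType) (t : nat -> nat -> A) (am : amalgamation i k) :
  weight t (ap (pair_data am)) (b |: S) a =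
  weight t (@qsep am) (am2 am @: [set: X']) (am1 am y0).
Proof.
have E : pair_map am @: (b |: S) = am2 am @: [set: X'].
  apply/setP=> z; apply/imsetP/imsetP => [[u]|[x' _ ->]].
    rewrite pair_right_set inE; case uE: (to_right u) => [x'|//] _ ->; exists x' => //.
    exact: pair_map_right.
  have [->|/k_cover[x <-]] := eqVneq x' x0; first by exists b; rewrite ?setU11.
  by exists (Some (i x)); rewrite ?setU1r ?imset_f //= am_comm.
rewrite -E (weight_map (P' := [set: am]) (f := pair_map am) (D' := @qsep am)) ?subsetT //.
  exact: qsep_separation.
by move=> *; rewrite tabK.
Qed.

Lemma pair_left_weight (A : pzSemiRingType) (t : nat -> nat -> A) :
  weight t pair_left S a = weight t (@qsep Y) (i @: [set: X]) y0.
Proof.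
have E : Some @: (i @: [set: X]) = S.
  by apply/setP=> u; apply/imsetP/imsetP => [[_ /imsetP[x _ ->] ->]|[x _ ->]];
     [exists x|exists (i x); rewrite ?imset_f].
rewrite -E -(weight_map (D := @qsep Y) (f := Some : Y -> W) pair_left_sep) //.
by rewrite E subsetUr.
Qed.

Lemma pair_left_num : class_num pair_left S a = class_num (@qsep Y) (i @: [set: X]) y0 /\
  lonely_num pair_left S a = lonely_num (@qsep Y) (i @: [set: X]) y0.
Proof.
have E : Some @: (i @: [set: X]) = S.
  by apply/setP=> u; apply/imsetP/imsetP => [[_ /imsetP[x _ ->] ->]|[x _ ->]];
     [exists x|exists (i x); rewrite ?imset_f].
rewrite -E -(class_num_map (D := @qsep Y) (f := Some : Y -> W) pair_left_sep) //.
- by rewrite -(lonely_num_map (D := @qsep Y) (f := Some : Y -> W) pair_left_sep) // E subsetUr.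
- by rewrite E subsetUr.
Qed.

Lemma pair_left_new : ~~ realized pair_left S a.
Proof.
apply/exists_inP => -[_ /imsetP[x _ ->]].
by rewrite /same /pair_left /popt /= -/(same (@qsep Y) _ _) qsep_same eq_sym (negPf (i_miss x)).
Qed.

Lemma pair_right_new : ~~ realized pair_right S b.
Proof.
apply/exists_inP => -[_ /imsetP[x _ ->]].
rewrite /same /pair_right /popt to_right_i /= -/(same (@qsep X') _ _) qsep_same.
by rewrite eq_sym (negPf (k_miss x)).
Qed.

Definition twin_points := forall x y z, qsep y0 (i x) (i y) (i z) = qsep x0 (k x) (k y) (k z).

Lemma pair_twin : twin_points <->
  {in S & &, forall x y z, pair_left a x y z = pair_right b x y z}.
Proof.
split=> [tw _ _ _ /imsetP[x _ ->] /imsetP[y _ ->] /imsetP[z _ ->]|h x y z].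
  by rewrite /pair_left /pair_right /popt !to_right_i /= tw.
have iS u : Some (i u) \in S by apply: imset_f.
have := h _ _ _ (iS x) (iS y) (iS z).
by rewrite /pair_left /pair_right /popt !to_right_i /=.
Qed.

Local Open Scope ring_scope.

Lemma pair_sum (F : table W -> Theta) :
  (forall am : amalgamation i k, scls (am2 am) = F (pair_data am)) ->
  scls i = \sum_(Q in pair_lifts) F Q.
Proof.
apply: scls_sum; [exact: pair_data_lifts|exact: pair_data_surj|exact: pair_data_iso|].
exact: pair_iso_data.
Qed.

(** When the base tells the two new points apart, it forces their relative position,
    so that the relation of [Theta] for this square has a single summand. *)
Lemma pair_unique (am : amalgamation i k) : ~ twin_points -> scls i = scls (am2 am) /\
  forall (A : pzSemiRingType) (t : nat -> nat -> A),
  weight t (@qsep am) (am2 am @: [set: X']) (am1 am y0) =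
  weight t (@qsep Y) (i @: [set: X]) y0.
Proof.
move=> Ntw; have dist : distinguished S a b pair_left pair_right.
  by constructor 3 => /pair_twin.
have [Q LQ wQ] := lifts_distinguished pair_aS pair_bS pair_ab pair_left_sep
  pair_right_sep pair_agree dist.
have QE (am' : amalgamation i k) : pair_data am' = Q.
  by apply/set1P; rewrite -LQ; apply: pair_data_lifts.
split; last by move=> A t; rewrite -pair_weight QE wQ pair_left_weight.
rewrite (@pair_sum (fun _ => scls (am2 am))) => [|am'].
  by rewrite /pair_lifts LQ big_set1.
have [h [bh h1 h2]] := pair_data_iso (etrans (QE am') (esym (QE am))).
apply: (scls_square (g := Embedding (@inj_id _) (fun _ _ _ _ => iff_refl _)) (h := h)) => //.
by exists id.
Qed.

(** The terms of the relation of [Theta] are the amalgams listed in [lifts_same_type]. *)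
Lemma pair_twin_sum (t : nat -> nat -> Theta) : twin_points ->
  (forall am : amalgamation i k, scls (am2 am) =
     weight t (@qsep am) (am2 am @: [set: X']) (am1 am y0)) ->
  scls i = type_step t (class_num (@qsep Y) (i @: [set: X]) y0)
    (lonely_num (@qsep Y) (i @: [set: X]) y0).
Proof.
move=> /pair_twin tw h; have [<- <-] := pair_left_num.
rewrite (@pair_sum (fun Q => weight t (ap Q) (b |: S) a)) => [|am].
  exact: (lifts_same_type pair_aS pair_bS pair_ab pair_left_sep pair_right_sep
    pair_agree tw pair_left_new pair_right_new).
by rewrite h pair_weight.
Qed.

End OnePointPair.

(** * Structures with a marked point *)

Section Puncture.
Variables (Z : treeStr).

Lemma punct_inj (a : Z) : injective (fun x : {x : Z | x != a} => val x).
Proof. exact: val_inj. Qed.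

Definition punct (a : Z) : treeStr := induced (@punct_inj a).
Definition pt (a x : Z) (xa : x != a) : punct a := exist (fun z => z != a) x xa.
Definition drop_emb (a : Z) : embedding (punct a) Z := induced_emb (@punct_inj a).

Lemma drop_image (a : Z) : drop_emb a @: [set: punct a] = ~: [set a].
Proof.
apply/setP=> x; rewrite !inE; apply/imsetP/idP => [[y _ ->]|xa]; first exact: (valP y).
by exists (pt xa).
Qed.

Definition pcls (a : Z) : Theta := cls (drop_emb a).
Definition pweight (A : pzSemiRingType) (t : nat -> nat -> A) (a : Z) : A :=
  weight t (@qsep Z) (~: [set a]) a.

End Puncture.

Lemma skel_weight (A : pzSemiRingType) (t : nat -> nat -> A) (X Y : treeStr)
    (i : embedding X Y) y :
  weight t (@qsep (skel_of Y)) (skel_emb i @: [set: skel_of X]) (rank_emb Y y) =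
  weight t (@qsep Y) (i @: [set: X]) y.
Proof.
have -> : skel_emb i @: [set: skel_of X] = rank_emb Y @: (i @: [set: X]).
  apply/setP=> z; apply/imsetP/imsetP => [[x _ ->]|[_ /imsetP[x _ ->] ->]].
    by exists (i (enum_val x)); rewrite ?imset_f.
  by exists (enum_rank x); rewrite //= /skel_fun enum_rankK.
rewrite [RHS](weight_map (P' := [set: skel_of Y]) (f := rank_emb Y) (D' := @qsep (skel_of Y))) ?subsetT //.
  exact: qsep_separation.
by move=> *; rewrite emb_qsep.
Qed.

Lemma skel_num (X Y : treeStr) (i : embedding X Y) y :
  class_num (@qsep (skel_of Y)) (skel_emb i @: [set: skel_of X]) (rank_emb Y y) =
  class_num (@qsep Y) (i @: [set: X]) y /\
  lonely_num (@qsep (skel_of Y)) (skel_emb i @: [set: skel_of X]) (rank_emb Y y) =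
  lonely_num (@qsep Y) (i @: [set: X]) y.
Proof.
have -> : skel_emb i @: [set: skel_of X] = rank_emb Y @: (i @: [set: X]).
  apply/setP=> z; apply/imsetP/imsetP => [[x _ ->]|[_ /imsetP[x _ ->] ->]].
    by exists (i (enum_val x)); rewrite ?imset_f.
  by exists (enum_rank x); rewrite //= /skel_fun enum_rankK.
have QP := qsep_separation (skel_of Y).
split; apply/esym; [apply: (class_num_map QP)|apply: (lonely_num_map QP)]; rewrite ?subsetT //;
  by move=> *; rewrite emb_qsep.
Qed.

Lemma skel_image (X Y : treeStr) (i : embedding X Y) y :
  i @: [set: X] = ~: [set y] -> skel_emb i @: [set: skel_of X] = ~: [set rank_emb Y y].
Proof.
move=> iE; apply/setP=> z; rewrite !inE; apply/imsetP/idP => [[x _ ->]|zy].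
  rewrite /= /skel_fun /rank_fun (inj_eq enum_rank_inj).
  have : i (enum_val x) \in ~: [set y] by rewrite -iE imset_f.
  by rewrite !inE.
have : enum_val z \in i @: [set: X].
  by rewrite iE !inE; apply: contraNneq zy => <-; rewrite /= /rank_fun enum_valK.
by case/imsetP=> x _ zE; exists (enum_rank x); rewrite //= /skel_fun enum_rankK -zE enum_valK.
Qed.

Section Removable.
Variables (Z : treeStr) (a b : Z).
Hypothesis ba : b != a.

(** The points [a] and [b] have the same type over all the other points. *)
Definition twins := forall x y z, x \in ~: [set a; b] -> y \in ~: [set a; b] ->
  z \in ~: [set a; b] -> qsep a x y z = qsep b x y z.

Lemma rest_neq : a != b. Proof. by rewrite eq_sym. Qed.

Definition rest_point : punct b := pt rest_neq.

Definition rest_map (x : punct rest_point) : punct a :=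
  @pt Z a (val (val x)) (valP x).

Lemma rest_map_inj : injective rest_map.
Proof. by move=> x y /(congr1 val) /= /val_inj/val_inj. Qed.

Definition rest_emb : embedding (punct rest_point) (punct a) :=
  Embedding rest_map_inj (fun _ _ _ _ => iff_refl _).

Definition mark_point : punct a := pt ba.

Lemma rest_image : rest_emb @: [set: punct rest_point] = ~: [set mark_point].
Proof.
apply/setP=> x; rewrite !inE -val_eqE /=; apply/imsetP/idP => [[y _ ->]|xb] /=.
  exact: (valP (val y)).
have xa : pt xb != rest_point by rewrite -val_eqE /=; exact: (valP x).
by exists (pt xa) => //; apply: val_inj.
Qed.

Lemma removable_comm x : skel_emb (drop_emb b) (skel_emb (drop_emb rest_point) x) =
  skel_emb (drop_emb a) (skel_emb rest_emb x).
Proof. by rewrite /= /skel_fun /= !enum_rankK. Qed.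

Lemma removable_surj z : (exists y, skel_emb (drop_emb b) y = z) \/
  (exists y, skel_emb (drop_emb a) y = z).
Proof.
have [E|N] := eqVneq (enum_val z) a; [left|right].
  exists (enum_rank rest_point); rewrite /= /skel_fun enum_rankK /= -E; exact: enum_valK.
by exists (enum_rank (pt N)); rewrite /= /skel_fun enum_rankK /= enum_valK.
Qed.

(** The structure is an amalgam of its restrictions to the complements of [a] and [b]. *)
Definition removable_am := Amalgamation removable_comm removable_surj.

(** Deleting a point [b] that can be told from [a] changes neither the class nor the
    type of [a]: the square formed by the two deletions has a single amalgam. *)
Lemma removable_step : ~ twins -> pcls a = pcls rest_point /\
  forall (A : pzSemiRingType) (t : nat -> nat -> A), pweight t a = pweight t rest_point.
Proof.
move=> Ntw.
have [] := pair_unique (skel_image (drop_image rest_point)) (skel_image rest_image) removable_am.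
  move=> tw; apply: Ntw => x y z; rewrite !inE !negb_or => /andP[xa xb] /andP[ya yb] /andP[za zb].
  have R u (ua : u != a) (ub : u != b) : exists v : skel_of (punct rest_point),
      skel_emb (drop_emb rest_point) v = enum_rank (pt ub) /\
      skel_emb rest_emb v = enum_rank (pt ua).
    have ua' : pt ub != rest_point by rewrite -val_eqE.
    exists (enum_rank (pt ua')); rewrite /= /skel_fun enum_rankK.
    by split=> //; congr enum_rank; apply: val_inj.
  have [x' [x1 x2]] := R x xa xb; have [y' [y1 y2]] := R y ya yb; have [z' [z1 z2]] := R z za zb.
  have := tw x' y' z'; rewrite x1 x2 y1 y2 z1 z2 !(emb_qsep (rank_emb _)).
  by rewrite -[qsep (_ : punct b) _ _ _](emb_qsep (drop_emb b)) -[qsep (_ : punct a) _ _ _](emb_qsep (drop_emb a)).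
move=> ce we; split; first exact: esym ce.
move=> A t; have := we A t.
have -> : am1 removable_am (rank_emb (punct b) rest_point) = rank_emb Z a.
  by rewrite /= /skel_fun enum_rankK.
by rewrite [am2 _]/= !skel_weight !drop_image.
Qed.

End Removable.

Lemma pcls_iso (Z Z' : treeStr) (h : embedding Z Z') a : bijective h ->
  pcls a = pcls (h a) /\
  forall (A : pzSemiRingType) (t : nat -> nat -> A), pweight t a = pweight t (h a).
Proof.
move=> bh; have hn (x : punct a) : h (val x) != h a by rewrite (inj_eq (@emb_inj _ _ h)) (valP x).
pose g (x : punct a) : punct (h a) := pt (hn x).
have gi : injective g by move=> x y /(congr1 val)/(@emb_inj _ _ h)/val_inj.
pose ge : embedding (punct a) (punct (h a)) :=
  Embedding gi (fun x1 x2 y1 y2 => emb_rel h (val x1) (val x2) (val y1) (val y2)).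
have ih : h @: (~: [set a]) = ~: [set h a].
  have [h' hK h'K] := bh; apply/setP=> z; rewrite !inE; apply/imsetP/idP => [[x xa ->]|za].
    by move: xa; rewrite !inE (inj_eq (@emb_inj _ _ h)).
  by exists (h' z); rewrite ?h'K // !inE; apply: contraNneq za => <-; rewrite h'K.
split.
  apply: (cls_square (g := ge) (h := h)) => //.
  have [h' hK h'K] := bh.
  have hn' (x : punct (h a)) : h' (val x) != a.
    by apply/eqP => /(congr1 h); rewrite h'K; apply/eqP; exact: (valP x).
  by exists (fun x => pt (hn' x)) => x; apply: val_inj; rewrite /= ?hK ?h'K.
move=> A t; rewrite /pweight -ih (weight_map (P' := [set: Z']) (f := h) (D' := @qsep Z')) ?subsetT //.
  exact: qsep_separation.
by move=> *; rewrite emb_qsep.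
Qed.

Definition mark (T : markedTree) : leafStr (mt_tree T) := exist _ (mt_mark T) (mt_leaf T).

Lemma marked_pcls (T : markedTree) : marked_cls T = pcls (mark T).
Proof.
have h1 (x : induced (@unmarked_inj T)) : unmarked_incl x != mark T.
  by rewrite -val_eqE; exact: (valP x).
pose g (x : induced (@unmarked_inj T)) : punct (mark T) := pt (h1 x).
have gi : injective g.
  by move=> x y gxy; apply: (@unmarked_inj T); exact: (congr1 val gxy).
pose ge : embedding (induced (@unmarked_inj T)) (punct (mark T)) :=
  Embedding gi (fun _ _ _ _ => iff_refl _).
pose he : embedding (leafStr (mt_tree T)) (leafStr (mt_tree T)) :=
  Embedding (@inj_id _) (fun _ _ _ _ => iff_refl _).
have bh : bijective he by exists id.
have bg : bijective ge.
  have h2 (x : punct (mark T)) : val (val x) != mt_mark T by have := valP x; rewrite -val_eqE.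
  pose g' (x : punct (mark T)) : induced (@unmarked_inj T) :=
    exist (fun x : leafStr (mt_tree T) => val x != mt_mark T) (val x) (h2 x).
  by exists g' => x; apply: val_inj.
rewrite /marked_cls /pcls; exact: (cls_square bg bh).
Qed.

(** * Caterpillars *)

(** All the trees that have to be computed with are caterpillars. In a caterpillar the
    leaves have levels along the spine, and a split puts the low ones on one side. The
    tree structure is then given by a list of levels. *)
Definition below (T : Type) (f : T -> nat) (x y z w : T) : bool :=
  [&& f x < f z, f x < f w, f y < f z & f y < f w].
Definition split_by (T : Type) (f : T -> nat) (x y z w : T) : bool :=
  below f x y z w || below f z w x y.

Definition level (n : nat) (L : seq nat) (i : 'I_n) : nat := nth 0 L i.

Definition modelled (n : nat) (L : seq nat) (Z : treeStr) (h : 'I_n -> Z) : Prop :=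
  bijective h /\ forall i j k l : 'I_n, uniq [:: i; j; k; l] ->
    qsep (h i) (h j) (h k) (h l) = split_by (level L) i j k l.

Lemma uniq4_perm (T : eqType) (x1 x2 y1 y2 : T) : uniq [:: x1; x2; y1; y2] ->
  uniq [:: x1; y1; x2; y2] /\ uniq [:: x1; y2; x2; y1].
Proof.
rewrite /= !inE !negb_or -!andbA => /and5P[-> -> ->] x2y1 /and3P[x2y2 y12 _].
by rewrite ![y2 == _]eq_sym x2y2 [y1 == x2]eq_sym x2y1 y12.
Qed.

(** It is enough to check the separations that the levels predict: of the three
    pairings of four points at most one is separated. *)
Lemma modelled_intro n L (Z : treeStr) (h : 'I_n -> Z) : bijective h ->
  (forall i j k l : 'I_n, uniq [:: i; j; k; l] -> below (level L) i j k l -> qsep (h i) (h j) (h k) (h l)) ->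
  (forall i j k l : 'I_n, uniq [:: i; j; k; l] -> [|| split_by (level L) i j k l,
     split_by (level L) i k j l | split_by (level L) i l j k]) -> modelled L h.
Proof.
move=> bh pos tot; split=> // i j k l u.
have DP := qsep_separation Z.
have sp (i' j' k' l' : 'I_n) : uniq [:: i'; j'; k'; l'] -> split_by (level L) i' j' k' l' ->
    qsep (h i') (h j') (h k') (h l').
  move=> u' /orP[/pos->//|/pos h']; rewrite (sep_swap DP) h' //.
  by rewrite -(rot_uniq 2) /= in u' *.
have [u1 u2] := uniq4_perm u.
apply/idP/idP => [D1|]; last exact: sp.
case/or3P: (tot _ _ _ _ u) => // [/(sp _ _ _ _ u1) D2|/(sp _ _ _ _ u2) D2]; sep_absurd DP D1 D2.
Qed.

Lemma modelled_iso n L (Z Z' : treeStr) (h : 'I_n -> Z) (h' : 'I_n -> Z') m :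
  modelled L h -> modelled L h' -> pcls (h m) = pcls (h' m).
Proof.
move=> [bh hE] [bh' h'E]; have [g hK gK] := bh; have [g' h'K g'K] := bh'.
pose f z := h' (g z).
have finj : injective f by apply: inj_comp (bij_inj bh') (can_inj gK).
have u4 (x1 x2 y1 y2 : Z) : uniq [:: x1; x2; y1; y2] = uniq [:: g x1; g x2; g y1; g y2].
  by rewrite -(map_inj_uniq (can_inj gK)).
have uf (x1 x2 y1 y2 : Z) : uniq [:: f x1; f x2; f y1; f y2] = uniq [:: x1; x2; y1; y2].
  by rewrite -(map_inj_uniq finj).
have fE x y z w : uniq [:: x; y; z; w] -> qsep (f x) (f y) (f z) (f w) = qsep x y z w.
  move=> u; have u' := u; rewrite u4 in u'.
  by rewrite /f h'E // -hE // !gK.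
have fR x1 x2 y1 y2 : qrel x1 x2 y1 y2 <-> qrel (f x1) (f x2) (f y1) (f y2).
  rewrite !qrel_qsep uf; split=> -[u]; have [u1 u2] := uniq4_perm u; by rewrite !fE.
pose e := Embedding finj fR.
have be : bijective e by exists (fun z => h (g' z)) => z; rewrite /= /f ?h'K ?hK ?gK ?g'K.
by have [-> _] := pcls_iso (h m) be; rewrite /= /f hK.
Qed.

Section ModelWeight.
Variables (n : nat) (L : seq nat) (Z : treeStr) (h : 'I_n -> Z).
Hypothesis hM : modelled L h.

Definition model_sep (i j k l : 'I_n) : bool := qsep (h i) (h j) (h k) (h l).

Lemma model_inj : injective h. Proof. exact: bij_inj (proj1 hM). Qed.

Lemma model_separation : separation [set: 'I_n] model_sep.
Proof.
have := separation_pull (P := [set: 'I_n]) (f := h) (qsep_separation Z) (fun x _ => in_setT _).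
by apply: separation_ext => x y z w; rewrite cutE // in_setT.
Qed.

Lemma model_same i j : same model_sep i j = (i == j).
Proof. by rewrite /same /model_sep -/(same (@qsep Z) _ _) qsep_same (inj_eq model_inj). Qed.

Lemma model_weight (A : pzSemiRingType) (t : nat -> nat -> A) (S : {set 'I_n}) m :
  weight t (@qsep Z) (h @: S) (h m) = weight t model_sep S m.
Proof.
by rewrite [RHS](weight_map (P' := [set: Z]) (f := h) (D' := @qsep Z)) ?subsetT //; apply: qsep_separation.
Qed.

Lemma model_pweight (A : pzSemiRingType) (t : nat -> nat -> A) m :
  pweight t (h m) = weight t model_sep (~: [set m]) m.
Proof.
rewrite -model_weight; congr (weight t _ _ _).
have [g hK gK] := proj1 hM; apply/setP=> z; rewrite !inE; apply/idP/imsetP => [zm|[i + ->]].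
  by exists (g z); rewrite ?gK // !inE; apply: contraNneq zm => <-; rewrite gK.
by rewrite !inE (inj_eq model_inj).
Qed.

Variables (S : {set 'I_n}) (m : 'I_n).
Hypothesis mS : m \notin S.

Lemma model_sim i j : i \in S -> j \in S -> sim model_sep S m i j =
  (i == j) || [exists d in S, [&& split_by (level L) i j m d, d != i & d != j]].
Proof.
move=> iS jS; have DP := model_separation; have [->|ij] /= := eqVneq i j.
  by apply/simP; left; rewrite model_same.
have im : i != m by apply: contraNneq mS => <-.
have jm : j != m by apply: contraNneq mS => <-.
have u4 d : d \in S -> d != i -> d != j -> uniq [:: i; j; m; d].
  move=> dS di dj; rewrite /= !inE !negb_or ij im jm [i == d]eq_sym [j == d]eq_sym di dj /=.
  by rewrite andbT; apply: contraNneq mS => ->.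
apply/simP/exists_inP => [[|[d dS Dd]]|[d dS /and3P[Dd di dj]]].
- by rewrite model_same (negPf ij).
- have di : d != i by apply/eqP => E; rewrite E (sep_irr4 DP) in Dd.
  have dj : d != j by apply/eqP => E; rewrite E (sep_irr3 DP) in Dd.
  by exists d => //; rewrite -(proj2 hM) ?u4 // di dj !andbT.
- by right; exists d => //; rewrite /model_sep (proj2 hM) ?u4.
Qed.

Lemma model_unrealized : ~~ realized model_sep S m.
Proof. by apply/exists_inP => -[x xS]; rewrite model_same => /eqP E; move: mS; rewrite E xS. Qed.

(** The points [c1] and [c2] represent the two classes; a class is a singleton when it
    consists of its representative. *)
Lemma weight_two_classes (A : pzSemiRingType) (t : nat -> nat -> A) (f : pred 'I_n) c1 c2 :
  {in S &, forall i j, sim model_sep S m i j = (f i == f j)} ->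
  c1 \in S -> f c1 -> c2 \in S -> ~~ f c2 ->
  weight t model_sep S m = t 2 ([forall x in S, f x ==> (x == c1)]
    + [forall x in S, ~~ f x ==> (x == c2)]).
Proof.
move=> fE c1S fc1 c2S fc2; rewrite /weight (negPf model_unrealized) (class_num_bool fE).
have -> : [exists x in S, f x] by apply/exists_inP; exists c1.
have -> : [exists x in S, ~~ f x] by apply/exists_inP; exists c2.
have loneE c : c \in S -> (c \in lonely model_sep S m) = [forall x in S, (f x == f c) ==> (x == c)].
  move=> cS; rewrite inE cS; apply: eq_forallb => x; case: (boolP (x \in S)) => // xS.
  by rewrite fE // model_same [f c == _]eq_sym [c == _]eq_sym.
rewrite /= (lonely_num_bool fE); congr (t 2 (_ + _)); congr nat_of_bool.
  apply/exists_inP/forall_inP => [[c cl fc] x xS|al].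
    apply/implyP=> fx; have cS : c \in S by move: cl; rewrite inE => /andP[].
    move: cl; rewrite loneE // => /forall_inP al.
    have := al x xS; rewrite fx fc /= => /eqP->; have := al c1 c1S.
    by rewrite fc1 fc /= eq_sym.
  by exists c1; rewrite // loneE //; apply/forall_inP=> x /al; rewrite fc1 eqb_id.
apply/exists_inP/forall_inP => [[c cl fc] x xS|al].
  apply/implyP=> fx; have cS : c \in S by move: cl; rewrite inE => /andP[].
  move: cl; rewrite loneE // => /forall_inP al.
  have := al x xS; rewrite (negPf fx) (negPf fc) /= => /eqP->; have := al c2 c2S.
  by rewrite (negPf fc2) (negPf fc) /= eq_sym.
by exists c2; rewrite // loneE //; apply/forall_inP=> x /al; rewrite (negPf fc2) eqbF_neg.
Qed.

End ModelWeight.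

Section Flat.
Variables (n : nat) (Z : treeStr) (h : 'I_n -> Z).
Hypothesis hM : modelled [::] h.

Lemma flat_pweight (A : pzSemiRingType) (t : nat -> nat -> A) m :
  pweight t (h m) = t n.-1 (if n.-1 == 2 then 2 else 0).
Proof.
have mS : m \notin ~: [set m] by rewrite !inE eqxx.
have sE : {in ~: [set m] &, forall i j, sim (model_sep h) (~: [set m]) m i j = (i == j)}.
  move=> i j iS jS; rewrite (model_sim hM) //; case: eqP => //= _.
  by apply/exists_inP => -[d _]; rewrite /split_by /below /level !nth_nil.
have cS : #|~: [set m]| = n.-1 by rewrite cardsC1 card_ord.
rewrite (model_pweight hM) /weight (negPf (model_unrealized hM mS)).
have -> : class_num (model_sep h) (~: [set m]) m = n.-1.
  by rewrite /class_num (class_count_fun (h := id)) ?imset_id.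
case: eqP => // n2; congr (t _ _); rewrite /lonely_num.
have -> : lonely (model_sep h) (~: [set m]) m = ~: [set m].
  apply/setP=> x; rewrite inE; case: (boolP (x \in _)) => // xS.
  by apply/forall_inP=> y yS; rewrite sE // (model_same hM); apply/implyP.
by rewrite (class_count_fun (h := id)) ?imset_id // cS.
Qed.

End Flat.

Lemma modelled_flat (Z : treeStr) n (h : 'I_n -> Z) : bijective h ->
  (forall x y z w : Z, uniq [:: x; y; z; w] -> qsep x y z w = false) -> modelled [::] h.
Proof.
move=> bh flat; split=> // i j k l u; rewrite flat.
  by rewrite /split_by /below /level !nth_nil.
by rewrite -(map_inj_uniq (bij_inj bh)) in u.
Qed.

Lemma flat_pointing (Z : treeStr) (a : Z) n (m : 'I_n) : #|Z| = n ->
  exists h : 'I_n -> Z, bijective h /\ h m = a.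
Proof.
move=> Zn; subst n; pose h i := enum_val (tperm m (enum_rank a) i).
exists h; split; last by rewrite /h tpermL enum_rankK.
exists (fun z => tperm m (enum_rank a) (enum_rank z)) => x; rewrite /h ?enum_valK tpermK //.
by rewrite enum_rankK.
Qed.

Lemma exists_ord4 (P : pred 'I_4) : [exists d, P d] =
  [|| P (@Ordinal 4 0 isT), P (@Ordinal 4 1 isT), P (@Ordinal 4 2 isT) | P (@Ordinal 4 3 isT)].
Proof.
apply/existsP/idP => [[[[|[|[|[|//]]]] lt]]|]; rewrite ?(bool_irrelevance lt isT).
  by move->; rewrite ?orbT.
  by move->; rewrite ?orbT.
  by move->; rewrite ?orbT.
  by move->; rewrite ?orbT.
by do ?[case/orP]; move=> Px; eexists; exact: Px.
Qed.

Lemma exists_ord5 (P : pred 'I_5) : [exists d, P d] =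
  [|| P (@Ordinal 5 0 isT), P (@Ordinal 5 1 isT), P (@Ordinal 5 2 isT), P (@Ordinal 5 3 isT)
    | P (@Ordinal 5 4 isT)].
Proof.
apply/existsP/idP => [[[[|[|[|[|[|//]]]]] lt]]|]; rewrite ?(bool_irrelevance lt isT).
  by move->; rewrite ?orbT.
  by move->; rewrite ?orbT.
  by move->; rewrite ?orbT.
  by move->; rewrite ?orbT.
  by move->; rewrite ?orbT.
by do ?[case/orP]; move=> Px; eexists; exact: Px.
Qed.

Lemma forall_ord4 (P : pred 'I_4) : [forall d, P d] =
  [&& P (@Ordinal 4 0 isT), P (@Ordinal 4 1 isT), P (@Ordinal 4 2 isT) & P (@Ordinal 4 3 isT)].
Proof.
apply: negb_inj; rewrite negb_forall exists_ord4.
by do 3 (rewrite negb_and; congr (_ || _)).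
Qed.

Lemma forall_ord5 (P : pred 'I_5) : [forall d, P d] =
  [&& P (@Ordinal 5 0 isT), P (@Ordinal 5 1 isT), P (@Ordinal 5 2 isT), P (@Ordinal 5 3 isT)
    & P (@Ordinal 5 4 isT)].
Proof.
apply: negb_inj; rewrite negb_forall exists_ord5.
by do 4 (rewrite negb_and; congr (_ || _)).
Qed.

(** The levels of the leaves of the trees Y and Z, the marked leaf of Y being at the
    position 0 and that of Z at the position 2. *)
Definition levels_Y := [:: 0; 0; 1; 1].
Definition levels_Z := [:: 0; 0; 1; 2; 2].

(** Evaluates the weight of a point of a model from the function [f] that tells its
    two classes apart. *)
Ltac two_classes hM t f c1 c2 existsE forallE :=
  match goal with |- weight _ _ ?S ?m = _ =>
    let mS := fresh "mS" in have mS : m \notin S by [rewrite !inE eqxx ?orbT];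
    rewrite (@weight_two_classes _ _ _ _ hM _ _ mS _ t f c1 c2) ?inE //;
    [ by rewrite !forallE !inE
    | let i := fresh "i" in let j := fresh "j" in let iS := fresh "iS" in let jS := fresh "jS" in
      move=> i j iS jS; rewrite (model_sim hM mS) // existsE; move: iS jS; rewrite !inE;
      move: j; case: i => [[|[|[|[|[|//]]]]] //= ?] [[|[|[|[|[|//]]]]] //= ?]]
  end.

Section ModelValues.
Variables (A : pzSemiRingType) (t : nat -> nat -> A).

Lemma model_Y_pweight (Z : treeStr) (h : 'I_4 -> Z) : modelled levels_Y h ->
  pweight t (h (@Ordinal 4 0 isT)) = t 2 1.
Proof.
move=> hM; rewrite (model_pweight hM).
two_classes hM t (fun i : 'I_4 => val i == 1) (@Ordinal 4 1 isT) (@Ordinal 4 2 isT) exists_ord4 forall_ord4.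
Qed.

(** Besides the marked leaf of Z, the weights of an end leaf and of both leaves over
    the remaining three: they compute the class of a pair of leaves in both orders. *)
Lemma model_Z_weight (Z : treeStr) (h : 'I_5 -> Z) : modelled levels_Z h ->
  [/\ pweight t (h (@Ordinal 5 2 isT)) = t 2 0,
      pweight t (h (@Ordinal 5 0 isT)) = t 2 1,
      weight t (@qsep Z) (h @: (~: [set @Ordinal 5 0 isT; @Ordinal 5 2 isT])) (h (@Ordinal 5 0 isT)) = t 2 1 &
      weight t (@qsep Z) (h @: (~: [set @Ordinal 5 0 isT; @Ordinal 5 2 isT])) (h (@Ordinal 5 2 isT)) = t 2 1].
Proof.
move=> hM; rewrite !(model_pweight hM) !(model_weight h); split.
- two_classes hM t (fun i : 'I_5 => val i <= 1) (@Ordinal 5 1 isT) (@Ordinal 5 3 isT) exists_ord5 forall_ord5.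
- two_classes hM t (fun i : 'I_5 => val i == 1) (@Ordinal 5 1 isT) (@Ordinal 5 3 isT) exists_ord5 forall_ord5.
- two_classes hM t (fun i : 'I_5 => val i == 1) (@Ordinal 5 1 isT) (@Ordinal 5 3 isT) exists_ord5 forall_ord5.
- two_classes hM t (fun i : 'I_5 => val i == 1) (@Ordinal 5 1 isT) (@Ordinal 5 3 isT) exists_ord5 forall_ord5.
Qed.

End ModelValues.

(** * The marked trees *)

Section ConcreteTree.
Variables (V : finType) (e : rel V) (eT : is_tree e).

(** Two pairs of leaves are separated as soon as one edge lies on all four paths from
    one pair to the other. *)
Lemma edge_qsep (p q : V) (x y z w : leafStr eT) : e p q -> uniq [:: x; y; z; w] ->
  side e p q (val x) -> side e p q (val y) ->
  side e q p (val z) -> side e q p (val w) -> qsep x y z w.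
Proof.
move=> epq u sx sy; have eqp : e q p by rewrite (tree_sym eT).
rewrite (sideC eT _ epq) => sz; rewrite (sideC eT _ epq) => sw.
have uE (T : eqType) (f : leafStr eT -> T) : injective f -> forall a b c d,
    uniq [:: a; b; c; d] -> uniq [:: f a; f b; f c; f d].
  by move=> fi a b c d; rewrite -(map_inj_uniq fi).
have R (a b c d : leafStr eT) : uniq [:: a; b; c; d] ->
    side e p q (val a) != side e p q (val b) -> side e p q (val c) != side e p q (val d) ->
    qrel a b c d.
  move=> u' ab cd; apply/(path_relP eT); split; last by exists p, q.
  exact: (uE _ val val_inj).
have [u1 u2] := uniq4_perm u.
have u3 : uniq [:: x; w; y; z].
  by move: u; rewrite /= !inE !negb_or -!andbA => /and5P[-> -> -> yz /and3P[yw zw _]];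
     rewrite yz ![w == _]eq_sym yw zw.
have /qrel_qsep[_ [//|D1]] : qrel x z y w by apply: R => //; rewrite ?sx ?sy ?(negPf sz) ?(negPf sw).
have /qrel_qsep[_ [D2|D2]] : qrel x w y z by apply: R => //; rewrite ?sx ?sy ?(negPf sz) ?(negPf sw).
  sep_sym (qsep_separation (leafStr eT)) D2.
sep_absurd (qsep_separation (leafStr eT)) D1 D2.
Qed.

End ConcreteTree.

Lemma side_edge (V : finType) (e : rel V) p q x y : side e p q x -> e x y ->
  ~~ ((x == p) && (y == q) || (x == q) && (y == p)) -> side e p q y.
Proof. by move=> sx exy N; apply: (connect_trans sx); apply: connect1; rewrite /cut_edge exy. Qed.

(** Two disjoint pairs of leaves cannot both be disconnected by an edge that cuts off
    a single leaf. *)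
Lemma leaf_edges_flat (V : finType) (e : rel V) (eT : is_tree e) :
  (forall p q, e p q -> #|[set y | e p y]| = 1 \/ #|[set y | e q y]| = 1) ->
  forall x y z w : leafStr eT, uniq [:: x; y; z; w] -> qsep x y z w = false.
Proof.
move=> eL; have NR (x1 x2 y1 y2 : leafStr eT) : ~ qrel x1 x2 y1 y2.
  case/(path_relP eT) => u [p [q [epq]]].
  have eqp : e q p by rewrite (tree_sym eT).
  have leaf_end a b : e a b -> #|[set y | e b y]| = 1 ->
      side e a b (val x1) != side e a b (val x2) ->
      side e a b (val y1) != side e a b (val y2) -> False.
    move=> eab /eqP/cards1P[w wE].
    have wa : a = w by apply/set1P; rewrite -wE inE (tree_sym eT).
    rewrite -wa in wE; rewrite !(leaf_side _ wE).
    move: u; rewrite /= !inE !negb_or -!andbA => /and5P[x12 x1y1 x1y2 x2y1 /and3P[x2y2 y12 _]].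
    have [E|_] := eqVneq (val x1) b; have [E'|_] := eqVneq (val x2) b => // _.
      by rewrite -E ![_ == val x1]eq_sym (negPf x1y1) (negPf x1y2).
    by rewrite -E' ![_ == val x2]eq_sym (negPf x2y1) (negPf x2y2).
  case: (eL _ _ epq) => c1; last exact: leaf_end.
  by rewrite !(sideC eT _ eqp) !(inj_eq negb_inj); apply: leaf_end.
move=> x y z w u; apply/negP => D; have [u1 u2] := uniq4_perm u.
by apply: (NR x z y w); apply/qrel_qsep; split=> //; left.
Qed.

Lemma star_flat n x y z w : uniq [:: x; y; z; w] -> @qsep (leafStr (star_is_tree n)) x y z w = false.
Proof.
apply: leaf_edges_flat => -[i|] [j|] // _; [left|right]; apply/eqP/cards1P;
  exists None; by apply/setP=> -[?|]; rewrite !inE.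
Qed.

Lemma few_flat (Z : treeStr) : #|Z| <= 3 ->
  forall x y z w : Z, uniq [:: x; y; z; w] -> qsep x y z w = false.
Proof.
move=> Z3 x y z w u; have := max_card [in [:: x; y; z; w]].
by rewrite (card_uniqP u) /= => /leq_trans/(_ Z3).
Qed.

Lemma point_card : #|leafStr point_is_tree| = 1.
Proof.
apply/eqP/fintype1P; exists (exist _ tt point_leaf) => -[[] l]; exact: val_inj.
Qed.

Lemma segment_card : #|leafStr segment_is_tree| = 2.
Proof.
rewrite card_sig (eq_card (B := {: bool})) ?card_bool // => b; rewrite !inE.
apply/orP/or_introl/cards1P; exists (~~ b); apply/setP=> c; rewrite !inE.
by case: b c => [] [].
Qed.

Lemma star_card n : 1 <= n -> #|leafStr (star_is_tree n)| = n.+1.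
Proof.
move=> n1; rewrite card_sig; transitivity #|Some @: [set: 'I_n.+1]|; last first.
  by rewrite card_imset ?cardsT ?card_ord //; apply: Some_inj.
apply: eq_card => x; rewrite inE; apply/idP/imsetP => [|[i _ ->]].
  case: x => [i|]; first by exists i.
  case/orP=> [|]; last by rewrite card_option card_ord.
  case/cards1P=> w wE.
  have : Some ord0 \in [set w] by rewrite -wE inE.
  have : Some (@Ordinal n.+1 1 n1) \in [set w] by rewrite -wE inE.
  by rewrite !inE => /eqP<- /eqP[].
apply/orP/or_introl/cards1P; exists None; apply/setP=> -[?|]; by rewrite !inE.
Qed.

Lemma X_card m : 0 < m -> #|leafStr (mt_tree (X_tree m))| = m.
Proof. by case: m => [|[|[|m]]] // _; [apply: point_card|apply: segment_card|apply: star_card]. Qed.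

Lemma X_flat m x y z w : uniq [:: x; y; z; w] ->
  @qsep (leafStr (mt_tree (X_tree m))) x y z w = false.
Proof.
case: m x y z w => [|[|[|m]]]; try by apply: few_flat; rewrite ?point_card ?segment_card.
exact: star_flat.
Qed.

Lemma X_modelled m (lt0 : 0 < m) : exists h : 'I_m -> leafStr (mt_tree (X_tree m)),
  modelled [::] h /\ h (Ordinal lt0) = mark (X_tree m).
Proof.
have [h [bh hm]] := flat_pointing (mark (X_tree m)) (Ordinal lt0) (X_card lt0).
by exists h; split=> //; apply: modelled_flat bh (@X_flat m).
Qed.

Lemma nth_bij (Z : finType) (z0 : Z) n (s : seq Z) : uniq s -> size s = n -> #|Z| = n ->
  bijective (fun i : 'I_n => nth z0 s i).
Proof.
move=> us sn Zn; apply: inj_card_bij; last by rewrite card_ord Zn.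
by move=> i j /eqP; rewrite nth_uniq ?sn // => /eqP/val_inj.
Qed.

Section ListModel.
Variable Z : treeStr.
Let DP := qsep_separation Z.

Lemma Y_model (a p q r : Z) : uniq [:: a; p; q; r] -> #|Z| = 4 -> qsep a p q r ->
  modelled levels_Y (fun i : 'I_4 => nth a [:: a; p; q; r] i).
Proof.
move=> u Z4 D; apply: modelled_intro; first exact: nth_bij.
  move=> [[|[|[|[|//]]]] ?] [[|[|[|[|//]]]] ?] // [[|[|[|[|//]]]] ?] // [[|[|[|[|//]]]] ?] // _ _ /=;
  sep_sym DP D.
by move=> [[|[|[|[|//]]]] ?] [[|[|[|[|//]]]] ?] // [[|[|[|[|//]]]] ?] // [[|[|[|[|//]]]] ?].
Qed.

Lemma Z_model (p q a r s : Z) : uniq [:: p; q; a; r; s] -> #|Z| = 5 ->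
  qsep p q r s -> qsep a q r s -> qsep a p r s -> qsep a r p q -> qsep a s p q ->
  modelled levels_Z (fun i : 'I_5 => nth a [:: p; q; a; r; s] i).
Proof.
move=> u Z5 D1 D2 D3 D4 D5; apply: modelled_intro; first exact: nth_bij.
  move=> [[|[|[|[|[|//]]]]] ?] [[|[|[|[|[|//]]]]] ?] // [[|[|[|[|[|//]]]]] ?] //
    [[|[|[|[|[|//]]]]] ?] // _ _ /=;
  first [sep_sym DP D1|sep_sym DP D2|sep_sym DP D3|sep_sym DP D4|sep_sym DP D5].
by move=> [[|[|[|[|[|//]]]]] ?] [[|[|[|[|[|//]]]]] ?] // [[|[|[|[|[|//]]]]] ?] //
    [[|[|[|[|[|//]]]]] ?].
Qed.

End ListModel.

Lemma leaf_of_neighbour (V : finType) (e : rel V) x w : e x =1 pred1 w -> leaf e x.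
Proof. by move=> E; apply/orP/or_introl/cards1P; exists w; apply/setP=> y; rewrite !inE E. Qed.

Lemma node_of_neighbours (V : finType) (e : rel V) x y z : e x y -> e x z -> y != z -> ~~ leaf e x.
Proof.
move=> xy xz yz; apply/norP; split.
  apply: contra yz => /cards1P[w E]; have : y \in [set w] by rewrite -E inE.
  have : z \in [set w] by rewrite -E inE.
  by rewrite !inE => /eqP-> /eqP->.
by apply: contra yz => /eqP/fintype1[w E]; rewrite (E y) (E z).
Qed.

Lemma Y_leaves (x : 'I_6) : leaf Y_edge x = (2 <= x).
Proof.
case: x => [[|[|[|[|[|[|//]]]]]] lt]; rewrite /=.
- by apply/negbTE/(@node_of_neighbours _ _ _ (@Ordinal 6 1 isT) (@Ordinal 6 2 isT)).
- by apply/negbTE/(@node_of_neighbours _ _ _ (@Ordinal 6 4 isT) (@Ordinal 6 5 isT)).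
- by apply: (@leaf_of_neighbour _ _ _ (@Ordinal 6 0 isT)) => -[[|[|[|[|[|[|//]]]]]] ?].
- by apply: (@leaf_of_neighbour _ _ _ (@Ordinal 6 0 isT)) => -[[|[|[|[|[|[|//]]]]]] ?].
- by apply: (@leaf_of_neighbour _ _ _ (@Ordinal 6 1 isT)) => -[[|[|[|[|[|[|//]]]]]] ?].
- by apply: (@leaf_of_neighbour _ _ _ (@Ordinal 6 1 isT)) => -[[|[|[|[|[|[|//]]]]]] ?].
Qed.

Lemma Z_leaves (x : 'I_8) : leaf Z_edge x = (3 <= x).
Proof.
case: x => [[|[|[|[|[|[|[|[|//]]]]]]]] lt]; rewrite /=.
- by apply/negbTE/(@node_of_neighbours _ _ _ (@Ordinal 8 3 isT) (@Ordinal 8 4 isT)).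
- by apply/negbTE/(@node_of_neighbours _ _ _ (@Ordinal 8 0 isT) (@Ordinal 8 2 isT)).
- by apply/negbTE/(@node_of_neighbours _ _ _ (@Ordinal 8 6 isT) (@Ordinal 8 7 isT)).
- by apply: (@leaf_of_neighbour _ _ _ (@Ordinal 8 0 isT)) => -[[|[|[|[|[|[|[|[|//]]]]]]]] ?].
- by apply: (@leaf_of_neighbour _ _ _ (@Ordinal 8 0 isT)) => -[[|[|[|[|[|[|[|[|//]]]]]]]] ?].
- by apply: (@leaf_of_neighbour _ _ _ (@Ordinal 8 1 isT)) => -[[|[|[|[|[|[|[|[|//]]]]]]]] ?].
- by apply: (@leaf_of_neighbour _ _ _ (@Ordinal 8 2 isT)) => -[[|[|[|[|[|[|[|[|//]]]]]]]] ?].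
- by apply: (@leaf_of_neighbour _ _ _ (@Ordinal 8 2 isT)) => -[[|[|[|[|[|[|[|[|//]]]]]]]] ?].
Qed.

Lemma Y_card : #|leafStr Y_is_tree| = 4.
Proof.
rewrite card_sig (eq_card (B := [pred x : 'I_6 | 2 <= x])) => [|x]; last by rewrite !inE Y_leaves.
by rewrite -sum1_card big_mkcond /= !big_ord_recl big_ord0.
Qed.

Lemma Z_card : #|leafStr Z_is_tree| = 5.
Proof.
rewrite card_sig (eq_card (B := [pred x : 'I_8 | 3 <= x])) => [|x]; last by rewrite !inE Z_leaves.
by rewrite -sum1_card big_mkcond /= !big_ord_recl big_ord0.
Qed.

Lemma Y_modelled : exists h : 'I_4 -> leafStr Y_is_tree,
  modelled levels_Y h /\ h (@Ordinal 4 0 isT) = mark Y_tree.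
Proof.
pose v k (lt : k < 6) : 'I_6 := Ordinal lt.
pose l k (lt : k < 6) (ge : 2 <= k) : leafStr Y_is_tree :=
  exist (fun x => leaf Y_edge x) (v k lt) (etrans (Y_leaves (v k lt)) ge).
pose a := l 2 isT isT; pose p := l 3 isT isT; pose q := l 4 isT isT; pose r := l 5 isT isT.
exists (fun i : 'I_4 => nth a [:: a; p; q; r] i); split; last exact: val_inj.
apply: Y_model; [by []|exact: Y_card|].
apply: (@edge_qsep _ _ _ (v 1 isT) (v 0 isT)) => //;
  by apply: side_edge (side_refl _ _ _) _ _.
Qed.

Lemma Z_modelled : exists h : 'I_5 -> leafStr Z_is_tree,
  modelled levels_Z h /\ h (@Ordinal 5 2 isT) = mark Z_tree.
Proof.
pose v k (lt : k < 8) : 'I_8 := Ordinal lt.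
pose l k (lt : k < 8) (ge : 3 <= k) : leafStr Z_is_tree :=
  exist (fun x => leaf Z_edge x) (v k lt) (etrans (Z_leaves (v k lt)) ge).
pose p := l 3 isT isT; pose q := l 4 isT isT; pose a := l 5 isT isT.
pose r := l 6 isT isT; pose s := l 7 isT isT.
exists (fun i : 'I_5 => nth a [:: p; q; a; r; s] i); split; last exact: val_inj.
have s01 (x : 'I_8) : 1 <= x -> x \notin [:: v 3 isT; v 4 isT] -> side Z_edge (v 0 isT) (v 1 isT) x.
  have s1 := side_refl Z_edge (v 0 isT) (v 1 isT).
  have s2 : side Z_edge (v 0 isT) (v 1 isT) (v 2 isT) by apply: side_edge s1 _ _.
  case: x => [[|[|[|[|[|[|[|[|//]]]]]]]] lt] // _ _; rewrite (bool_irrelevance lt isT) //;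
    first [exact: (side_edge s1)|exact: (side_edge s2)].
have s10 x : x \in [:: v 3 isT; v 4 isT] -> side Z_edge (v 1 isT) (v 0 isT) x.
  have s0 := side_refl Z_edge (v 1 isT) (v 0 isT).
  by rewrite !inE => /orP[] /eqP->; apply: (side_edge s0).
have s12 x : x \in [:: v 6 isT; v 7 isT] -> side Z_edge (v 1 isT) (v 2 isT) x.
  have s2 := side_refl Z_edge (v 1 isT) (v 2 isT).
  by rewrite !inE => /orP[] /eqP->; apply: (side_edge s2).
have s21 (x : 'I_8) : 3 <= x <= 5 -> side Z_edge (v 2 isT) (v 1 isT) x.
  have s1 := side_refl Z_edge (v 2 isT) (v 1 isT).
  have s0 : side Z_edge (v 2 isT) (v 1 isT) (v 0 isT) by apply: side_edge s1 _ _.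
  case: x => [[|[|[|[|[|[|[|[|//]]]]]]]] lt] // _; rewrite (bool_irrelevance lt isT) //;
    first [exact: (side_edge s1)|exact: (side_edge s0)].
apply: Z_model; [by []|exact: Z_card| | | | |].
- by apply: (@edge_qsep _ _ _ (v 2 isT) (v 1 isT)) => //; rewrite ?s21 ?s12.
- by apply: (@edge_qsep _ _ _ (v 2 isT) (v 1 isT)) => //; rewrite ?s21 ?s12.
- by apply: (@edge_qsep _ _ _ (v 2 isT) (v 1 isT)) => //; rewrite ?s21 ?s12.
- by apply: (@edge_qsep _ _ _ (v 0 isT) (v 1 isT)) => //; rewrite ?s01 ?s10.
- by apply: (@edge_qsep _ _ _ (v 0 isT) (v 1 isT)) => //; rewrite ?s01 ?s10.
Qed.

(** * Reduction to the marked trees *)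

(** Compares two explicit lists up to order by counting. *)
Ltac reorder :=
  let f := fresh in apply/seq.permP => f /=;
  repeat match goal with |- context [nat_of_bool (f ?x)] =>
    let n := fresh in move: (nat_of_bool (f x)) => n end; lia.

Section Irremovable.
Variables (Z : treeStr) (a : Z).
Let DP := qsep_separation Z.
Hypothesis tw : forall b, b != a -> twins a b.


Lemma twin_in (b x y z : Z) : uniq [:: a; b; x; y; z] -> qsep a x y z = qsep b x y z.
Proof.
rewrite /= !inE !negb_or -!andbA => /and5P[ab ax ay az /and4P[bx by_ bz _]].
by apply: tw; rewrite 1?eq_sym // !inE negb_or ![_ == a]eq_sym ![_ == b]eq_sym ?ax ?ay ?az ?bx ?by_ ?bz.
Qed.

(** Any point of a quartet may be exchanged for the marked one. *)
Lemma marked_quartet : (exists x y z w, uniq [:: x; y; z; w] /\ @qsep Z x y z w) ->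
  exists p q r : Z, uniq [:: a; p; q; r] /\ qsep a p q r.
Proof.
case=> x [y [z [w [u D]]]].
have perm (x' y' z' w' : Z) : perm_eq [:: x'; y'; z'; w'] [:: x; y; z; w] -> uniq [:: x'; y'; z'; w'].
  by move/perm_uniq->.
have [xa|xa] := eqVneq x a; first by exists y, z, w; rewrite -xa.
have [ya|ya] := eqVneq y a.
  exists x, z, w; rewrite -ya; split; last by sep_sym DP D.
  by apply: perm; rewrite (perm_catCA [:: y] [:: x]).
have [za|za] := eqVneq z a.
  exists w, x, y; rewrite -za; split; last by sep_sym DP D.
  by apply: perm; rewrite (perm_catC [:: z; w]).
have [wa|wa] := eqVneq w a.
  exists z, x, y; rewrite -wa; split; last by sep_sym DP D.
  by apply: perm; rewrite (perm_catC [:: w; z]) /= !perm_cons (perm_catC [:: w] [:: z]).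
have u5 : uniq [:: a; x; y; z; w].
  by rewrite cons_uniq u !inE !negb_or ![a == _]eq_sym xa ya za wa.
exists y, z, w; split; last by rewrite (twin_in u5).
have : uniq [:: x; a; y; z; w].
  by rewrite (perm_uniq (s2 := [:: a; x; y; z; w])) //; reorder.
by case/andP.
Qed.

(** Exchanging [a] for [p] gives a split quartet without [a], and exchanging any point of
    the latter for [a] gives the quartets of a caterpillar with [a] in the middle. *)
Lemma five_points (p q r s : Z) : uniq [:: p; q; a; r; s] -> qsep a q r s ->
  [/\ qsep p q r s, qsep a p r s, qsep a r p q & qsep a s p q].
Proof.
move=> u D.
have u' l : perm_eq l [:: p; q; a; r; s] -> uniq l by move/perm_uniq->.
have D1 : qsep p q r s by rewrite -(@twin_in p) // u' //; reorder.
have D2 : qsep a p r s.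
  by rewrite (@twin_in q) ?u' //; [sep_sym DP D1|reorder].
have D3 : qsep a s p q.
  by rewrite (@twin_in r) ?u' //; [sep_sym DP D1|reorder].
have D4 : qsep a r p q.
  by rewrite (@twin_in s) ?u' //; [sep_sym DP D1|reorder].
by split.
Qed.

(** With two further points [p] and [t], exchanging [a] for [p] in the caterpillar of [t]
    puts [p] on the side of [s], and exchanging [a] for [t] in the caterpillar of [p]
    puts [p] on the side of [q]. *)
Lemma six_points (p q r s t : Z) : uniq [:: p; q; a; r; s; t] -> ~~ qsep a q r s.
Proof.
move=> u; apply/negP => D.
have up : uniq [:: p; q; a; r; s] by move: u; rewrite -[[:: _; _; _; _; _; _]]/(rcons [:: p; q; a; r; s] t) rcons_uniq => /andP[].
have ut : uniq [:: t; q; a; r; s].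
  by have : uniq [:: p; t; q; a; r; s] by [rewrite (perm_uniq (s2 := [:: p; q; a; r; s; t])) //; reorder]; case/andP.
have [D1 _ D3 D4] := five_points up D; have [D1' _ D3' D4'] := five_points ut D.
have E1 : qsep p s t q.
  rewrite -(@twin_in p) //.
  by have : uniq [:: r; a; p; s; t; q] by [rewrite (perm_uniq (s2 := [:: p; q; a; r; s; t])) //; reorder]; case/andP.
have E2 : qsep t s p q.
  rewrite -(@twin_in t) //.
  by have : uniq [:: r; a; t; s; p; q] by [rewrite (perm_uniq (s2 := [:: p; q; a; r; s; t])) //; reorder]; case/andP.
sep_absurd DP E1 E2.
Qed.

(** If no point can be told from [a], then no quartet is split, or there are four
    points, or there are five points that form the caterpillar of [five_points]: these
    are the trees X, Y and Z with their marks. *)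
Lemma irremovable_cases :
  [\/ forall x y z w : Z, uniq [:: x; y; z; w] -> qsep x y z w = false,
      exists h : 'I_4 -> Z, modelled levels_Y h /\ h (@Ordinal 4 0 isT) = a |
      exists h : 'I_5 -> Z, modelled levels_Z h /\ h (@Ordinal 5 2 isT) = a].
Proof.
have [ex|Nex] := pselect (exists x y z w : Z, uniq [:: x; y; z; w] /\ qsep x y z w); last first.
  constructor 1 => x y z w u; apply/negP => D; apply: Nex; by exists x, y, z, w.
have [q [r [s [u D]]]] := marked_quartet ex.
have [/forallP all4|] := boolP [forall x : Z, x \in [:: a; q; r; s]].
  constructor 2; exists (fun i : 'I_4 => nth a [:: a; q; r; s] i); split=> //.
  apply: Y_model => //; rewrite -(eq_card (A := [in [:: a; q; r; s]])) ?(card_uniqP u) //.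
case/forallPn=> p pN.
have up : uniq [:: p; a; q; r; s] by rewrite cons_uniq pN.
have up' : uniq [:: p; q; a; r; s].
  by rewrite (perm_uniq (s2 := [:: p; a; q; r; s])) //; reorder.
have [D1 D2 D3 D4] := five_points up' D.
constructor 3; exists (fun i : 'I_5 => nth a [:: p; q; a; r; s] i); split=> //.
apply: Z_model => //; rewrite -(eq_card (A := [in [:: p; q; a; r; s]])) ?(card_uniqP up') // => t.
apply/negPn/negP => tN.
have ut : uniq [:: t; p; q; a; r; s] by rewrite cons_uniq tN.
suff /six_points/negP : uniq [:: p; q; a; r; s; t] by apply.
by rewrite (perm_uniq (s2 := [:: t; p; q; a; r; s])) //; reorder.
Qed.

End Irremovable.

Definition tree_value (k s : nat) : Theta :=
  match k, s with
  | 2, 0 => marked_cls Z_tree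
  | 2, 1 => marked_cls Y_tree
  | _, _ => marked_cls (X_tree k.+1)
  end.

(** Points that can be told from [a] are deleted until none is left; what remains is one
    of the marked trees. *)
Lemma pcls_value (Z : treeStr) (a : Z) : pcls a = pweight tree_value a.
Proof.
have [n] := ubnP #|Z|; elim: n Z a => // n IH Z a; rewrite ltnS => Zn.
have [tw|] := pselect (forall b, b != a -> twins a b); last first.
  move=> N; have [b [ba Ntw]] : exists b, exists ba : b != a, ~ twins a b.
    by apply: contrapT => Nex; apply: N => b ba; apply: contrapT => Ntw; apply: Nex; exists b, ba.
  have [-> we] := removable_step ba Ntw; rewrite we; apply: IH.
  by apply: leq_trans Zn; rewrite card_sig -[X in _ < X](cardC (pred1 b)) card1 add1n.
case: (irremovable_cases tw) => [flat|[h [hM <-]]|[h [hM <-]]].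
- have Z0 : 0 < #|Z| by apply/card_gt0P; exists a.
  have [h [bh ha]] := flat_pointing a (Ordinal Z0) erefl.
  have hM := modelled_flat bh flat; have [h' [hM' ha']] := X_modelled Z0.
  rewrite -ha (modelled_iso _ hM hM') ha' -marked_pcls (flat_pweight hM).
  have -> : #|Z| = #|Z|.-1.+1 by rewrite prednK.
  by rewrite [X in tree_value X]/=; case: #|Z|.-1 => [|[|[|k]]].
- have [h' [hM' ha']] := Y_modelled.
  by rewrite (modelled_iso _ hM hM') ha' -(marked_pcls Y_tree) (model_Y_pweight _ hM).
have [h' [hM' ha']] := Z_modelled.
rewrite (modelled_iso _ hM hM') ha' -(marked_pcls Z_tree).
by have [-> _ _ _] := model_Z_weight tree_value hM.
Qed.

(** * The measure given by the classes *)

Local Open Scope ring_scope.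

Lemma cls_one_point (X Z : treeStr) (j : embedding X Z) (a : Z) :
  a |: (j @: [set: X]) = [set: Z] -> cls j = weight tree_value (@qsep Z) (j @: [set: X]) a.
Proof.
move=> jZ; have [aj|aj] := boolP (a \in j @: [set: X]).
  have r : realized (@qsep Z) (j @: [set: X]) a.
    by apply/exists_inP; exists a => //; rewrite qsep_same.
  have jT : j @: [set: X] = [set: Z] by rewrite -jZ; apply/esym/setUidPr; rewrite sub1set.
  have bj : bijective j.
    apply: inj_card_bij (@emb_inj _ _ j) _.
    by rewrite -cardsT -jT card_imset ?cardsT //; apply: (@emb_inj _ _ j).
  by rewrite /weight r; exact: (cls_iso bj).
have jE : j @: [set: X] = ~: [set a].
  apply/setP=> z; have := in_setT z; rewrite -jZ !inE.
  by have [->|] //= := eqVneq z a; rewrite ?(negPf aj).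
rewrite jE -/(pweight tree_value a) -pcls_value.
have ja x : j x != a by apply: contraNneq aj => <-; rewrite imset_f.
pose g x : punct a := pt (ja x).
have gi : injective g by move=> x y gxy; apply: (@emb_inj _ _ j); exact: (congr1 val gxy).
pose ge : embedding X (punct a) := Embedding gi (fun x1 x2 y1 y2 => emb_rel j x1 x2 y1 y2).
have bg : bijective ge.
  apply: (inj_card_bij gi).
  have -> : #|punct a| = #|~: [set a]| by rewrite card_sig; apply: eq_card => x; rewrite !inE.
  by rewrite -jE card_imset ?cardsT //; apply: (@emb_inj _ _ j).
pose he : embedding Z Z := Embedding (@inj_id _) (fun _ _ _ _ => iff_refl _).
have bh : bijective he by exists id.
exact: (cls_square bg bh).
Qed.

Section TwoPoints.
Variables (Z : treeStr) (a b : Z) (ba : b != a).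

(** The class of the inclusion of the complement of two points, computed by removing
    them in the two possible orders. *)
Lemma two_points : pcls b * pcls (rest_point ba) = pcls a * pcls (mark_point ba).
Proof.
have -> : pcls (mark_point ba) = cls (rest_emb ba).
  rewrite (cls_one_point (a := mark_point ba)) ?rest_image ?setUCr //.
  by rewrite -/(pweight tree_value _) pcls_value.
have E : emb_comp (drop_emb b) (drop_emb (rest_point ba)) = emb_comp (drop_emb a) (rest_emb ba).
  exact: embedding_ext.
apply: etrans (esym (cls_comp _ _)) (etrans _ (cls_comp _ _)).
exact: congr1 E.
Qed.

Lemma punct_weight (A : pzSemiRingType) (t : nat -> nat -> A) (c x : Z) (xc : x != c) :
  pweight t (pt xc) = weight t (@qsep Z) (~: [set c; x]) x.
Proof.
have E : drop_emb c @: (~: [set pt xc]) = ~: [set c; x].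
  apply/setP=> z; rewrite !inE negb_or; apply/imsetP/andP => [[y + ->]|[zc zx]].
    by rewrite !inE -val_eqE /= => ->; split; first exact: (valP y).
  by exists (pt zc); rewrite // !inE -val_eqE.
rewrite /pweight -E (weight_map (P' := [set: Z]) (f := drop_emb c) (D' := @qsep Z)) ?subsetT //.
exact: qsep_separation.
Qed.

End TwoPoints.

(** The relation of [Theta] for the amalgams of a one-point extension with itself: the
    two new points have the same type, and [lifts_same_type] counts the amalgams. *)
Lemma self_amalgam (Z : treeStr) (a : Z) k s :
  (forall t : nat -> nat -> nat, pweight t a = t k (if k == 2%N then s else 0%N)) ->
  tree_value k (if k == 2%N then s else 0%N) = type_step tree_value k s.
Proof.
move=> typ; have iE := skel_image (drop_image a).
have aN : ~~ realized (@qsep Z) (~: [set a]) a.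
  by apply/exists_inP => -[x]; rewrite !inE qsep_same eq_sym => /negPf->.
have cn : class_num (@qsep Z) (~: [set a]) a = k.
  by have := typ (fun k _ => k); rewrite /pweight /weight (negPf aN).
have ln : k = 2%N -> lonely_num (@qsep Z) (~: [set a]) a = s.
  by move=> k2; have := typ (fun _ s => s); rewrite /pweight /weight (negPf aN) cn k2 eqxx.
have := @pair_twin_sum _ _ _ _ _ _ _ iE iE tree_value (fun x y z => erefl).
have [-> ->] := skel_num (drop_emb a) a; rewrite drop_image cn => H.
have <- : type_step tree_value k (lonely_num (@qsep Z) (~: [set a]) a) = type_step tree_value k s.
  by case: k ln {H cn typ} => [|[|[|k]]] // ->.
rewrite -H => [|am].
  have -> : scls (skel_emb (drop_emb a)) = pcls a by [].
  rewrite pcls_value /pweight /weight (negPf aN) cn.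
  by case: eqP => // k2; rewrite ln.
rewrite -cls_scls; apply: cls_one_point; apply/setP=> z; rewrite in_setT !inE.
case: (am_surj z) => -[y <-]; last by rewrite imset_f ?orbT.
have [->|ya] := eqVneq y (rank_emb Z a); first by rewrite eqxx.
have : y \in skel_emb (drop_emb a) @: [set: skel_of (punct a)] by rewrite iE !inE.
by case/imsetP=> x _ ->; rewrite am_comm imset_f ?orbT.
Qed.

(** Each marked tree provides one instance of [self_amalgam]. The commutation relation
    comes from the caterpillar Z: removing the marked leaf first gives [z * y], removing
    an end leaf first gives [y * y]. *)
Lemma tree_value_measure : type_measure tree_value.
Proof.
split; last first.
  have [h [hM _]] := Z_modelled; have [e1 e2 e3 e4] := model_Z_weight tree_value hM.
  set o0 := @Ordinal 5 0 isT in e2 e3 e4; set o2 := @Ordinal 5 2 isT in e1 e3 e4.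
  have hi := bij_inj (proj1 hM).
  have ba : h o0 != h o2 by rewrite (inj_eq hi).
  have hS : h @: (~: [set o0; o2]) = ~: [set h o0; h o2].
    have [g hK gK] := proj1 hM; apply/setP=> z; rewrite !inE negb_or; apply/imsetP/andP => [[i + ->]|[z0 z2]].
      by rewrite !inE negb_or !(inj_eq hi) => /andP.
    by exists (g z); rewrite ?gK // !inE -!(inj_eq hi) gK negb_or z0.
  have hS' : h @: (~: [set o0; o2]) = ~: [set h o2; h o0] by rewrite hS setUC.
  have w1 : pcls (rest_point ba) = tree_value 2 1.
    rewrite pcls_value punct_weight -hS; exact: e4.
  have w2 : pcls (mark_point ba) = tree_value 2 1.
    rewrite pcls_value punct_weight -hS'; exact: e3.
  have w3 : pcls (h o0) = tree_value 2 1 := etrans (pcls_value _) e2.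
  have w4 : pcls (h o2) = tree_value 2 0 := etrans (pcls_value _) e1.
  have H := etrans (esym (congr2 *%R w3 w1)) (etrans (two_points ba) (congr2 *%R w4 w2)).
  move: H; move: (tree_value 2 0) (tree_value 2 1) => z y H.
  rewrite (mulrC z y) in H; exact: H.
move=> k s s2; have [k2|k2] := eqVneq k 2%N; last first.
  have [h [hM _]] := X_modelled (ltn0Sn k).
  have := @self_amalgam _ (h (Ordinal (ltn0Sn k))) k s; rewrite (negPf k2); apply.
  by move=> t; rewrite (flat_pweight hM) /= (negPf k2).
move: s2; rewrite {k}k2; case: s => [|[|[|//]]] _.
- have [h [hM _]] := Z_modelled; apply: (@self_amalgam _ (h (@Ordinal 5 2 isT)) 2 0) => t.
  by have [] := model_Z_weight t hM.
- have [h [hM _]] := Y_modelled; apply: (@self_amalgam _ (h (@Ordinal 4 0 isT)) 2 1) => t.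
  exact: (model_Y_pweight t hM).
have [h [hM _]] := X_modelled (isT : (0 < 3)%N).
apply: (@self_amalgam _ (h (@Ordinal 3 0 isT)) 2 2) => t; exact: (flat_pweight hM).
Qed.

(** * The isomorphism *)

Lemma emb_weight_drop (A : comPzRingType) (t : nat -> nat -> A) (Z : treeStr) (a : Z) :
  type_measure t -> emb_weight t (drop_emb a) = pweight t a.
Proof.
move=> tm; rewrite (emb_weight_chain tm (l := [:: a])) /= ?mulr1 ?drop_image //.
by apply/setP=> z; rewrite !inE orNb.
Qed.

(** Every embedding is a composite of isomorphisms and one-point extensions. *)
Lemma cls_value (X Y : treeStr) (i : embedding X Y) : cls i = emb_weight tree_value i.
Proof.
have tm := tree_value_measure.
have [n] := ubnP #|Y|; elim: n X Y i => // n IH X Y i; rewrite ltnS => Yn.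
have [/eqP iT|] := boolP (i @: [set: X] == [set: Y]).
  have bi : bijective i.
    apply: inj_card_bij (@emb_inj _ _ i) _.
    by rewrite -cardsT -iT card_imset ?cardsT //; apply: (@emb_inj _ _ i).
  exact: etrans (cls_iso bi) (esym (emb_weight_iso tm bi)).
rewrite -subTset => /subsetPn[a _ aN].
have ja x : i x != a by apply: contraNneq aN => <-; rewrite imset_f.
pose g x : punct a := pt (ja x).
have gi : injective g by move=> x y gxy; apply: (@emb_inj _ _ i); exact: (congr1 val gxy).
pose ge : embedding X (punct a) := Embedding gi (fun x1 x2 y1 y2 => emb_rel i x1 x2 y1 y2).
have -> : i = emb_comp (drop_emb a) ge by apply: embedding_ext.
apply: etrans (cls_comp _ _) (etrans _ (esym (emb_weight_comp tm _ _))).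
apply: congr2; first exact: etrans (pcls_value a) (esym (emb_weight_drop a tm)).
apply: IH; apply: leq_trans Yn.
by rewrite card_sig -[X in (_ < X)%N](cardC (pred1 a)) card1 add1n.
Qed.

Lemma emb_weight_skel (A : comPzRingType) (t : nat -> nat -> A) (X Y : treeStr) (i : embedding X Y) :
  type_measure t -> emb_weight t (skel_emb i) = emb_weight t i.
Proof.
move=> tm; have E : emb_comp (skel_emb i) (rank_emb X) = emb_comp (rank_emb Y) i.
  by apply: embedding_ext => x; rewrite /= /skel_fun /rank_fun enum_rankK.
move/(congr1 (@emb_weight _ t _ _)): E; rewrite !(emb_weight_comp tm).
by rewrite !(emb_weight_iso tm (rank_bij _)) mulr1 mul1r.
Qed.

Section WeightMorphism.
Variables (A B : comPzRingType) (f : {rmorphism A -> B}).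
Variables (t : nat -> nat -> A) (t' : nat -> nat -> B).
Hypothesis tE : forall k s, (s <= 2)%N ->
  f (t k (if k == 2%N then s else 0%N)) = t' k (if k == 2%N then s else 0%N).

Lemma weight_morph (W : finType) (P S : {set W}) D a : presep P D -> S \subset P ->
  f (weight t D S a) = weight t' D S a.
Proof.
move=> DP SP; rewrite /weight; case: realized; first exact: rmorph1.
case: eqP => [k2|/eqP/negPf k2].
  by have := tE (class_num D S a) (lonely_num_le2 DP SP k2); rewrite k2 eqxx.
by have := tE (class_num D S a) (leq0n 2); rewrite k2.
Qed.

Lemma emb_weight_morph (X Y : treeStr) (i : embedding X Y) :
  f (emb_weight t i) = emb_weight t' i.
Proof.
rewrite /emb_weight; elim: (enum Y) (i @: _) => [|a l IH] S /=; first exact: rmorph1.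
by rewrite rmorphM IH (weight_morph _ (qsep_separation Y)) ?subsetT.
Qed.

End WeightMorphism.

Lemma type_value_measure_uv (A : comPzRingType) (u v : A) :
  u * v = 0 -> type_measure (type_value u (u - v)).
Proof. by move=> uv; apply: type_value_measure; rewrite mulrBr uv subr0. Qed.

Lemma zuv_relation : u_ * v_ = 0.
Proof. by rewrite -rmorphM; apply: proj_gen. Qed.

Definition zuv_value := type_value u_ (u_ - v_).

Lemma zuv_value_measure : type_measure zuv_value.
Proof. exact: type_value_measure_uv zuv_relation. Qed.

Lemma rmorph_sub_eq0 (R : comNzRingType) (A : comPzRingType) (phi : {rmorphism R -> A}) x y :
  phi x = phi y -> phi (x - y) = 0.
Proof. by move=> E; rewrite rmorphB E subrr. Qed.

Definition sym_value (s : {classic symbol}) : Zuv := emb_weight zuv_value (sym_emb (s : symbol)).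

Lemma sym_value_rel x : Theta_rel x -> free_eval sym_value x = 0.
Proof.
have tm := zuv_value_measure.
have symE (X Y : skel) (i : embedding X Y) : free_eval sym_value (sym i) = emb_weight zuv_value i.
  exact: free_eval_var.
case=> [X Y i bi|X Y Z j i|X Y X' i k n s sP]; apply: rmorph_sub_eq0.
- exact: etrans (symE _ _ i) (etrans (emb_weight_iso tm bi) (esym (rmorph1 _))).
- apply: etrans (symE _ _ _) (etrans (emb_weight_comp tm j i) (esym _)).
  exact: etrans (rmorphM _ _ _) (congr2 _ (symE _ _ j) (symE _ _ i)).
apply: etrans (symE _ _ i) (etrans (emb_weight_amalg tm sP) (esym _)).
apply: etrans (raddf_sum _ _ _ _) (eq_bigr _ _) => r _; exact: symE.
Qed.

Definition theta_to_zuv : {rmorphism Theta -> Zuv} := quot_map sym_value_rel.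

Lemma theta_to_zuv_cls (X Y : treeStr) (i : embedding X Y) :
  theta_to_zuv (cls i) = emb_weight zuv_value i.
Proof.
rewrite -(emb_weight_skel i zuv_value_measure).
exact: etrans (quot_map_proj _ _) (free_eval_var _ _).
Qed.

Lemma theta_to_zuv_pcls (Z : treeStr) (a : Z) : theta_to_zuv (pcls a) = pweight zuv_value a.
Proof. exact: etrans (theta_to_zuv_cls _) (emb_weight_drop a zuv_value_measure). Qed.

Lemma type_value_morph (A B : comPzRingType) (f : {rmorphism A -> B}) (y z : A) k s :
  f (type_value y z k s) = type_value (f y) (f z) k s.
Proof.
case: k => [|[|[|k]]] /=.
- by rewrite !rmorphD rmorphN rmorph1.
- by rewrite !rmorphD rmorphN rmorph1.
- by rewrite rmorphD rmorphMn rmorphB.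
by rewrite rmorphB rmorphM rmorph_nat !rmorphD rmorphN rmorph1.
Qed.

Lemma type_value_default (A : comPzRingType) (y z : A) k s :
  type_value y z k (if k == 2%N then s else 0%N) = type_value y z k s.
Proof. by case: k => [|[|[|k]]]. Qed.

(** The images of the variables: [u] goes to the class of Y, and [v] to the difference of
    the classes of Y and Z, as [u - v] has to go to the class of Z. *)
Definition gen_value (i : 'I_2) : Theta :=
  if i == ord0 then marked_cls Y_tree else marked_cls Y_tree - marked_cls Z_tree.

Lemma mul_sub_eq0 (A : comPzRingType) (y z : A) : y * y = y * z -> y * (y - z) = 0.
Proof. by move=> E; rewrite mulrBr E subrr. Qed.

Lemma gen_value_rel x : Zuv_rel x -> free_eval gen_value x = 0.
Proof.
move->; apply: etrans (rmorphM _ _ _) _.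
apply: etrans (congr2 _ (free_eval_var _ _) (free_eval_var _ _)) _.
exact: mul_sub_eq0 (tm_comm tree_value_measure).
Qed.

Definition zuv_to_theta : {rmorphism Zuv -> Theta} := quot_map gen_value_rel.

Lemma zuv_to_theta_u : zuv_to_theta u_ = marked_cls Y_tree.
Proof. exact: etrans (quot_map_proj _ _) (free_eval_var _ _). Qed.

Lemma zuv_to_theta_v : zuv_to_theta v_ = marked_cls Y_tree - marked_cls Z_tree.
Proof. exact: etrans (quot_map_proj _ _) (free_eval_var _ _). Qed.

Lemma morph_value (A B : comPzRingType) (f : {rmorphism A -> B}) (u v : A) (y z : B)
    (t : nat -> nat -> B) : type_measure t -> t 2 1%N = y -> t 2 0%N = z ->
  f u = y -> f v = y - z -> forall k s, (s <= 2)%N ->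
  f (type_value u (u - v) k (if k == 2%N then s else 0%N)) = t k (if k == 2%N then s else 0%N).
Proof.
move=> tm <- <- fu fv k s s2; rewrite type_value_default type_value_morph.
by rewrite (type_measure_value k tm s2) rmorphB fv fu opprB addrC subrK.
Qed.

(** The composite sends the class of an embedding to its weight for a measure on types
    that takes the same values at [2 1] and [2 0] as [tree_value], hence equals it. *)
Lemma theta_to_zuvK : cancel theta_to_zuv zuv_to_theta.
Proof.
apply: (free_quot_ext (phi := zuv_to_theta \o theta_to_zuv) (psi := idfun)) => s.
case: s => X Y i.
apply: etrans (congr1 zuv_to_theta (etrans (quot_map_proj _ _) (free_eval_var _ _))) _.
apply: etrans (emb_weight_morph (morph_value tree_value_measure erefl erefl
  zuv_to_theta_u zuv_to_theta_v) i) _.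
change (emb_weight tree_value i = scls i); rewrite -cls_scls.
exact: esym (cls_value i).
Qed.

Lemma theta_to_zuv_marked (T : markedTree) :
  theta_to_zuv (marked_cls T) = pweight zuv_value (mark T).
Proof. rewrite marked_pcls; exact: theta_to_zuv_pcls. Qed.

Lemma theta_to_zuv_X m : theta_to_zuv (marked_cls (X_tree m.+1)) = type_value u_ (u_ - v_) m 2.
Proof.
apply: etrans (theta_to_zuv_marked _) _.
have [h [hM <-]] := X_modelled (ltn0Sn m).
exact: etrans (flat_pweight hM _ _) (type_value_default _ _ m 2).
Qed.

Lemma theta_to_zuv_Y : theta_to_zuv (marked_cls Y_tree) = type_value u_ (u_ - v_) 2 1.
Proof.
apply: etrans (theta_to_zuv_marked _) _.
have [h [hM <-]] := Y_modelled; exact: model_Y_pweight.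
Qed.

Lemma theta_to_zuv_Z : theta_to_zuv (marked_cls Z_tree) = type_value u_ (u_ - v_) 2 0.
Proof.
apply: etrans (theta_to_zuv_marked _) _.
have [h [hM <-]] := Z_modelled; by have [e _ _ _] := model_Z_weight zuv_value hM; exact: e.
Qed.

Section Values.
Variables (A : comPzRingType) (u v : A).

Lemma type_valueY : type_value u (u - v) 2 1 = u. Proof. by rewrite /=; ring. Qed.
Lemma type_valueZ : type_value u (u - v) 2 0 = u - v. Proof. by rewrite /=; ring. Qed.
Lemma type_value0 s : type_value u (u - v) 0 s = u + v + 2. Proof. by rewrite /=; ring. Qed.
Lemma type_value1 s : type_value u (u - v) 1 s = u + v + 1. Proof. by rewrite /=; ring. Qed.
Lemma type_value2 : type_value u (u - v) 2 2 = u + v. Proof. by rewrite /=; ring. Qed.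
Lemma type_value3 k s : type_value u (u - v) k.+3 s = v + 1 - (k.+4 - 2)%:R * (u + 1).
Proof. by rewrite /= subnE /=; ring. Qed.
End Values.

Lemma gen_value_cancel (A B : comPzRingType) (f : {rmorphism A -> B}) (y z : A) (u v : B) :
  f y = u -> f z = u - v -> f (y - z) = v.
Proof. by move=> fy fz; rewrite rmorphB fy fz opprB addrC subrK. Qed.

Lemma zuv_to_thetaK : cancel zuv_to_theta theta_to_zuv.
Proof.
apply: (free_quot_ext (phi := theta_to_zuv \o zuv_to_theta) (psi := idfun)) => i.
have [-> | ->] : i = ord0 \/ i = ord_max.
  by case: i => [[|[|//]] lt]; [left|right]; apply: val_inj.
  exact: etrans (congr1 theta_to_zuv zuv_to_theta_u) (etrans theta_to_zuv_Y (type_valueY _ _)).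
apply: etrans (congr1 theta_to_zuv zuv_to_theta_v) _.
exact: gen_value_cancel (etrans theta_to_zuv_Y (type_valueY _ _))
  (etrans theta_to_zuv_Z (type_valueZ _ _)).
Qed.

Theorem theorem3p5 :
  exists phi : {rmorphism Theta -> Zuv},
    bijective phi /\
    phi (marked_cls (X_tree 1)) = u_ + v_ + 2 /\
    phi (marked_cls (X_tree 2)) = u_ + v_ + 1 /\
    phi (marked_cls (X_tree 3)) = u_ + v_ /\
    (forall m : nat, (4 <= m)%N ->
       phi (marked_cls (X_tree m)) = v_ + 1 - (m - 2)%:R * (u_ + 1)) /\
    phi (marked_cls Y_tree) = u_ /\
    phi (marked_cls Z_tree) = u_ - v_.
Proof.
exists theta_to_zuv; split; first exact: Bijective theta_to_zuvK zuv_to_thetaK.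
split; first exact: etrans (theta_to_zuv_X 0) (type_value0 _ _ _).
split; first exact: etrans (theta_to_zuv_X 1) (type_value1 _ _ _).
split; first exact: etrans (theta_to_zuv_X 2) (type_value2 _ _).
split; last by split; [exact: etrans theta_to_zuv_Y (type_valueY _ _)|
                       exact: etrans theta_to_zuv_Z (type_valueZ _ _)].
by case=> [|[|[|[|k]]]] // _; exact: etrans (theta_to_zuv_X k.+3) (type_value3 _ _ _ _).
Qed.
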